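(* Let $G$ be a finitely generated group that splits as a graph of groups. Suppose that all edge groups are finitely generated and undistorted in $G$, and that $(\partial_M E,G)=\emptyset$ for every edge group $E$. Suppose additionally that $(\partial_M V,G)$ is totally disconnected for every vertex group $V\leq G$. Then $\partial_M G$ is totally disconnected.
   Context: The empty set is considered totally disconnected. Splittings. A finitely generated group $G$ splits as a graph of groups if it acts without inversions and without a global fixed point (non-elliptically) on a simplicial tree $T$; we fix such an action. Vertex groups are the $G$-stabilisers of vertices of $T$, and edge groups are the $G$-stabilisers of edges of $T$. A finitely generated subgroup $H\leq G$ is undistorted if the inclusion is a quasi-isometric embedding with respect to word metrics. (When all edge groups are finitely generated and undistorted in $G$, so are all vertex groups, so that $(\partial_M V,G)$ below makes sense.) Morse boundaries. A $C$-quasi-geodesic is a $(C,C)$-quasi-geodesic, i.e. a map $\gamma$ from an interval with $\frac1C|s-t|-C\leq d(\gamma(s),\gamma(t))\leq C|s-t|+C$. Let $X$ be a proper geodesic metric space. A quasi-geodesic $\gamma\subseteq X$ is $N$-Morse, for a function $N\colon[1,+\infty)\to[0,+\infty)$ (a Morse gauge), if every $C$-quasi-geodesic with endpoints on $\gamma$ is contained in the $N(C)$-neighbourhood of $\gamma$; it is Morse if it is $N$-Morse for some $N$. For a basepoint $p\in X$, $\partial_M^N X_p$ is the set of $N$-Morse geodesic rays based at $p$, identifying rays at finite Hausdorff distance, with the compact-open topology. Let $\partial_M X_p=\bigcup_N\partial_M^N X_p$, where a subset $U$ is open (resp. closed) if and only if $U\cap\partial_M^N X_p$ is open (resp. closed)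 in $\partial_M^N X_p$ for every $N$. Up to canonical homeomorphism this does not depend on $p$; it is denoted $\partial_M X$. For a finitely generated group $G$, $\partial_M G$ is the Morse boundary of a Cayley graph with respect to a finite generating set (well defined up to homeomorphism). Relative Morse boundary. Let $H\leq G$ be finitely generated groups with $H$ undistorted in $G$, and let $i\colon\Lambda\to\Gamma$ be a quasi-isometric embedding between Cayley graphs of $H$ and $G$ extending the inclusion. Then $(\partial_M H,G)$ is the subset of points $[\gamma]\in\partial_M H$ such that $i\circ\gamma$ is Morse in $\Gamma$, with the subspace topology from $\partial_M H$. *)

(* Defs.v *)
From HB Require Import structures.
From mathcomp Require Import all_boot all_order all_algebra.
From mathcomp Require Import all_classical all_reals topology.
From mathcomp Require Import ring lra.
Import Order.TTheory GRing.Theory Num.Theory.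
Import numFieldTopology.Exports.

Set Implicit Arguments.
Unset Strict Implicit.
Unset Printing Implicit Defensive.

Local Open Scope classical_set_scope.
Local Open Scope ring_scope.

Section Paths.
Variables (R : realType) (X : metricType R).

Definition path_on (I : interval R) := [set` I] -> X.

Definition quasi_geodesic (I : interval R) (C : R) (f : path_on I) :=
  forall s t : [set` I],
    C^-1 * `|\val s - \val t| - C <= mdist (f s) (f t) <=
    C * `|\val s - \val t| + C.

(* Only the values of a gauge on [1, +oo[ matter. *)
Definition morse_gauge (N : R -> R) := forall C, 1 <= C -> 0 <= N C.

(* Closed N(C)-neighbourhoods; open ones give the same class of Morse paths and
   the same direct limit topology. *)
Definition morse (N : R -> R) (I : interval R) (f : path_on I) :=
  [/\ morse_gauge N,
      (exists2 C, 1 <= C & quasi_geodesic C f) &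
      forall (C a b : R) (h : path_on `[a, b]),
        1 <= C -> a <= b -> quasi_geodesic C h ->
        (forall t, \val t = a \/ \val t = b -> exists s, h t = f s) ->
        forall t, exists s, mdist (h t) (f s) <= N C].

Definition ray := path_on `[0, +oo[.

Definition geodesic_ray (p : X) (g : ray) :=
  (forall t, \val t = 0 -> g t = p) /\
  (forall s t, mdist (g s) (g t) = `|\val s - \val t|).

(* The images of g and h are at finite Hausdorff distance. *)
Definition asymptotic (g h : ray) :=
  exists K : R, (forall s, exists t, mdist (g s) (h t) <= K) /\
                (forall t, exists s, mdist (g s) (h t) <= K).

Definition ray_class (p : X) (g : ray) : set ray :=
  [set h | geodesic_ray p h /\ asymptotic g h].

(* A point is the class, among all geodesic rays based at p, of a Morse ray. *)
Record morse_boundary (p : X) := MorseBoundary {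
  point_rays :> set ray;
  point_raysP : exists N g,
    [/\ geodesic_ray p g, morse N g & point_rays = ray_class p g]
}.

HB.instance Definition _ (p : X) := gen_eqMixin (morse_boundary p).
HB.instance Definition _ (p : X) := gen_choiceMixin (morse_boundary p).

Definition morse_rays (N : R -> R) (p : X)
    : set {compact-open, [set` `[(0 : R), +oo[ ] -> X} :=
  [set g | geodesic_ray p g /\ morse N g].

Lemma stratum_pt_subproof N p (g : morse_rays N p) :
  exists N' g', [/\ geodesic_ray p g', morse N' g' &
                    ray_class p (\val g) = ray_class p g'].
Proof. by exists N, (\val g); have [] := set_valP g. Qed.

Definition stratum_pt N p (g : morse_rays N p) : morse_boundary p :=
  MorseBoundary (stratum_pt_subproof g).

Definition stratum N p : set (morse_boundary p) := range (@stratum_pt N p).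
Arguments stratum N p : clear implicits.

(* Quotient topology on the stratum, coming from the subspace topology that
   morse_rays N p inherits from the compact-open topology. *)
Definition stratum_open N p (A : set (morse_boundary p)) :=
  open (@stratum_pt N p @^-1` A).

Definition boundary_open p : set_system (morse_boundary p) :=
  [set U | forall N, morse_gauge N -> stratum_open N (U `&` stratum N p)].

Lemma stratum_openE N p (U : set (morse_boundary p)) :
  stratum_open N (U `&` stratum N p) = open (@stratum_pt N p @^-1` U).
Proof.
rewrite /stratum_open; congr open; apply/seteqP; split => g /=; first by case.
by split=> //; exists g.
Qed.

Lemma boundary_openT p : @boundary_open p setT.
Proof. by move=> N _; rewrite stratum_openE; exact: openT. Qed.

Lemma boundary_openI p : setI_closed (@boundary_open p).
Proof.
move=> U V oU oV N gN; have := oU N gN; have := oV N gN.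
by rewrite !stratum_openE => ? ?; exact: openI.
Qed.

Lemma boundary_open_bigU p (I : Type) (f : I -> set (morse_boundary p)) :
  (forall i, boundary_open (f i)) -> boundary_open (\bigcup_i f i).
Proof.
move=> of_ N gN; rewrite stratum_openE preimage_bigcup.
by apply: bigcup_open => i _; have := of_ i N gN; rewrite stratum_openE.
Qed.

HB.instance Definition _ (p : X) :=
  isOpenTopological.Build (morse_boundary p)
    (@boundary_openT p) (@boundary_openI p) (@boundary_open_bigU p).

End Paths.

Definition qi_embedding (R : realType) (A B : Type)
    (dA : A -> A -> R) (dB : B -> B -> R) (f : A -> B) :=
  exists2 K : R, 1 <= K &
    forall x y, K^-1 * dA x y - K <= dB (f x) (f y) <= K * dA x y + K.

Record graph := Graph {
  vertex :> choiceType;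
  adj : rel vertex;
  adj_sym : symmetric adj;
  adj_irr : irreflexive adj
}.

Definition graph_connected (X : graph) :=
  forall x y : X, exists2 s, path (@adj X) x s & last x s = y.

(* ucycle: a closed path without repeated vertices.  The ones of size 2 just
   run back and forth along an edge. *)
Definition acyclic (X : graph) :=
  forall s : seq X, ucycle (@adj X) s -> (size s <= 2)%N.

Record cgraph := CGraph { cgraph_val :> graph; _ : graph_connected cgraph_val }.

Definition cgraphP (X : cgraph) : graph_connected X :=
  let: CGraph _ h := X in h.

Definition is_tree (X : graph) :=
  [/\ inhabited X, graph_connected X & acyclic X].

Section Realization.
Variable R : realType.

(* Barycentric coordinates of the point at distance t from u on the edge uv. *)
Definition edge_pt (X : graph) (u v : X) (t : R) : X -> R :=
  fun w => (1 - t) * (w == u)%:R + t * (w == v)%:R.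

Record realization (X : graph) := Realization {
  bary :> X -> R;
  baryP : exists u v t,
    [/\ (u == v) || adj u v, 0 <= t <= 1 & bary = edge_pt u v t]
}.

HB.instance Definition _ (X : graph) := gen_eqMixin (realization X).
HB.instance Definition _ (X : graph) := gen_choiceMixin (realization X).

Lemma vertex_pt_subproof (X : graph) (u : X) : exists a b t,
  [/\ (a == b) || adj a b, 0 <= t <= 1 & edge_pt u u 0 = edge_pt a b t].
Proof. by exists u, u, 0; rewrite eqxx lexx ler01. Qed.

Definition vertex_pt (X : graph) (u : X) : realization X :=
  Realization (vertex_pt_subproof u).

(* chain x y l: x and y are joined by a broken line of length l, each piece of
   which lies in a single edge of length 1. *)
Inductive chain (X : graph) : realization X -> realization X -> R -> Prop :=
| chain_nil x : chain x x 0
| chain_cons (x y z : realization X) (u v : X) (s t l : R) :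
    adj u v -> 0 <= s <= 1 -> 0 <= t <= 1 ->
    x = edge_pt u v s :> (X -> R) -> y = edge_pt u v t :> (X -> R) ->
    chain y z l -> chain x z (`|s - t| + l).

Definition length_dist (X : graph) (x y : realization X) : R :=
  inf [set l | chain x y l].

Section MetricGraph.
Variable X : cgraph.
Implicit Types (x y z : realization X) (u v : X).

Lemma realization_inj x y : x = y :> (X -> R) -> x = y.
Proof.
by case: x y => [f fP] [g gP] /= e; subst g; congr Realization; exact: Prop_irrelevance.
Qed.

Lemma chain_ge0 x y l : chain x y l -> 0 <= l.
Proof. by elim=> // *; rewrite addr_ge0. Qed.

Lemma chain_cat x y z l m : chain x y l -> chain y z m -> chain x z (l + m).
Proof.
elim=> [w|w w' w'' u v s t k uv s01 t01 ew ew' _ IH] ch; first by rewrite add0r.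
by rewrite -addrA; apply: chain_cons ew' (IH ch).
Qed.

Lemma chain_rev x y l : chain x y l -> chain y x l.
Proof.
elim=> [w|w w' w'' u v s t k uv s01 t01 ew ew' _ IH]; first exact: chain_nil.
rewrite addrC distrC; apply: chain_cat IH _; rewrite -[`|_|]addr0.
by apply: chain_cons ew' ew _ => //; exact: chain_nil.
Qed.

Lemma chain_coord x y l w : chain x y l -> `|x w - y w| <= l.
Proof.
elim=> [z|z z' z'' u v s t k uv s01 t01 ez ez' _ IH]; first by rewrite subrr normr0.
rewrite (le_trans (ler_distD (z' w) _ _))// lerD// ez ez' /edge_pt.
have -> : (1 - s) * (w == u)%:R + s * (w == v)%:R -
  ((1 - t) * (w == u)%:R + t * (w == v)%:R) =
  (s - t) * ((w == v)%:R - (w == u)%:R) :> R by ring.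
rewrite normrM ler_piMr//.
by case: (w == v); case: (w == u); rewrite ?subrr ?subr0 ?sub0r ?normrN ?normr0 ?normr1.
Qed.

Lemma chain_vertices u v : exists l, chain (vertex_pt u) (vertex_pt v) l.
Proof.
have [s] := cgraphP u v; elim: s u => [u _ <-|w s IH u /= /andP[uw ws] lv].
  by exists 0; exact: chain_nil.
have [l wl] := IH w ws lv; exists (`|0 - 1| + l).
apply: (chain_cons uw _ _ _ _ wl); rewrite ?lexx ?ler01//=;
  by apply/funext => z; rewrite /edge_pt; ring.
Qed.

Lemma chain_to_vertex x : exists u l, chain x (vertex_pt u) l.
Proof.
have [u [v [t [/orP[/eqP <-|uv] t01 ex]]]] := baryP x; exists u.
  exists 0; suff -> : x = vertex_pt u by exact: chain_nil.
  apply: realization_inj; rewrite ex; apply/funext => w /=.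
  by rewrite /edge_pt -!mulrDl subrK subr0 addr0.
exists (`|t - 0| + 0); apply: (chain_cons uv t01 _ ex) (chain_nil _).
  by rewrite lexx ler01.
by apply/funext => w /=; rewrite /edge_pt !mul0r.
Qed.

Lemma chain_ex x y : exists l, chain x y l.
Proof.
have [u [l xu]] := chain_to_vertex x; have [v [m yv]] := chain_to_vertex y.
have [k uv] := chain_vertices u v; exists (l + k + m).
exact: chain_cat (chain_cat xu uv) (chain_rev yv).
Qed.

Lemma has_inf_chain x y : has_inf [set l | chain x y l].
Proof.
split; first by have [l xl] := chain_ex x y; exists l.
by exists 0 => l /chain_ge0.
Qed.

Lemma length_dist_le x y l : chain x y l -> length_dist x y <= l.
Proof. by move=> xl; apply: ge_inf => //; exact: (has_inf_chain x y).2. Qed.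

Lemma le_length_dist x y m :
  (forall l, chain x y l -> m <= l) -> m <= length_dist x y.
Proof. by move=> h; apply: lb_le_inf => //; exact: (has_inf_chain x y).1. Qed.

Lemma length_distxx x : length_dist x x = 0.
Proof.
apply/eqP; rewrite eq_le length_dist_le ?andTb; last exact: chain_nil.
by apply: le_length_dist => l /chain_ge0.
Qed.

Lemma length_dist_positivity x y : length_dist x y = 0 -> x = y.
Proof.
move=> d0; apply: realization_inj; apply/funext => w; apply/eqP.
rewrite -subr_eq0 -normr_le0 -d0; apply: le_length_dist => l; exact: chain_coord.
Qed.

Lemma length_dist_sym x y : length_dist x y = length_dist y x.
Proof.
by congr inf; apply/seteqP; split => l; exact: chain_rev.
Qed.

Lemma length_dist_triangle y x z :
  length_dist x z <= length_dist x y + length_dist y z.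
Proof.
apply/ler_addgt0Pl => e e0; have e2 : 0 < e / 2 by rewrite divr_gt0.
have [l xl ll] := inf_adherent e2 (has_inf_chain x y).
have [m ym mm] := inf_adherent e2 (has_inf_chain y z).
have := length_dist_le (chain_cat xl ym).
by rewrite /length_dist in ll mm *; lra.
Qed.

HB.instance Definition _ := isMetric.Build R (realization X)
  length_distxx length_dist_positivity length_dist_sym length_dist_triangle.

End MetricGraph.

End Realization.

Definition bundle_subgroup (G : groupType) (P : {pred G})
    (closedP : group_closed P) : groupClosed G :=
  GroupClosed.Pack (GroupClosed.Class
    (isInvClosed.Build G P (group_closedV closedP))
    (isMul1Closed.Build G P closedP.1)
    (isMulClosed.Build G P (group_closedM closedP))).

Record subgroup_of (G : groupType) (H : groupClosed G) := SubgroupOf {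
  sg_val :> G;
  _ : sg_val \in H
}.

Section SubgroupOf.
Variables (G : groupType) (H : groupClosed G).

HB.instance Definition _ := [isSub for @sg_val G H].
HB.instance Definition _ := [Choice of subgroup_of H by <:].

Lemma subgroup_of_closed : group_closed [pred g | g \in H].
Proof. by split=> [|g h]; rewrite !inE ?gpred1 //; exact: gpredF. Qed.

HB.instance Definition _ :=
  SubChoice_isSubGroup.Build G _ (subgroup_of H) subgroup_of_closed.

End SubgroupOf.

Definition generates (G : groupType) (S : seq G) :=
  forall H : groupClosed G, {subset S <= H} -> forall g, g \in H.

Record gen_seq (G : groupType) := GenSeq {
  gens :> seq G;
  gensP : generates gens
}.

Definition finitely_generated (G : groupType) := inhabited (gen_seq G).

Section Cayley.
Variables (G : groupType) (S : gen_seq G).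

Definition letter : pred G := fun s => (s \in gens S) || (s^-1%g \in gens S).

Lemma letterV s : letter s^-1%g = letter s.
Proof. by rewrite /letter invgK orbC. Qed.

(* Multiple edges and loops are discarded. *)
Definition cayley_adj : rel G := fun g h => (g != h) && letter (g^-1 * h)%g.

Lemma cayley_sym : symmetric cayley_adj.
Proof.
by move=> g h; rewrite /cayley_adj eq_sym -letterV invgM invgK.
Qed.

Lemma cayley_irr : irreflexive cayley_adj.
Proof. by move=> g; rewrite /cayley_adj eqxx. Qed.

Definition cayley_graph := Graph cayley_sym cayley_irr.

Definition reached : {pred G} :=
  fun g => `[< forall h, exists2 s, path cayley_adj h s & last h s = (h * g)%g >].

Lemma reached_closed : group_closed reached.
Proof.
split; first by apply/asboolP => h; exists [::] => //=; rewrite mulg1.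
move=> a b /asboolP ra /asboolP rb; apply/asboolP => h.
have [s hs ls] := ra h; have [t ht lt] := rb (h * (a * b^-1))%g.
have [r hr lr] : exists2 r,
    path cayley_adj (last h s) r & last (last h s) r = (h * (a / b))%g.
  have -> : last h s = last (h * (a / b))%g t by rewrite ls lt !mulgA mulgVK.
  exists (rev (belast (h * (a / b))%g t)).
    by rewrite rev_path (eq_path (e' := cayley_adj)) // => x y; exact: cayley_sym.
  by case: t {ht lt} => //= x t; rewrite rev_cons last_rcons.
by exists (s ++ r); rewrite ?cat_path ?last_cat ?hs.
Qed.

Lemma cayley_connected : graph_connected cayley_graph.
Proof.
move=> g h; have : (g^-1 * h)%g \in bundle_subgroup reached_closed.
  apply: (@gensP G S) => s sS; apply/asboolP => k.
  have [->|s1] := eqVneq s 1%g; first by exists [::] => //; rewrite mulg1.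
  exists [:: (k * s)%g] => //=; rewrite andbT /cayley_adj /letter mulKg sS andbT.
  by rewrite -{1}(mulg1 k) (inj_eq (mulgI k)) eq_sym.
by move=> /asboolP /(_ g); rewrite mulVKg.
Qed.

Definition cayley_cgraph := CGraph cayley_connected.

End Cayley.

(* Distance between g and h in the word metric: the least length of a word in
   the generators and their inverses representing g^-1 h. *)
Definition word_dist (R : realType) (G : groupType) (S : gen_seq G)
    (g h : G) : R :=
  inf [set (size w)%:R | w in
    [set w : seq G | all (letter S) w /\ (\prod_(s <- w) s = g^-1 * h)%g]].

Definition undistorted (R : realType) (G : groupType) (S : gen_seq G)
    (H : groupClosed G) :=
  exists A : gen_seq (subgroup_of H),
    qi_embedding (@word_dist R _ A) (@word_dist R _ S) (@sg_val G H).

Definition cayley (R : realType) (G : groupType) (S : gen_seq G) : metricType R :=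
  realization R (cayley_cgraph S).

Definition cayley_vertex (R : realType) (G : groupType) (S : gen_seq G) (g : G) :
    cayley R S :=
  @vertex_pt R (cayley_cgraph S) g.

(* The choices entering the definition of the relative Morse boundary of H in G,
   once S is fixed: a finite generating set of H, a basepoint in the Cayley graph
   of H, and an extension of the inclusion.  They exist iff H is finitely
   generated and undistorted. *)
Record rel_setting (R : realType) (G : groupType) (S : gen_seq G)
    (H : groupClosed G) := RelSetting {
  rs_gens : gen_seq (subgroup_of H);
  rs_base : cayley R rs_gens;
  rs_map : cayley R rs_gens -> cayley R S;
  rs_ext : forall h, rs_map (cayley_vertex R rs_gens h) = cayley_vertex R S (\val h);
  rs_qi : qi_embedding (@mdist R _) (@mdist R _) rs_map
}.
Arguments rs_map {R G S H} c _ : rename.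

(* It does not matter which ray represents the point x, since Morseness passes
   to quasi-geodesics at finite Hausdorff distance. *)
Definition rel_morse_boundary (R : realType) (G : groupType) (S : gen_seq G)
    (H : groupClosed G) (c : rel_setting R S H) :
    set (morse_boundary (rs_base c)) :=
  [set x | exists g N,
     point_rays x g /\ @morse R (cayley R S) N `[0, +oo[ (rs_map c \o g)].

Arguments rel_morse_boundary {R G S H} c _ : rename.

Record action (G : groupType) (X : graph) := Action {
  act :> G -> X -> X;
  act1 : forall x, act 1%g x = x;
  actM : forall g h x, act (g * h)%g x = act g (act h x);
  act_adj : forall g x y, adj (act g x) (act g y) = adj x y
}.

Section Action.
Variables (G : groupType) (X : graph) (a : action G X).

Definition without_inversions :=
  forall g x y, adj x y -> ~ (a g x = y /\ a g y = x).

(* g acts on barycentric coordinates by precomposition with g^-1. *)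
Definition no_global_fixed_point (R : realType) :=
  ~ exists x : realization R X, forall g v, x (a g v) = x v.

Lemma vertex_stab_closed (x : X) : group_closed [pred g | a g x == x].
Proof.
split=> [|g h]; rewrite !inE ?act1// => /eqP gx /eqP hx.
have hVx : a h^-1%g x = x by rewrite -{1}hx -actM mulVg act1.
by rewrite actM hVx gx.
Qed.

Definition vertex_stab (x : X) : groupClosed G :=
  bundle_subgroup (vertex_stab_closed x).

Lemma edge_stab_closed (x y : X) :
  group_closed [pred g | perm_eq [:: a g x; a g y] [:: x; y]].
Proof.
split=> [|g h]; rewrite !inE ?act1// => gxy hxy.
apply: perm_trans gxy; rewrite !actM.
rewrite -[X in perm_eq X _]/(map (a g) [:: a h^-1%g x; a h^-1%g y]).
rewrite -[X in perm_eq _ X]/(map (a g) [:: x; y]); apply: perm_map.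
rewrite perm_sym; have := perm_map (a h^-1%g) hxy.
by rewrite /= -!actM mulVg !act1.
Qed.

Definition edge_stab (x y : X) : groupClosed G :=
  bundle_subgroup (edge_stab_closed x y).

End Action.

(* Main.v *)
(* Fix a base vertex of T. An edge of T separates the vertices of G into two
   sides, by their action on the base vertex, and the places where the side
   changes lie near a coset of the edge group E. A Morse ray of G that came back
   there at arbitrarily large times would, E being undistorted, follow a Morse
   ray of E, against (d_M E, G) = set0; compactness makes this uniform in the
   gauge. So every edge cuts the boundary into two clopen sets, and a connected
   subset C lies on one side of each edge. If C has two points, represented by
   rays from p, an edge crossed by both rays is crossed near p, since a path
   joining the two crossings inside the coset of E has to come near p. Hence only
   finitely many edges are crossed by both rays, and all edges point, in the
   direction of C, to a common vertex x. The rays of C then return infinitely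
   often near V = Stab x and follow rays of V. This gives an injective map from C
   to (d_M V, G) under which closed sets have closed preimages, so that its image
   is connected, a contradiction. That V is undistorted is seen by cutting a word
   at its visits to x: the excursion between two visits leaves and comes back
   through the same edge, and can be replaced by a word in the edge group. *)
Require Import Defs.
From mathcomp Require Import all_boot all_order all_algebra.
From mathcomp Require Import all_classical all_reals topology.
From mathcomp Require Import ring lra zify.

Set Implicit Arguments.
Unset Strict Implicit.
Unset Printing Implicit Defensive.
Import Order.TTheory GRing.Theory Num.Theory.
Import numFieldTopology.Exports.

(** * Half-trees *)

Section Tree.
Variable T : graph.
Implicit Types (u v w x y z : T).

(** No quotient of [T] is formed. Translation by [g^-1] turns an edge crossed near [g] into one of
    finitely many ordered pairs of vertices ([fin_edges]); this list carries the finiteness and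
    uniformity over edges, and [coset_near] turns membership in it into closeness to a stabiliser.
    The obstacle is the direct limit topology: openness and closedness have to be checked on each
    stratum, hence with constants that depend on the gauge and not on the ray. For a constant
    sequence the same lemma gives the ray of V followed by a ray of C. A ray of a subgroup is only a
    quasi-geodesic in G, so it is compared with rays of G through images, up to finite Hausdorff
    distance. *)

Definition cut y z : rel T := fun a b =>
  adj a b && ~~ [|| (a == y) && (b == z) | (a == z) && (b == y)].

(** The half-tree behind the edge from [y] to [z]: the component of [z] once the edge is removed. *)
Definition side y z w := exists2 s, path (cut y z) z s & last z s = w.

Definition separates y z u w :=
  (side y z u /\ side z y w) \/ (side z y u /\ side y z w).

Lemma separatesC y z u w : separates y z u w -> separates z y u w.
Proof. by case; [right|left]. Qed.

Lemma cut_adj y z : subrel (cut y z) (@adj T).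
Proof. by move=> u v /andP[]. Qed.

Lemma cut_sym y z : symmetric (cut y z).
Proof. by move=> u v; rewrite /cut adj_sym; congr (_ && ~~ _); rewrite orbC andbC [X in _ || X]andbC. Qed.

Lemma cutC y z : cut y z =2 cut z y.
Proof. by move=> u v; rewrite /cut orbC. Qed.

Lemma side_refl y z : side y z z.
Proof. by exists [::]. Qed.

Lemma side_cut y z u v : side y z u -> cut y z u v -> side y z v.
Proof.
move=> [s zs <-] uv; exists (rcons s v); last by rewrite last_rcons.
by rewrite rcons_path zs.
Qed.

Hypothesis T_tree : is_tree T.
Variables (y z : T).
Hypothesis yz : adj y z.

Lemma adj_neq u v : adj u v -> u != v.
Proof. by apply: contraTneq => ->; rewrite adj_irr. Qed.

(** A simple path from [z] to [y] closes up with the edge to a cycle. Acyclicity leaves at most two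
    vertices, and such a path would use the removed edge. *)
Lemma not_side : ~ side y z y.
Proof.
move=> [s zs lys]; have [_ _ acyc] := T_tree.
case/shortenP: zs lys => s' zs' us' _ lys.
have := acyc (z :: s'); rewrite /ucycle /= rcons_path (sub_path (@cut_adj y z) zs').
rewrite lys yz; move: (us') => /= -> /(_ isT).
case: s' zs' us' lys => [|a [|b s1]] //=.
  by move=> _ _ zy; move: (adj_neq yz); rewrite zy eqxx.
by rewrite andbT => /andP[_ +] _ ay; rewrite ay !eqxx /= orbT.
Qed.

Lemma side_step u v : side y z u -> adj u v -> side y z v \/ (u = z /\ v = y).
Proof.
move=> zu uv; have [c|] := boolP (cut y z u v); first by left; exact: side_cut c.
rewrite /cut /= uv /= negbK => /orP[/andP[/eqP uy _]|/andP[/eqP -> /eqP ->]]; last by right.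
by case: not_side; move: zu; rewrite uy.
Qed.

Lemma side_total w : side y z w \/ side z y w.
Proof.
have [_ cn _] := T_tree; have [s zs <-] := cn z w.
elim/last_ind: s zs => [_|s v IH]; first by left; exact: side_refl.
rewrite last_rcons rcons_path => /andP[/IH{}IH uv].
have [c|] := boolP (cut y z (last z s) v).
  by case: IH => h; [left|right]; apply: side_cut h _; rewrite // cutC.
rewrite /cut /= uv /= negbK => /orP[/andP[_ /eqP ->]|/andP[_ /eqP ->]].
  by left; exact: side_refl.
by right; exact: side_refl.
Qed.

Lemma side_path u w : side y z u -> side y z w -> exists2 s, path (cut y z) u s & last u s = w.
Proof.
move=> [s zs lu] [t zt lw].
exists (rev (belast z s) ++ t).
  rewrite cat_path; apply/andP; split.
    by rewrite -lu rev_path (eq_path (e' := cut y z)) // => a b; rewrite cut_sym.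
  suff -> : last u (rev (belast z s)) = z by [].
  by rewrite -lu; case: s {zs lu} => //= a s; rewrite rev_cons last_rcons.
rewrite last_cat -lw; congr last.
by rewrite -lu; case: s {zs lu} => //= a s; rewrite rev_cons last_rcons.
Qed.

End Tree.

Section GraphDist.
Variable X : graph.
Hypothesis X_conn : graph_connected X.
Implicit Types (u v w : X).

Lemma gdist_subproof u w :
  exists n, `[< exists2 s, path (@adj X) u s & last u s = w /\ size s = n >].
Proof. by have [s us lw] := X_conn u w; exists (size s); apply/asboolP; exists s. Qed.

Definition gdist u w := ex_minn (gdist_subproof u w).

Lemma gdist_path u w : exists2 s, path (@adj X) u s & last u s = w /\ size s = gdist u w.
Proof. by rewrite /gdist; case: ex_minnP => n /asboolP. Qed.

Lemma gdist_le u s : path (@adj X) u s -> gdist u (last u s) <= size s.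
Proof.
by move=> us; rewrite /gdist; case: ex_minnP => n _; apply; apply/asboolP; exists s.
Qed.

Lemma gdistxx u : gdist u u = 0.
Proof. by apply/eqP; rewrite -leqn0 -[X in gdist u X]/(last u [::]) gdist_le. Qed.

Lemma gdist_adj u v w : adj v w -> gdist u w <= (gdist u v).+1.
Proof.
move=> vw; have [s us [lv <-]] := gdist_path u v.
by have := @gdist_le u (rcons s w); rewrite last_rcons size_rcons rcons_path us lv; apply.
Qed.

End GraphDist.

Section TreeTheory.
Variable T : graph.
Hypothesis T_tree : is_tree T.
Implicit Types (u v w x y z : T).

Lemma side_excl y z w : adj y z -> side y z w -> ~ side z y w.
Proof.
move=> yz zw yw; apply: (not_side T_tree yz).
have [s wt ly] := side_path yw (side_refl z y).
have [t zt lt] := zw; exists (t ++ s); last by rewrite last_cat lt.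
by rewrite cat_path zt lt (eq_path (cutC y z)).
Qed.

(** A path within the branch of [z] never visits [x], so it cannot run along the edge between [x]
    and [y]. *)
Lemma side_branch x y z w : adj x y -> adj x z -> y != z -> side x z w -> side y x w.
Proof.
move=> xy xz yz [s zs <-]; have yx : adj y x by rewrite adj_sym.
have: side y x z.
  have [//|[_ zy]] := side_step T_tree yx (side_refl y x) xz.
  by rewrite zy eqxx in yz.
have: side x z z by exact: side_refl.
elim: s {2 4 5 6}z zs => //= v s IH u /andP[uv vs] zu xu.
have zv := side_cut zu uv; apply: IH => //.
have [//|[ux _]] := side_step T_tree yx xu (cut_adj uv).
by case: (not_side T_tree xz); move: zu; rewrite ux.
Qed.

Lemma branch_ex x w : w <> x -> exists2 z, adj x z & side x z w.
Proof.
have [_ cn _] := T_tree; have [s xs <-] := cn x w.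
elim/last_ind: s xs => [//|s v IH]; rewrite last_rcons rcons_path => /andP[/IH{}IH uv] vx.
have [ux|/eqP /IH [z xz zu]] := eqVneq (last x s) x.
  by exists v; [rewrite -{1}ux|exact: side_refl].
by exists z => //; have [//|[_ /vx]] := side_step T_tree xz zu uv.
Qed.

Lemma side_step2 x z u v : adj x z -> side x z u -> ~ separates x z u v -> side x z v.
Proof. by move=> xz zu nsep; have [//|xv] := side_total T_tree x z v; case: nsep; left. Qed.

Lemma separates_neq y z u : adj y z -> ~ separates y z u u.
Proof. by move=> yz [[a b]|[b a]]; exact: side_excl a b. Qed.

Lemma separates_trans y z u v w :
  separates y z u w -> separates y z u v \/ separates y z v w.
Proof.
move=> sep; have [zv|yv] := side_total T_tree y z v.
  by case: sep => -[h k]; [right; left|left; right].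
by case: sep => -[h k]; [left; left|right; right].
Qed.

(** An edge that separates the ends of a path is traversed by the path. *)
Lemma fin_separates u w : exists L : seq (T * T), forall y z,
  adj y z -> separates y z u w -> (y, z) \in L.
Proof.
have [_ cn _] := T_tree; have [s us <-] := cn u w.
elim: s u us => [|v s IH] u /=; first by exists [::] => y z yz /(separates_neq yz).
move=> /andP[uv /IH[L HL]]; exists [:: (u, v), (v, u) & L] => y z yz sep.
rewrite !inE; have [{}sep|/(HL _ _ yz) ->] := separates_trans v sep; last by rewrite !orbT.
have zy : adj z y by rewrite adj_sym.
case: sep => -[a b].
  have [b'|[-> ->]] := side_step T_tree yz a uv; first by case: (side_excl yz b' b).
  by rewrite eqxx orbT.
have [b'|[-> ->]] := side_step T_tree zy a uv; first by case: (side_excl zy b' b).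
by rewrite eqxx.
Qed.

(** A path to [z] from the half-tree of [x] leaves it at [x], so it begins with a strictly shorter
    path to [x]. *)
Lemma gdist_side (cn : graph_connected T) u x z :
  adj x z -> side z x u -> gdist cn u x < gdist cn u z.
Proof.
move=> xz xu; have [s us [lz <-]] := gdist_path cn u z.
suff [s' us' [<- lt]] : exists2 s', path (@adj T) u s' & last u s' = x /\ size s' < size s.
  by apply: leq_ltn_trans lt; apply: gdist_le.
have zx : adj z x by rewrite adj_sym.
elim: s u us lz xu => [|v s IH] u /=.
  by move=> _ -> /(not_side T_tree zx).
move=> /andP[uv vs] lz xu; have [xv|[-> _]] := side_step T_tree zx xu uv; last by exists [::].
have [s' vs' [lx lt]] := IH v vs lz xv.
by exists (v :: s') => //=; rewrite uv.
Qed.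

End TreeTheory.

Section TreeAction.
Variables (G : groupType) (T : graph) (a : action G T).
Implicit Types (u v w x y z : T) (g h : G).

Lemma actVK g x : a g^-1%g (a g x) = x.
Proof. by rewrite -actM mulVg act1. Qed.

Lemma actKV g x : a g (a g^-1%g x) = x.
Proof. by rewrite -actM mulgV act1. Qed.

Lemma act_inj g : injective (a g).
Proof. exact: can_inj (actVK g). Qed.

Lemma side_act g y z w : side y z w -> side (a g y) (a g z) (a g w).
Proof.
move=> [s zs <-]; exists (map (a g) s); last by rewrite last_map.
rewrite path_map; apply: sub_path zs => u v.
by rewrite /cut /= act_adj !(inj_eq (@act_inj g)).
Qed.

Lemma separates_act g y z u w :
  separates y z u w -> separates (a g y) (a g z) (a g u) (a g w).
Proof. by case=> -[h k]; [left|right]; split; exact: side_act. Qed.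

End TreeAction.

(** * Vertex groups are undistorted *)

Local Open Scope group_scope.
Local Open Scope classical_set_scope.

Section Words.
Variable G : groupType.
Implicit Types (A B : seq G) (g h : G) (n m : nat).

Definition sletter A : pred G := fun s => (s \in A) || (s^-1 \in A).

(** A bound in place of a length: it makes sense for lists that do not generate and requires no
    minimum. *)
Definition wlen A n g := exists2 w : seq G, all (sletter A) w & \prod_(s <- w) s = g /\ size w <= n.

Lemma wlen1 A n : wlen A n 1.
Proof. by exists [::]; rewrite ?big_nil. Qed.

Lemma wlenM A n m g h : wlen A n g -> wlen A m h -> wlen A (n + m) (g * h).
Proof.
move=> [w wA [<- nw]] [v vA [<- nv]]; exists (w ++ v); first by rewrite all_cat wA.
by rewrite big_cat size_cat leq_add.
Qed.

Lemma wlenV A n g : wlen A n g -> wlen A n g^-1.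
Proof.
move=> [w wA [<- nw]]; exists (rev (map (fun s => s^-1) w)); last split.
- rewrite all_rev all_map; apply: sub_all wA => s.
  by rewrite /sletter /= invgK orbC.
- elim: w {wA nw} => [|s w IH]; first by rewrite !big_nil invg1.
  by rewrite map_cons rev_cons -cats1 big_cat /= IH big_seq1 big_cons invgM.
- by rewrite size_rev size_map.
Qed.

Lemma wlen_le A n m g : n <= m -> wlen A n g -> wlen A m g.
Proof. by move=> nm [w wA [e nw]]; exists w => //; split=> //; exact: leq_trans nm. Qed.

Lemma wlen_letter A g : g \in A -> wlen A 1 g.
Proof. by move=> gA; exists [:: g]; rewrite /= ?/sletter ?gA ?big_seq1. Qed.

Lemma wlen_subst A B k n g :
  (forall s, s \in A -> wlen B k s) -> wlen A n g -> wlen B (k * n) g.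
Proof.
move=> AB [w wA [<- nw]]; apply: (@wlen_le _ (k * size w)); first by rewrite leq_mul2l nw orbT.
elim: w wA {nw} => [|s w IH] /=; first by rewrite big_nil => _; exact: wlen1.
move=> /andP[sA /IH wB]; rewrite big_cons mulnS; apply: wlenM wB.
by case/orP: sA => /AB // /wlenV; rewrite invgK.
Qed.

Lemma wlen_conj A B k n g :
  (forall s, s \in A -> k * s * k^-1 \in B) -> wlen A n g -> wlen B n (k * g * k^-1).
Proof.
move=> AB [w wA [<- nw]]; exists (map (fun s => k * s * k^-1) w); last split.
- rewrite all_map; apply: sub_all wA => s /orP[/AB|/AB] h; rewrite /= /sletter ?h //.
  by apply/orP; right; move: h; rewrite !invgM invgK mulgA.
- elim: w {wA nw} => [|s w IH]; first by rewrite !big_nil mulg1 mulgV.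
  by rewrite /= !big_cons IH !mulgA mulgVK.
- by rewrite size_map.
Qed.

Definition words_of A : {pred G} := fun g => `[< exists n, wlen A n g >].

Lemma words_closed A : group_closed (words_of A).
Proof.
split; first by apply/asboolP; exists 0%N; exact: wlen1.
move=> g h /asboolP[n gn] /asboolP[m hm]; apply/asboolP; exists (n + m)%N.
by apply: wlenM gn _; exact: wlenV.
Qed.

Lemma generatesP A : generates A <-> forall g, exists n, wlen A n g.
Proof.
split=> [gA g|h H AH g].
  suff /asboolP : g \in bundle_subgroup (words_closed A) by [].
  by apply: gA => s sA; apply/asboolP; exists 1%N; exact: wlen_letter.
have [n [w wA [<- _]]] := h g.
elim: w wA => [|s w IH] /=; first by rewrite big_nil => _; exact: gpred1.
move=> /andP[sA /IH wH]; rewrite big_cons gpredM //.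
by case/orP: sA => /AH //; rewrite gpredV.
Qed.

End Words.

Section WordDist.
Variable R : realType.
Local Open Scope ring_scope.

Section One.
Variables (G : groupType) (S : gen_seq G).

Lemma word_dist_has_inf (g h : G) :
  has_inf [set ((size w)%:R : R) | w in
    [set w : seq G | all (letter S) w /\ (\prod_(s <- w) s = g^-1 * h)%g]].
Proof.
split.
  have /generatesP /(_ (g^-1 * h)%g) [n [w wA [e _]]] := @gensP _ S.
  by exists (size w)%:R, w.
by exists 0 => _ [w _ <-]; exact: ler0n.
Qed.

Lemma word_dist_le (g h : G) n : wlen S n (g^-1 * h)%g -> word_dist R S g h <= n%:R.
Proof.
move=> [w wA [e nw]]; apply: (@le_trans _ _ (size w)%:R); last by rewrite ler_nat.
by apply: ge_inf; [exact: (word_dist_has_inf g h).2|exists w].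
Qed.

Lemma word_dist_wlen (g h : G) :
  exists2 n, wlen S n (g^-1 * h)%g & n%:R <= word_dist R S g h + 1.
Proof.
have [_ [w [wA e] <-] lt] := inf_adherent (ltr01 : 0 < 1 :> R) (word_dist_has_inf g h).
by exists (size w); [exists w|exact: ltW].
Qed.

End One.

Lemma undistorted_words (G : groupType) (S : gen_seq G) (H : groupClosed G) :
  undistorted R S H ->
  exists (A : seq G) (K : nat), (forall s, s \in A -> s \in H) /\
    forall n g, g \in H -> wlen S n g -> wlen A (K * n.+1)%N g.
Proof.
(* The distance in [H] is at most [K * (n + K)], and passing to an actual word loses 1; this factor
   times [n + 1] bounds the sum. *)
move=> [A [K K1 qK]]; exists (map val (A : seq _)), (Num.truncn (K * (K + 1) + 2)).+1.
split=> [_ /mapP[s _ ->]|n g gH gn]; first exact: valP.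
pose h : subgroup_of H := SubgroupOf gH.
have [m [w wA [e mw]] mle] := word_dist_wlen A 1%g h.
apply: (@wlen_le _ _ m); last first.
  exists (map val w); last split; last by rewrite size_map.
    rewrite all_map; apply: sub_all wA => s; rewrite /sletter /=.
    case/orP => sA; first by rewrite map_f.
    by apply/orP; right; apply/mapP; exists s^-1%g.
  have -> : (g = val (1^-1 * h))%g by rewrite invg1 mul1g.
  rewrite -e; elim: w {wA e mw} => [|s w IH]; rewrite ?big_nil //= !big_cons IH.
  by [].
have /andP[q _] := qK 1%g h.
have wd : word_dist R S (val (1%g : subgroup_of H)) (val h) <= n%:R.
  by apply: word_dist_le; rewrite /= invg1 mul1g.
have n0 : 0 <= n%:R :> R by exact: ler0n.
have K0 : 0 < K by lra.
have q2 : word_dist R A 1%g h <= K * (n%:R + K).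
  by rewrite -ler_pdivrMl //; lra.
have lt : K * (K + 1) + 2 < (Num.truncn (K * (K + 1) + 2)).+1%:R :> R by exact: truncnS_gt.
rewrite -(ler_nat R) natrM -[n.+1%:R]natr1.
apply: (@le_trans _ _ ((K * (K + 1) + 2) * (n%:R + 1))); first by nra.
by rewrite ler_wpM2r //; [lra|exact: ltW].
Qed.

End WordDist.

Lemma seq_choice (I : eqType) (U : Type) (u0 : U) (s : seq I) (P : I -> U -> Prop) :
  (forall i, i \in s -> exists u, P i u) -> exists f : I -> U, forall i, i \in s -> P i (f i).
Proof.
move=> h; have /choice[f hf] : forall i, exists u, i \in s -> P i u.
  by move=> i; have [/h [u Pu]|] := boolP (i \in s); [exists u|exists u0].
by exists f.
Qed.

Lemma leq_bigmaxn_seq (I : eqType) (r : seq I) (F : I -> nat) i :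
  i \in r -> F i <= \max_(j <- r) F j.
Proof. by move=> ir; apply: (leq_bigmax_seq (P := xpredT)). Qed.

Section Crossing.
Variables (G : groupType) (T : graph) (a : action G T) (x0 : T).
Hypothesis T_tree : is_tree T.
Implicit Types (u v w x y z : T) (g h : G) (B : seq G).

Definition crosses B y z g := exists2 b, b \in B & separates y z (a g x0) (a (g * b) x0).

(** After translation by [g^-1] the edge separates [x0] from [b x0] for some [b] of the finite list
    [B]. *)
Lemma fin_edges B : exists F : seq (T * T), forall y z g,
  adj y z -> crosses B y z g -> (a g^-1 y, a g^-1 z) \in F.
Proof.
suff [F HF] : exists F : seq (T * T), forall y z b, adj y z -> b \in B ->
    separates y z x0 (a b x0) -> (y, z) \in F.
  exists F => y z g yz [b bB sep]; apply: (HF _ _ b) => //; first by rewrite act_adj.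
  by have := separates_act a g^-1 sep; rewrite -!actM mulKg mulVg act1.
elim: B => [|b B [F HF]]; first by exists [::].
have [L HL] := fin_separates T_tree x0 (a b x0).
exists (L ++ F) => y z c yz; rewrite inE mem_cat => /predU1P[->|cB] sep.
  by rewrite HL.
by rewrite (HF _ _ c) // orbT.
Qed.

Lemma crosses_stab B y z g h : a h y = y -> a h z = z -> crosses B y z g ->
  crosses B y z (h * g).
Proof.
move=> hy hz [b bB sep]; exists b => //.
by have := separates_act a h sep; rewrite hy hz -!actM mulgA.
Qed.

End Crossing.

Section EdgeStab.
Variables (G : groupType) (T : graph) (a : action G T).
Hypothesis a_inv : without_inversions a.

(** The other permutation of the two ends would be an inversion. *)
Lemma edge_stabP (x y : T) g : adj x y -> g \in edge_stab a x y <-> a g x = x /\ a g y = y.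
Proof.
move=> xy; rewrite !inE /=; split=> [|[-> ->]]; last exact: perm_refl.
move=> pe; have: a g x \in [:: x; y] by rewrite -(perm_mem pe) inE eqxx.
rewrite !inE => /orP[/eqP gx|/eqP gx].
  by split=> //; move: pe; rewrite gx perm_cons => /perm_small_eq -/(_ isT) [].
exfalso; apply: (a_inv xy (g := g)); split=> //.
have: x \in [:: a g x; a g y] by rewrite (perm_mem pe) inE eqxx.
rewrite !inE gx => /orP[/eqP xy'|/eqP //].
by move: xy; rewrite xy' adj_irr.
Qed.

End EdgeStab.

Lemma vertex_stabP (G : groupType) (T : graph) (a : action G T) (x : T) g :
  g \in vertex_stab a x <-> a g x = x.
Proof. by rewrite !inE /=; split=> [/eqP|->]. Qed.

Section VertexStab.
Variables (R : realType) (G : groupType) (S : gen_seq G) (T : graph) (a : action G T).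
Hypotheses (T_tree : is_tree T) (a_inv : without_inversions a).
Hypothesis E_undistorted : forall x y : T, adj x y -> undistorted R S (edge_stab a x y).
Variable x0 : T.

Let B : seq G := (S : seq G) ++ map (fun s => s^-1) S.

Let mem_B s : (s \in B) = sletter S s.
Proof.
rewrite mem_cat /sletter; congr (_ || _); apply/mapP/idP => [[t tS ->]|sS].
  by rewrite invgK.
by exists s^-1; rewrite ?invgK.
Qed.

Let BV s : (s^-1 \in B) = (s \in B).
Proof. by rewrite !mem_B /sletter invgK orbC. Qed.

Let crosses := crosses a x0 B.

(** The visits to [x0]. The second alternative is there because a single letter may move the orbit
    point over [x0] without landing on it. *)
Let Z g := a g x0 = x0 \/ exists2 z, adj x0 z & crosses x0 z g.

Let not_crosses g b z : ~ Z g -> b \in B -> adj x0 z ->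
  side x0 z (a g x0) -> side x0 z (a (g * b) x0).
Proof.
move=> nZ bB xz zg; apply: (side_step2 T_tree xz zg) => sep.
by apply: nZ; right; exists z => //; exists b.
Qed.

(** A step from the branch of [z] across any other edge at [x0] also leaves the branch of [z]. *)
Let Z_side g z : Z g -> adj x0 z -> side x0 z (a g x0) -> crosses x0 z g.
Proof.
move=> [gx|[y xy [b bB sep]]] xz zg.
  by case: (not_side T_tree xz); rewrite gx in zg.
have [yz|yz] := eqVneq y z; first by rewrite -yz; exists b.
exists b => //; left; split=> //.
have xg := side_branch T_tree xy xz yz zg.
have yx : adj y x0 by rewrite adj_sym.
case: sep => -[h1 h2]; first by case: (side_excl T_tree xy h1 xg).
by apply: side_branch h2 => //; rewrite eq_sym.
Qed.

(** The elements [kg g * u * (kg (g * u))^-1] between successive visits fix [x0] and telescope along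
    the word. Each costs a multiple of the length of [u]: a single letter gives a generator, and a
    longer excursion stays behind one edge at [x0], whose undistorted stabiliser provides a short
    word. *)
Lemma vertex_stab_words : exists (A : seq G) (C : nat),
  (forall s, s \in A -> s \in vertex_stab a x0) /\
  forall n g, g \in vertex_stab a x0 -> wlen S n g -> wlen A (C * n) g.
Proof.
have [F0 HF0] := fin_edges a x0 T_tree B.
pose F := [seq f <- F0 | adj f.1 f.2].
have HF z g : adj x0 z -> crosses x0 z g -> (a g^-1 x0, a g^-1 z) \in F.
  by move=> xz /HF0 h; rewrite mem_filter h // act_adj xz.
have /(seq_choice ([::], 0%N)) [AK HAK] : forall f, f \in F -> exists AK : seq G * nat,
    (forall s, s \in AK.1 -> s \in edge_stab a f.1 f.2) /\
    forall n g, g \in edge_stab a f.1 f.2 -> wlen S n g -> wlen AK.1 (AK.2 * n.+1) g.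
  move=> f; rewrite mem_filter => /andP[/E_undistorted /undistorted_words[A [K h]] _].
  by exists (A, K).
pose Ag f := (AK f).1; pose K := \max_(f <- F) (AK f).2.
have HK f n g : f \in F -> g \in edge_stab a f.1 f.2 -> wlen S n g -> wlen (Ag f) (K * n.+1) g.
  move=> fF gE gn; apply: wlen_le ((HAK f fF).2 n g gE gn).
  by rewrite leq_mul2r (leq_bigmaxn_seq (fun f => (AK f).2) fF) orbT.
(* [k] brings points of the orbit of [x0] back to [x0]. Since [k x0 = 1], both outer correctors are
   trivial for a word that represents an element fixing [x0]. *)
have [k [k0 kx]] : exists k : T -> G, k x0 = 1 /\
    forall v, (exists g, a g v = x0) -> a (k v) v = x0.
  have /choice[k hk] : forall v, exists g : G, (v = x0 -> g = 1) /\
      ((exists g, a g v = x0) -> a g v = x0).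
    move=> v; have [->|/eqP vx] := eqVneq v x0; first by exists 1; rewrite act1.
    have [[g gv]|n] := pselect (exists g, a g v = x0); first by exists g.
    by exists 1.
  by exists k; split=> [|v]; [exact: (hk x0).1|exact: (hk v).2].
(* A chosen element carrying one listed edge to another; its value is 1 if they lie in different
   orbits. *)
have [t ht] : exists t : T * T -> T * T -> G, forall f f',
    (exists g, a g f'.1 = f.1 /\ a g f'.2 = f.2) ->
    a (t f f') f'.1 = f.1 /\ a (t f f') f'.2 = f.2.
  have /choice[t ht] : forall ff : (T * T) * (T * T), exists g : G,
      (exists g, a g ff.2.1 = ff.1.1 /\ a g ff.2.2 = ff.1.2) ->
      a g ff.2.1 = ff.1.1 /\ a g ff.2.2 = ff.1.2.
    move=> ff; have [[g h]|n] := pselect (exists g, a g ff.2.1 = ff.1.1 /\ a g ff.2.2 = ff.1.2).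
      by exists g.
    by exists 1.
  by exists (fun f f' => t (f, f')) => f f' /(ht (f, f')).
have [c hc] : exists c, forall f f', f \in F -> f' \in F -> wlen S c (t f f').
  have [len hlen] : exists len : G -> nat, forall g, wlen S (len g) g.
    have /generatesP /choice[len h] := @gensP _ S; by exists len.
  exists (\max_(f <- F) \max_(f' <- F) len (t f f')) => f f' fF fF'.
  apply: wlen_le (hlen _).
  apply: leq_trans (leq_bigmaxn_seq (fun f => \max_(f' <- F) len (t f f')) fF).
  exact: (leq_bigmaxn_seq (fun f' => len (t f f')) fF').
pose F' := x0 :: map fst F.
(* [A1] serves words in the edge groups, [A2] the passage between listed edges of one orbit, [A3]
   single letters between two visits; [A] keeps those that fix [x0]. *)
pose A1 := [seq k f.1 * s * (k f.1)^-1 | f <- F, s <- Ag f].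
pose A2 := [seq k f.1 * t f f' * (k f'.1)^-1 | f <- F, f' <- F].
pose A3 := [seq k u * bv.1 * (k bv.2)^-1 | u <- F', bv <- [seq (b, v) | b <- B, v <- F']].
pose A := [seq g <- A1 ++ A2 ++ A3 | g \in vertex_stab a x0].
pose kg g := k (a g^-1 x0).
have kgx g : a (kg g) (a g^-1 x0) = x0 by apply: kx; exists g; rewrite actKV.
have stab g u : kg g * u * (kg (g * u))^-1 \in vertex_stab a x0.
  apply/vertex_stabP; rewrite -[in X in X = _](kgx (g * u)) actM actVK -!actM.
  by rewrite invgM !mulgA mulgK actM kgx.
have ZF g : Z g -> a g^-1 x0 \in F'.
  rewrite inE => -[gx|[z xz /(HF _ _ xz) h]].
    by rewrite -{1}gx actVK eqxx.
  by apply/orP; right; apply/mapP; exists (a g^-1 x0, a g^-1 z).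
(* An excursion of length [n.+1] costs [K * (n.+1 + c).+1] letters in the edge group, where [c]
   bounds the transport element, and one letter of [A2]. *)
pose C := (K * c.+2 + 1)%N.
have single g b : Z g -> Z (g * b) -> b \in B -> wlen A 1 (kg g * b * (kg (g * b))^-1).
  move=> /ZF Zg /ZF Zgb bB; apply: wlen_letter; rewrite mem_filter stab mem_cat.
  apply/orP; right; rewrite mem_cat; apply/orP; right; apply/allpairsPdep.
  exists (a g^-1 x0), (b, a (g * b)^-1 x0); split=> //.
  by apply/allpairsPdep; exists b, (a (g * b)^-1 x0).
have excursion g u z n : adj x0 z -> crosses x0 z g -> crosses x0 z (g * u) ->
    wlen S n.+1 u -> wlen A (C * n.+1) (kg g * u * (kg (g * u))^-1).
  move=> xz cg cgu un; have fF := HF _ _ xz cg; have fF' := HF _ _ xz cgu.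
  set f := (a g^-1 x0, a g^-1 z) in fF; set f' := (_, _) in fF'.
  have [t1 t2] : a (t f f') f'.1 = f.1 /\ a (t f f') f'.2 = f.2.
    by apply: ht; exists u; rewrite /= -!actM invgM !mulgA mulgV mul1g.
  set tt := t f f' in t1 t2 *.
  (* Both [u] and [tt] carry [f'] to [f]. *)
  have hE : u * tt^-1 \in edge_stab a f.1 f.2.
    apply/(edge_stabP a_inv); first by rewrite act_adj.
    rewrite !actM -{1}t1 -{1}t2 !actVK /=.
    by rewrite -!actM invgM !mulgA mulgV mul1g.
  have hw := HK _ _ _ fF hE (wlenM un (wlenV (hc _ _ fF fF'))).
  have hA : wlen A (K * (n.+1 + c).+1) (kg g * (u * tt^-1) * (kg g)^-1).
    apply: wlen_conj hw => s sA; rewrite mem_filter; apply/andP; split.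
      have /(edge_stabP a_inv) : s \in edge_stab a f.1 f.2 by apply: (HAK f fF).1.
      rewrite act_adj => /(_ xz) /= [sx _].
      by apply/vertex_stabP; rewrite -[in X in X = _](kgx g) !actM actVK sx kgx.
    rewrite mem_cat; apply/orP; left; apply/allpairsPdep.
    by exists f, s.
  have hA2 : wlen A 1 (kg g * tt * (kg (g * u))^-1).
    apply: wlen_letter; rewrite mem_filter; apply/andP; split; last first.
      rewrite mem_cat; apply/orP; right; rewrite mem_cat; apply/orP; left.
      by apply/allpairsPdep; exists f, f'.
    apply/vertex_stabP; rewrite -[in X in X = _](kgx (g * u)) !actM actVK.
    by rewrite -[a (g * u)^-1 x0]/(f'.1) t1 kgx.
  have := wlenM hA hA2.
  have -> : kg g * (u * tt^-1) * (kg g)^-1 * (kg g * tt * (kg (g * u))^-1) =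
     kg g * u * (kg (g * u))^-1 by rewrite !mulgA mulgVK mulgVK.
  by apply: wlen_le; rewrite /C; nia.
have main : forall n w, size w <= n -> all (sletter S) w -> forall g, Z g ->
    Z (g * \prod_(s <- w) s) -> wlen A (C * size w)
      (kg g * \prod_(s <- w) s * (kg (g * \prod_(s <- w) s))^-1).
  elim=> [|n IH] [|b w] //=.
  - by move=> _ _ g _ _; rewrite ?big_nil ?mulg1 ?muln0 mulgV; exact: wlen1.
  - by move=> _ _ g _ _; rewrite ?big_nil ?mulg1 ?muln0 mulgV; exact: wlen1.
  rewrite ltnS => sw /andP[bS wS] g Zg Zgw; have bB : b \in B by rewrite mem_B.
  (* It suffices to treat a nonempty first piece that ends at a visit: the induction hypothesis
     covers the rest. *)
  have cat_case w1 w2 h : b :: w = w1 ++ w2 -> (0 < size w1)%N -> h = \prod_(s <- w1) s ->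
      Z (g * h) -> wlen A (C * size w1) (kg g * h * (kg (g * h))^-1) ->
      wlen A (C * (size w).+1) (kg g * \prod_(s <- b :: w) s *
         (kg (g * \prod_(s <- b :: w) s))^-1).
    move=> e w10 -> Zh wh.
    have ew : (size w).+1 = (size w1 + size w2)%N by rewrite -size_cat -e.
    rewrite ew mulnDr; set h1 := \prod_(s <- w1) s in Zh wh *.
    have ep : \prod_(s <- b :: w) s = h1 * \prod_(s <- w2) s by rewrite e big_cat.
    have := IH w2 _ _ (g * h1) Zh.
    rewrite -mulgA -ep => /(_ _ _ Zgw) h2.
    have {h2}/(wlenM wh) : wlen A (C * size w2) (kg (g * h1) * \prod_(s <- w2) s *
      (kg (g * \prod_(s <- b :: w) s))^-1).
      apply: h2; first lia.
      have : all (sletter S) (w1 ++ w2) by rewrite -e /= bS.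
  by rewrite all_cat => /andP[].
    by rewrite !mulgA mulgVK -(mulgA _ h1) -ep.
  have [Zgb|nZgb] := pselect (Z (g * b)).
    apply: (cat_case [:: b] w b) => //; first by rewrite big_seq1.
    by apply: wlen_le (single _ _ Zg Zgb bB); rewrite /= muln1 /C addn1.
  have gbx : a (g * b) x0 <> x0 by move=> e; apply: nZgb; left.
  have [z xz zgb] := branch_ex T_tree gbx.
  (* [B] is closed under inverses, so the step back from [g * b], which is not a visit, crosses no
     edge at [x0] either. *)
  have zg : side x0 z (a g x0).
    have bVB : b^-1 \in B by rewrite BV.
    by have := not_crosses nZgb bVB xz zgb; rewrite mulgK.
  (* [w1] ends at the first visit after [g]. No edge at [x0] is crossed in between, so the orbit is
     still behind [z] at that moment. *)
  have [w1 [w2 [e w10 Zw1 zw1]]] : exists w1 w2, [/\ b :: w = w1 ++ w2, (0 < size w1)%N,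
      Z (g * \prod_(s <- w1) s) & side x0 z (a (g * \prod_(s <- w1) s) x0)].
    have [w1 [w2 [e Zw1 zw1]]] : exists w1 w2, [/\ w = w1 ++ w2,
        Z (g * b * \prod_(s <- w1) s) & side x0 z (a (g * b * \prod_(s <- w1) s) x0)].
      move: (Zgw) zgb nZgb wS; rewrite big_cons mulgA.
      elim: (w) (g * b) => [|d v IHv] h; first by rewrite big_nil mulg1 => ? ? [].
      rewrite big_cons mulgA => Zv zh nZh /= /andP[dS vS].
      have zhd : side x0 z (a (h * d) x0).
        by apply: not_crosses => //; rewrite mem_B.
      have [Zhd|nZhd] := pselect (Z (h * d)).
        by exists [:: d], v; rewrite big_seq1.
      have [w1 [w2 [-> Zw1 zw1]]] := IHv _ Zv zhd nZhd vS.
      by exists (d :: w1), w2; rewrite big_cons mulgA.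
    by exists (b :: w1), w2; rewrite e big_cons mulgA.
  apply: (cat_case w1 w2 _ e w10 erefl Zw1).
  have -> : size w1 = (size w1).-1.+1 by rewrite prednK.
  apply: (excursion _ _ z) => //; [exact: Z_side|exact: Z_side|].
  exists w1; rewrite ?prednK //.
  have : all (sletter S) (w1 ++ w2) by rewrite -e /= bS.
  by rewrite all_cat => /andP[].
exists A, C; split=> [s|n g gV [w wS [e wn]]]; first by rewrite mem_filter => /andP[].
have gx : a g x0 = x0 by apply/vertex_stabP.
apply: (@wlen_le _ _ (C * size w)); first by rewrite leq_mul2l wn orbT.
have := main _ w (leqnn _) wS 1; rewrite mul1g e /kg invg1 act1 -{2}gx actVK k0.
rewrite mul1g invg1 mulg1; apply; left => //; by rewrite act1.
Qed.

End VertexStab.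

(** The bound also shows that [A] generates [H], because [S] generates [G]. The opposite estimate
    holds because the finitely many elements of [A] have bounded length over [S]. *)
Lemma words_undistorted (R : realType) (G : groupType) (S : gen_seq G) (H : groupClosed G)
    (A : seq G) (C : nat) :
  (forall s, s \in A -> s \in H) ->
  (forall n g, g \in H -> wlen S n g -> wlen A (C * n) g) ->
  undistorted R S H.
Proof.
move=> AH HA; pose A' : seq (subgroup_of H) := pmap insub A.
have A'A : map val A' = A.
  rewrite {}/A' {HA}; elim: A AH => //= s A IH sAH.
  rewrite /= insubT ?sAH ?inE ?eqxx //= => sH; congr (_ :: _); apply: IH => t tA.
  by apply: sAH; rewrite inE tA orbT.
have sl (s : subgroup_of H) : sletter A' s = sletter A (val s).
  by rewrite /sletter -A'A !(mem_map val_inj) -[(val s)^-1]/(val s^-1) !(mem_map val_inj).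
have pv (w : seq (subgroup_of H)) : \prod_(s <- map val w) s = val (\prod_(s <- w) s).
  by elim: w => [|s w IH]; rewrite ?big_nil //= !big_cons IH.
have up n (g : subgroup_of H) : wlen A n (val g) -> wlen A' n g.
  move=> [w wA [e wn]].
  have wH : all (fun s => s \in H) w.
    by apply: sub_all wA => s /orP[/AH //|/AH]; rewrite gpredV.
  exists (pmap insub w).
    elim: w wA wH {e wn} => //= s w IH /andP[sA wA] /andP[sH wH].
    by rewrite insubT /= sl /= sA IH.
  have ew : map val (pmap insub w : seq (subgroup_of H)) = w.
    by elim: w wH {wA e wn} => //= s w IH /andP[sH wH]; rewrite insubT /= IH.
  by split; [apply: val_inj; rewrite -pv ew|rewrite -(size_map val) ew].
have genA' : generates A'.
  apply/generatesP => g; have /generatesP /(_ (val g)) [n gn] := @gensP _ S.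
  by exists (C * n)%N; apply: up; apply: HA => //; exact: valP.
have [K2 hK2] : exists K2, forall s, s \in A' -> wlen S K2 (val s).
  have [len hlen] : exists len : G -> nat, forall g, wlen S (len g) g.
    have /generatesP /choice[len h] := @gensP _ S; by exists len.
  exists (\max_(s <- A') len (val s)) => s sA.
  by apply: wlen_le (hlen _); exact: (leq_bigmaxn_seq (fun s => len (val s)) sA).
have down n (g : subgroup_of H) : wlen A' n g -> wlen S (K2 * n) (val g).
  move=> [w wA [<- wn]]; apply: (@wlen_subst _ A).
    by move=> _ /[!(esym A'A)] /mapP[s sA ->]; exact: hK2.
  exists (map val w); last by rewrite size_map pv.
  by rewrite all_map; apply: sub_all wA => s /=; rewrite sl.
pose S' := GenSeq genA'; exists S'; pose K : R := (C + K2 + 1)%:R%R.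
exists K => [|g h]; first by rewrite ler1n addn1.
have [n gn nle] := word_dist_wlen R S (val g) (val h).
have [m gm mle] := word_dist_wlen R S' g h.
have := word_dist_le R (up _ (g^-1 * h) (HA _ _ (valP (g^-1 * h)) gn) : wlen S' _ _).
have := word_dist_le R (down _ _ gm : wlen S _ ((val g)^-1 * val h)).
rewrite !natrM; have -> : K = (C%:R + K2%:R + 1)%R by rewrite /K !natrD.
set x := word_dist R S' g h in mle *; set y := word_dist R S _ _ in nle *.
move=> d1 d2; have C0 : (0 <= C%:R :> R)%R by exact: ler0n.
have K0 : (0 <= K2%:R :> R)%R by exact: ler0n.
have n0 : (0 <= n%:R :> R)%R by exact: ler0n.
have m0 : (0 <= m%:R :> R)%R by exact: ler0n.
move: C0 K0 n0 m0 nle mle d1 d2.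
move: (C%:R)%R (K2%:R)%R (n%:R)%R (m%:R)%R => c k n' m' c0 k0 n0 m0 nle mle d1 d2.
apply/andP; split; last by nra.
rewrite lerBlDr ler_pdivrMl; nra.
Qed.

Lemma vertex_stab_undistorted (R : realType) (G : groupType) (S : gen_seq G)
    (T : graph) (a : action G T) (x : T) :
  is_tree T -> without_inversions a ->
  (forall x y : T, adj x y -> undistorted R S (edge_stab a x y)) ->
  undistorted R S (vertex_stab a x).
Proof.
move=> T_tree a_inv E_und.
have [A [C [AH HA]]] := vertex_stab_words T_tree a_inv E_und x.
exact: words_undistorted AH HA.
Qed.

Local Close Scope group_scope.
Local Open Scope ring_scope.

(** * Ultralimits and geodesics in Cayley graphs *)

Section Ultralimits.
Variables (R : realType) (X : metricType R) (U : set_system nat).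
Hypothesis UU : UltraFilter U.
Implicit Types (f g : nat -> X) (x y : X).
Local Notation d := (@mdist R X).

Definition ulim f x := forall e : R, 0 < e -> U [set n | d (f n) x < e].

Lemma ultra_ex (P : nat -> Prop) : U [set n | P n] -> exists n, P n.
Proof. by move=> /filter_ex[n Pn]; exists n. Qed.

Lemma ultraI (P Q : nat -> Prop) : U [set n | P n] -> U [set n | Q n] -> U [set n | P n /\ Q n].
Proof. exact: filterI. Qed.

Lemma ultraS (P Q : nat -> Prop) : (forall n, P n -> Q n) -> U [set n | P n] -> U [set n | Q n].
Proof. by move=> h; apply: filterS. Qed.

Lemma ultra_forall (I : eqType) (s : seq I) (P : I -> nat -> Prop) :
  (forall i, i \in s -> U [set n | P i n]) -> U [set n | forall i, i \in s -> P i n].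
Proof.
elim: s => [_|i s IH h]; first by apply: filterS (filterT); move=> n _ j.
have h1 := h i; rewrite inE eqxx in h1.
apply: ultraS (ultraI (h1 isT) (IH _)) => [n [pi ps] j|j js].
  by rewrite inE => /predU1P[->|/ps].
by apply: h; rewrite inE js orbT.
Qed.

Lemma ultra_pigeonhole (I : eqType) (s : seq I) (v : nat -> I) :
  U [set n | v n \in s] -> exists i, U [set n | v n = i].
Proof.
elim: s => [/ultra_ex[n] //|i s IH h].
have [vi|nvi] := in_ultra_setVsetC [set n | v n = i] UU; first by exists i.
apply: IH; apply: ultraS (ultraI h nvi) => n [+ nv].
by rewrite inE => /predU1P[/nv|].
Qed.

Lemma ulim_dist_le f g x y c : ulim f x -> ulim g y ->
  U [set n | d (f n) (g n) <= c] -> d x y <= c.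
Proof.
move=> fx gy fg; apply/ler_addgt0Pl => e e0.
have e2 : 0 < e / 2 by rewrite divr_gt0.
have [n /= [[h1 h2] h3]] := ultra_ex (ultraI (ultraI (fx _ e2) (gy _ e2)) fg).
have t1 := metric_triangle x (f n) y; have t2 := metric_triangle (f n) (g n) y.
have t3 := metric_sym x (f n); lra.
Qed.

Lemma ulim_dist_ge f g x y c : ulim f x -> ulim g y ->
  U [set n | c <= d (f n) (g n)] -> c <= d x y.
Proof.
move=> fx gy fg; apply/ler_addgt0Pl => e e0.
have e2 : 0 < e / 2 by rewrite divr_gt0.
have [n /= [[h1 h2] h3]] := ultra_ex (ultraI (ultraI (fx _ e2) (gy _ e2)) fg).
have t1 := metric_triangle (f n) x (g n); have t2 := metric_triangle x y (g n).
have t3 := metric_sym y (g n); lra.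
Qed.

Lemma ulim_cst x : ulim (fun _ => x) x.
Proof. by move=> e e0; apply: filterS (filterT) => n _ /=; rewrite mdistxx. Qed.

(** The limit is the supremum of the numbers that lie below [t n] for almost all [n]; the
    ultrafilter decides every comparison. *)
Lemma ultralimit_unit (t : nat -> R) : (forall n, 0 <= t n <= 1) ->
  exists2 t0, 0 <= t0 <= 1 & forall e, 0 < e -> U [set n | `|t n - t0| < e].
Proof.
move=> t01; pose A := [set r | U [set n | r <= t n]].
have A0 : A 0 by apply: filterS (filterT) => n _ /=; case/andP: (t01 n).
have A1 : ubound A 1.
  by move=> r /ultra_ex[n] /le_trans; apply; case/andP: (t01 n).
have hs : has_sup A by split; [exists 0|exists 1].
exists (sup A) => [|e e0].
  by rewrite (ub_le_sup hs.2) //= ge_sup //; exists 0.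
have [r Ar lr] := sup_adherent e0 hs.
have nA : U (~` [set n | sup A + e / 2 <= t n]).
  have [h|//] := in_ultra_setVsetC [set n | sup A + e / 2 <= t n] UU.
  by have := ub_le_sup hs.2 h; lra.
apply: ultraS (ultraI Ar nA) => n [h1 /negP]; rewrite -ltNge => h2.
by rewrite ltr_norml; lra.
Qed.

End Ultralimits.

(* Sequential properness, phrased with ultrafilters so that no diagonal
   extraction of subsequences is needed. *)
Definition uproper (R : realType) (X : metricType R) := forall (U : set_system nat)
  (UU : UltraFilter U) (f : nat -> X) (x0 : X) (M : R),
  U [set n | mdist (f n) x0 <= M] -> exists x, ulim U f x.

Lemma ultrafilter_oo : exists2 U : set_system nat, UltraFilter U &
  forall k, U [set n | (k <= n)%N].
Proof.
have [U [UU sU]] := @ultraFilterLemma nat \oo _.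
by exists U => // k; apply: sU; exact: nbhs_infty_ge.
Qed.

Section EdgePoints.
Variables (R : realType) (X : cgraph).
Hypothesis X_fin : forall u : X, exists L : seq X, forall v, adj u v -> v \in L.
Implicit Types (x y : realization R X) (u v w : X).
Local Notation d := (@mdist R (realization R X)).

Let barysum (phi : X -> R) (L : seq X) (f : X -> R) := \sum_(w <- L) f w * phi w.

Let barysum_edge phi L u v t : uniq L -> u \in L -> v \in L ->
  barysum phi L (edge_pt u v t) = (1 - t) * phi u + t * phi v.
Proof.
move=> uL; rewrite /barysum /edge_pt => Lu Lv.
have delta u' : u' \in L -> \sum_(w <- L) (w == u')%:R * phi w = phi u'.
  move=> Lu'; rewrite (bigD1_seq u') //= eqxx mul1r big1 ?addr0 // => i /negPf ->.
  by rewrite mul0r.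
rewrite -[in RHS](delta u) // -[in RHS](delta v) // !mulr_sumr -big_split /=.
by apply: eq_bigr => w _; ring.
Qed.

(** The affine extension of [phi] is its pairing with the barycentric coordinates, which do not
    depend on the edge used to represent the point. *)
Lemma edge_pt_affine (phi : X -> R) u v s u' v' t : edge_pt u v s = edge_pt u' v' t ->
  (1 - s) * phi u + s * phi v = (1 - t) * phi u' + t * phi v'.
Proof.
move=> e; pose L := undup [:: u; v; u'; v'].
rewrite -(@barysum_edge phi L) ?undup_uniq ?mem_undup ?inE ?eqxx ?orbT //.
by rewrite e barysum_edge ?undup_uniq ?mem_undup ?inE ?eqxx ?orbT.
Qed.

Lemma chain_affine (phi : X -> R) x y l u v s u' v' t :
  (forall u v, adj u v -> `|phi u - phi v| <= 1) ->
  chain x y l -> x = edge_pt u v s :> (X -> R) -> y = edge_pt u' v' t :> (X -> R) ->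
  `|(1 - s) * phi u + s * phi v - ((1 - t) * phi u' + t * phi v')| <= l.
Proof.
move=> lip ch; elim: ch u v s => [z|z z' z'' a b s' t' k ab s01 t01 ez ez' _ IH] u v s ex ey.
  by rewrite (edge_pt_affine phi (etrans (esym ex) ey)) subrr normr0.
rewrite (edge_pt_affine phi (etrans (esym ex) ez)).
apply: le_trans (ler_distD ((1 - t') * phi a + t' * phi b) _ _) _.
apply: lerD (IH _ _ _ ez' ey).
have -> : (1 - s') * phi a + s' * phi b - ((1 - t') * phi a + t' * phi b) =
   (s' - t') * (phi b - phi a) by ring.
by rewrite normrM ler_piMr // distrC lip.
Qed.

Lemma edge_dist x y u v s t : (u == v) || adj u v -> 0 <= s <= 1 -> 0 <= t <= 1 ->
  x = edge_pt u v s :> (X -> R) -> y = edge_pt u v t :> (X -> R) -> d x y <= `|s - t|.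
Proof.
move=> /orP[/eqP <-|uv] s01 t01 ex ey.
  suff -> : x = y by rewrite mdistxx.
  by apply: realization_inj; rewrite ex ey; apply/funext => w; rewrite /edge_pt; ring.
rewrite -[`|_|]addr0; apply: length_dist_le.
by apply: chain_cons uv s01 t01 ex ey (chain_nil _).
Qed.

Lemma near_vertex x : exists u, d x (vertex_pt R u) <= 1.
Proof.
have [u [v [t [uv t01 ex]]]] := baryP x; exists u.
apply: (le_trans (edge_dist (s := t) (t := 0) uv t01 _ ex _)).
- by rewrite lexx ler01.
- by apply/funext => w; rewrite /= /edge_pt; ring.
- by case/andP: t01 => t0 t1; rewrite subr0 ger0_norm.
Qed.

(** The affine extension of [gdist u0] vanishes at [u0] and is 1-Lipschitz along chains; the 1
    allows for the position of [x] on its edge. *)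
Lemma gdist_mdist u0 u v t x : (u == v) || adj u v -> 0 <= t <= 1 ->
  x = edge_pt u v t :> (X -> R) ->
  (gdist (@cgraphP X) u0 u)%:R <= d (vertex_pt R u0) x + 1.
Proof.
move=> uv /andP[t0 t1] ex; rewrite -lerBlDr; apply: le_length_dist => l ch.
pose phi w : R := (gdist (@cgraphP X) u0 w)%:R.
have lip1 a b : adj a b -> phi b <= phi a + 1.
  by move=> ab; rewrite /phi natr1 ler_nat gdist_adj.
have lip a b : adj a b -> `|phi a - phi b| <= 1.
  move=> ab; have ba : adj b a by rewrite adj_sym.
  by have := lip1 _ _ ab; have := lip1 _ _ ba; rewrite ler_norml; lra.
have := chain_affine lip ch erefl ex.
have -> : phi u0 = 0 by rewrite /phi gdistxx.
rewrite !mulr0 addr0 sub0r normrN => /(le_trans (ler_norm _)).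
have puv : phi u <= phi v + 1.
  case/orP: uv => [/eqP ->|uv]; first by rewrite lerDl.
  by apply: lip1; rewrite adj_sym.
rewrite -/(phi u); nra.
Qed.

Lemma ball_fin u0 (M : R) : exists L : seq X, forall u v t x,
  (u == v) || adj u v -> 0 <= t <= 1 -> x = edge_pt u v t :> (X -> R) ->
  d (vertex_pt R u0) x <= M -> u \in L /\ v \in L.
Proof.
have [L HL] : exists L : seq X, forall u, (gdist (@cgraphP X) u0 u)%:R <= M + 1 -> u \in L.
  suff [L HL] : exists L : seq X, forall s, path (@adj X) u0 s ->
      (size s <= Num.truncn (M + 1))%N -> last u0 s \in L.
    exists L => u; have [s us [<- <-]] := gdist_path (@cgraphP X) u0 u => sM.
    apply: HL => //; rewrite truncn_ge_nat //; exact: le_trans sM.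
  elim: (Num.truncn (M + 1)) => [|n [L IH]]; first by exists [:: u0] => -[|//]; rewrite inE.
  have /choice[nb hnb] := X_fin.
  exists (L ++ flatten (map nb L)) => s; case/lastP: s => [|s v] us sn.
    by rewrite mem_cat (IH [::]).
  rewrite last_rcons mem_cat; apply/orP; right; apply/flatten_mapP.
  move: us sn; rewrite rcons_path size_rcons ltnS => /andP[us uv] /(IH _ us) sL.
  by exists (last u0 s) => //; exact: hnb.
exists L => u v t x uv t01 ex dx; split; apply: HL.
  by apply: le_trans (gdist_mdist u0 uv t01 ex) _; rewrite lerD2r.
have vu : (v == u) || adj v u by rewrite eq_sym adj_sym.
have t01' : 0 <= 1 - t <= 1 by lra.
apply: le_trans (gdist_mdist u0 (x := x) vu t01' _) _; last by rewrite lerD2r.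
by rewrite ex; apply/funext => w; rewrite /edge_pt; ring.
Qed.

(** Finitely many edges meet a ball, so the ultrafilter selects one of them, on which the parameters
    converge. *)
Lemma realization_proper : uproper (realization R X).
Proof.
move=> U UU f x0 M fM; have [u0 xu0] := near_vertex x0.
have /choice[rep hrep] : forall n, exists r : X * X * R,
    [/\ (r.1.1 == r.1.2) || adj r.1.1 r.1.2, 0 <= r.2 <= 1 &
        f n = edge_pt r.1.1 r.1.2 r.2 :> (X -> R)].
  by move=> n; have [u [v [t h]]] := baryP (f n); exists (u, v, t).
have [L HL] := ball_fin u0 (M + 1).
have uL : U [set n | (rep n).1 \in [seq (u, v) | u <- L, v <- L]].
  apply: ultraS fM => n fn; have [h1 h2 h3] := hrep n.
  have [|uL vL] := HL _ _ _ _ h1 h2 h3.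
    by rewrite metric_sym; apply: le_trans (metric_triangle _ x0 _) _; exact: lerD.
  by apply/allpairsPdep; exists (rep n).1.1, (rep n).1.2; split=> //; case: (rep n).1.
have [[u v] uvU] := ultra_pigeonhole UU uL.
have [t0 t001 ht0] := @ultralimit_unit R U UU (fun n => (rep n).2) (fun n => let: And3 _ h _ := hrep n in h).
have [n0 hn0] := ultra_ex UU uvU.
have uv : (u == v) || adj u v by have [] := hrep n0; rewrite hn0.
have xP : exists a b t, [/\ (a == b) || adj a b, 0 <= t <= 1 & edge_pt u v t0 = edge_pt a b t :> (X -> R)].
  by exists u, v, t0.
exists (Realization xP) => e e0; apply: ultraS (ultraI UU uvU (ht0 e e0)) => n [hn lt].
have [h1 h2 h3] := hrep n; rewrite hn in h1 h3.
by apply: le_lt_trans lt; apply: (edge_dist h1 h2 t001 h3).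
Qed.

End EdgePoints.

(** * Limits of geodesics *)

Section Geodesics.
Variables (R : realType) (X : metricType R).
Implicit Types (f g r : R -> X) (x y z : X) (L T : R).
Local Notation d := (@mdist R X).

Definition geodesic_on L f :=
  forall s t, 0 <= s <= L -> 0 <= t <= L -> d (f s) (f t) = `|s - t|.

Definition geodesic_half f :=
  forall s t, 0 <= s -> 0 <= t -> d (f s) (f t) = `|s - t|.

Definition geodesic_space := forall x y, exists f,
  [/\ f 0 = x, f (d x y) = y & geodesic_on (d x y) f].

Lemma geodesic_half_on L f : geodesic_half f -> geodesic_on L f.
Proof. by move=> gf s t /andP[s0 _] /andP[t0 _]; exact: gf. Qed.

Lemma net_close f g T (e e' : R) : 0 < e -> geodesic_on T f -> geodesic_on T g ->
  (forall j : nat, j%:R * e <= T -> d (f (j%:R * e)) (g (j%:R * e)) <= e') ->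
  forall t, 0 <= t <= T -> d (f t) (g t) <= e' + 2 * e.
Proof.
move=> e0 gf gg fg t /andP[t0 tT]; pose j := Num.truncn (t / e).
have te0 : 0 <= t / e by rewrite divr_ge0 // ltW.
have := truncn_itv te0; rewrite -/j => /andP[].
rewrite ler_pdivlMr // ltr_pdivrMr // -natr1 mulrDl mul1r => j1 j2.
have je0 : 0 <= j%:R * e by rewrite mulr_ge0 // ltW.
have h1 : d (f t) (f (j%:R * e)) <= e.
  by rewrite gf; [rewrite ger0_norm; lra|lra|lra].
have h2 : d (g t) (g (j%:R * e)) <= e.
  by rewrite gg; [rewrite ger0_norm; lra|lra|lra].
have h3 := fg j (le_trans j1 tT).
have t1 := metric_triangle (f t) (f (j%:R * e)) (g t).
have t2 := metric_triangle (f (j%:R * e)) (g (j%:R * e)) (g t).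
have t3 := metric_sym (g t) (g (j%:R * e)); lra.
Qed.

Hypothesis X_proper : uproper X.

(** The limit is pointwise along an ultrafilter. Closeness on a finite net of mesh [e / 3] gives
    closeness on the whole interval, geodesics being 1-Lipschitz. *)
Lemma arzela_ascoli (q : X) (r : nat -> R -> X) (L : nat -> R) :
  (forall n, [/\ r n 0 = q, n%:R <= L n & geodesic_on (L n) (r n)]) ->
  exists rho, [/\ rho 0 = q, geodesic_half rho &
    forall T e k, 0 < e -> exists n, [/\ (k <= n)%N, T <= L n &
      forall t, 0 <= t <= T -> d (r n t) (rho t) <= e]].
Proof.
move=> hr; have [U UU Uoo] := ultrafilter_oo.
have Ularge (T : R) : U [set n | T <= L n].
  have := Uoo (Num.truncn T).+1; apply: filterS => n /= Tn.
  have [_ nL _] := hr n; apply: le_trans nL.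
  apply: le_trans (ltW (truncnS_gt T)) _; by rewrite ler_nat.
have /choice[rho hrho] : forall t, exists x, 0 <= t -> ulim U (fun n => r n t) x.
  move=> t; have [t0|_] := boolP (0 <= t); last by exists q.
  have [|x hx] := X_proper UU (f := fun n => r n t) (x0 := q) (M := t).
    apply: filterS (Ularge t) => n /= tL; have [r0 _ gr] := hr n.
    by rewrite -r0 gr ?subr0 ?ger0_norm //; lra.
  by exists x.
have grho : geodesic_half rho.
  move=> s t s0 t0; apply/eqP; rewrite eq_le; apply/andP; split.
    apply: (ulim_dist_le UU (hrho s s0) (hrho t t0)).
    apply: filterS (filterI (Ularge s) (Ularge t)) => n /= [sL tL].
    by have [_ _ gr] := hr n; rewrite gr //; lra.
  apply: (ulim_dist_ge UU (hrho s s0) (hrho t t0)).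
  apply: filterS (filterI (Ularge s) (Ularge t)) => n /= [sL tL].
  by have [_ _ gr] := hr n; rewrite gr //; lra.
exists rho; split=> //.
  apply: mdist_positivity; apply/eqP; rewrite eq_le mdist_ge0 andbT.
  apply: (ulim_dist_le UU (hrho 0 (lexx _)) (ulim_cst UU q)).
  by apply: filterS filterT => n _ /=; have [-> _ _] := hr n; rewrite mdistxx.
move=> T e k e0; have e3 : 0 < e / 3 by rewrite divr_gt0.
have hnet : U [set n | forall j, j \in iota 0 (Num.truncn (T / (e / 3))).+1 ->
    d (r n (j%:R * (e / 3))) (rho (j%:R * (e / 3))) < e / 3].
  apply: ultra_forall => j _; apply: (hrho _ _ _ e3).
  exact: mulr_ge0 (ler0n _ _) (ltW e3).
have [n [[kn TL] net]] := ultra_ex UU (ultraI UU (ultraI UU (Uoo k) (Ularge T)) hnet).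
rewrite /= in kn TL.
exists n; split=> // t tT; have [_ _ gr] := hr n.
have -> : e = e / 3 + 2 * (e / 3) by field.
apply: (net_close e3 _ (geodesic_half_on grho) _ tT) => [s t' sT tT'|j jT].
  by apply: gr; lra.
apply/ltW/net; rewrite mem_iota /= add0n ltnS truncn_ge_nat; last first.
  by rewrite divr_ge0 ?(ltW e3) //; apply: le_trans jT; rewrite mulr_ge0 // ltW.
by rewrite ler_pdivlMr.
Qed.

End Geodesics.

Section RealizationGeodesic.
Variables (R : realType) (X : cgraph).
Implicit Types (x y : realization R X) (u v w : X).
Local Notation d := (@mdist R (realization R X)).

(** The chain is parametrised by its length, one piece after the other. *)
Lemma chain_lipschitz x y l : chain x y l -> exists f : R -> realization R X,
  [/\ f 0 = x, f l = y & forall s t, 0 <= s -> s <= t -> t <= l -> d (f s) (f t) <= t - s].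
Proof.
elim=> [z|z z' z'' u v s t k uv s01 t01 ez ez' ch [f [f0 fk fl]]].
  by exists (fun=> z); split=> // s t s0 st t0; rewrite mdistxx; lra.
have uv' : (u == v) || adj u v by rewrite uv orbT.
pose a := `|s - t|; have a0 : 0 <= a by exact: normr_ge0.
have k0 := chain_ge0 ch.
pose par (tau : R) : R := if s <= t then s + tau else s - tau.
have par01 tau : 0 <= tau <= a -> 0 <= par tau <= 1.
  rewrite /par /a; case: (leP s t) => st; first by rewrite ler0_norm; lra.
  by rewrite gtr0_norm; lra.
have parL tau tau' : `|par tau - par tau'| = `|tau - tau'|.
  rewrite /par; case: (s <= t); first by congr `|_|; ring.
  by rewrite -normrN; congr `|_|; ring.
have /choice[e he] : forall tau : R, exists p : realization R X, 0 <= tau <= a -> p = edge_pt u v (par tau) :> (X -> R).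
  move=> tau; have [h|nh] := boolP (0 <= tau <= a); last by exists z.
  have pP : exists b c t', [/\ (b == c) || adj b c, 0 <= t' <= 1 & edge_pt u v (par tau) = edge_pt b c t' :> (X -> R)].
    by exists u, v, (par tau); split=> //; exact: par01.
  by exists (Realization pP).
have ea : e a = z'.
  apply: realization_inj; rewrite he ?ez' ?a0 ?lexx //; congr edge_pt.
  by rewrite /par /a; case: (leP s t) => st; [rewrite ler0_norm|rewrite gtr0_norm]; lra.
have e0 : e 0 = z.
  apply: realization_inj; rewrite he ?ez ?a0 ?lexx //; congr edge_pt.
  by rewrite /par; case: (leP s t) => st; lra.
have el tau tau' : 0 <= tau -> tau <= tau' -> tau' <= a -> d (e tau) (e tau') <= tau' - tau.
  move=> h1 h2 h3; have i1 : 0 <= tau <= a by lra. 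
  have i2 : 0 <= tau' <= a by lra.
  apply: le_trans (edge_dist uv' (par01 _ i1) (par01 _ i2) (he _ i1) (he _ i2)) _.
  by rewrite parL ler0_norm; lra.
exists (fun tau => if tau <= a then e tau else f (tau - a)); split.
- by rewrite a0.
- rewrite -/a; case: ifP => [ak|_]; last by rewrite addrAC subrr add0r.
  have -> : k = 0 by lra.
  by rewrite addr0 ea -f0 -[in RHS]fk; congr f; lra.
- move=> s1 t1 s10 st1 t1l; case: ifP => h1; case: ifP => h2; try lra.
  + exact: el.
  + have h3 := el _ _ s10 h1 (lexx a).
    have h4 : d (f 0) (f (t1 - a)) <= t1 - a - 0 by apply: fl; rewrite -/a in t1l; lra.
    rewrite ea -f0 in h3; have := metric_triangle (e s1) (f 0) (f (t1 - a)); lra.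
  + have h4 : d (f (s1 - a)) (f (t1 - a)) <= t1 - a - (s1 - a).
      by apply: fl; rewrite -/a in t1l; lra.
    lra.
Qed.

Hypothesis X_fin : forall u : X, exists L : seq X, forall v, adj u v -> v \in L.

(* Ultralimit of paths whose lengths tend to the distance. *)
Lemma realization_geodesic : geodesic_space (realization R X).
Proof.
move=> x y; have [U UU Uoo] := ultrafilter_oo; set D := d x y.
have D0 : 0 <= D by exact: mdist_ge0.
have inv0 n : 0 < n.+1%:R^-1 :> R by rewrite invr_gt0.
have /choice[f hf] : forall n : nat, exists f : R -> realization R X, [/\ f 0 = x,
    d (f D) y <= n.+1%:R^-1 & forall s t, 0 <= s -> s <= t -> t <= D -> d (f s) (f t) <= t - s].
  move=> n; have [l xl ll] := inf_adherent (inv0 n) (has_inf_chain x y).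
  have [f [f0 fl fL]] := chain_lipschitz xl; have Dl := length_dist_le xl.
  rewrite -[length_dist x y]/D in Dl; rewrite -[inf _]/D in ll.
  exists f; split=> // [|s t s0 st tD]; last by apply: fL; lra.
  by rewrite -fl; apply: le_trans (fL _ _ D0 Dl (lexx _)) _; rewrite lerBlDl ltW.
have /choice[g hg] : forall t, exists z, 0 <= t <= D -> ulim U (fun n => f n t) z.
  move=> t; have [/andP[t0 tD]|_] := boolP (0 <= t <= D); last by exists x.
  have [|z hz] := realization_proper X_fin UU (f := fun n => f n t) (x0 := x) (M := t).
    apply: filterS filterT => n _ /=; have [f0 _ fL] := hf n.
    by rewrite -f0 metric_sym; apply: le_trans (fL _ _ _ t0 tD) _; rewrite ?subr0.
  by exists z.
have i0 : (0 : R) <= 0 <= D by lra.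
have iD : 0 <= D <= D by lra.
have g0 : g 0 = x.
  apply: mdist_positivity; apply/eqP; rewrite eq_le mdist_ge0 andbT.
  apply: (ulim_dist_le UU (hg 0 i0) (ulim_cst UU x)).
  by apply: filterS filterT => n _ /=; have [-> _ _] := hf n; rewrite mdistxx.
have gD : g D = y.
  apply: mdist_positivity; apply/eqP; rewrite eq_le mdist_ge0 andbT.
  apply/ler_addgt0Pl => e e0; rewrite addr0.
  apply: (ulim_dist_le UU (hg D iD) (ulim_cst UU y)).
  have := Uoo (Num.truncn e^-1); apply: filterS => n /= en.
  have [_ h _] := hf n; apply: le_trans h _.
  rewrite -[leRHS]invrK lef_pV2 ?posrE ?invr_gt0 //.
  by apply: le_trans (ltW (truncnS_gt _)) _; rewrite ler_nat ltnS.
have gL s t : 0 <= s -> s <= t -> t <= D -> d (g s) (g t) <= t - s.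
  move=> s0 st tD; have is_ : 0 <= s <= D by lra.
  have it : 0 <= t <= D by lra.
  apply: (ulim_dist_le UU (hg s is_) (hg t it)).
  by apply: filterS filterT => n _ /=; have [_ _ h] := hf n; apply: h.
exists g; split=> // s t /andP[s0 sD] /andP[t0 tD].
wlog st : s t s0 sD t0 tD / s <= t => [h|].
  have [st|/ltW st] := leP s t; first exact: h.
  by rewrite metric_sym distrC; exact: h.
apply/eqP; rewrite eq_le ler0_norm; last lra.
have h1 := gL _ _ s0 st tD; have h2 := gL _ _ (lexx 0) s0 sD.
have h3 := gL _ _ t0 tD (lexx D); rewrite g0 in h2; rewrite gD in h3.
have t1 := metric_triangle x (g s) y; have t2 := metric_triangle (g s) (g t) y.
rewrite -/D in t1; lra.
Qed.

End RealizationGeodesic.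

Section CayleyGeometry.
Variables (R : realType) (G : groupType) (S : gen_seq G).
Local Notation d := (@mdist R (cayley R S)).
Local Notation vtx := (cayley_vertex R S).

Lemma cayley_fin (u : cayley_cgraph S) :
  exists L : seq (cayley_cgraph S), forall v, adj u v -> v \in L.
Proof.
exists ([seq (u * s)%g | s <- S] ++ [seq (u * s^-1)%g | s <- S]) => v /andP[_].
have vE : v = (u * (u^-1 * v))%g by rewrite mulVKg.
rewrite /letter mem_cat => /orP[h|h]; apply/orP; [left|right]; apply/mapP.
  by exists (u^-1 * v)%g.
by exists (u^-1 * v)^-1%g; rewrite ?invgK.
Qed.

Lemma cayley_proper : uproper (cayley R S).
Proof. exact: realization_proper cayley_fin. Qed.

Lemma cayley_geodesic : geodesic_space (cayley R S).
Proof. exact: realization_geodesic cayley_fin. Qed.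

Lemma cayley_near (x : cayley R S) : exists g, d x (vtx g) <= 1.
Proof. by have [g hg] := near_vertex x; exists g. Qed.

Lemma cayley_ball (M : R) : exists B : seq G, forall g, d (vtx 1%g) (vtx g) <= M -> g \in B.
Proof.
have [L HL] := @ball_fin R _ cayley_fin (1%g : G) M; exists L => g gM.
have [] // := HL g g 0 (vtx g) _ _ erefl gM; first by rewrite eqxx.
by rewrite lexx ler01.
Qed.

(** Translation acts on barycentric coordinates by precomposition with the inverse and maps chains
    to chains of the same length; one inequality suffices, applied to [k] and to [k^-1]. *)
Lemma cayley_left (k g h : G) : d (vtx (k * g)%g) (vtx (k * h)%g) = d (vtx g) (vtx h).
Proof.
have le (k' g' h' : G) : d (vtx (k' * g')%g) (vtx (k' * h')%g) <= d (vtx g') (vtx h').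
  apply: le_length_dist => l ch; apply: length_dist_le.
  have trP (x : cayley R S) : exists u v t, [/\ (u == v) || adj u v, 0 <= t <= 1 &
      (fun w : cayley_cgraph S => bary x (k'^-1 * w)%g) = edge_pt u v t].
    have [u [v [t [uv t01 ->]]]] := baryP x.
    exists (k' * u)%g, (k' * v)%g, t; split=> //.
      case/orP: uv => [/eqP ->|]; first by rewrite eqxx.
      move=> /andP[uv luv]; apply/orP; right; rewrite /adj /= /cayley_adj.
      by rewrite (inj_eq (mulgI k')) uv invgM -mulgA mulKg.
    by apply/funext => w; rewrite /edge_pt !(can2_eq (mulVKg k') (mulKg k')).
  pose tr x := Realization (trP x).
  have vtr g1 : vtx (k' * g1)%g = tr (vtx g1).
    apply: realization_inj; apply/funext => w.
    by rewrite /= /edge_pt !(can2_eq (mulVKg k') (mulKg k')).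
  rewrite !vtr; elim: ch => [x|x y z u v s t m uv s01 t01 ex ey _ IH]; first exact: chain_nil.
  apply: (@chain_cons R (cayley_cgraph S) (tr x) (tr y) (tr z) (k' * u)%g (k' * v)%g s t m _ s01 t01 _ _ IH).
  - move: uv => /andP[uv luv]; rewrite /adj /= /cayley_adj.
    by rewrite (inj_eq (mulgI k')) uv invgM -mulgA mulKg.
  - by rewrite /= ex; apply/funext => w; rewrite /edge_pt !(can2_eq (mulVKg k') (mulKg k')).
  - by rewrite /= ey; apply/funext => w; rewrite /edge_pt !(can2_eq (mulVKg k') (mulKg k')).
apply/eqP; rewrite eq_le le /=.
by have := le k^-1%g (k * g)%g (k * h)%g; rewrite !mulKg.
Qed.

Lemma cayley_dist1 (g h : G) : d (vtx g) (vtx h) = d (vtx 1%g) (vtx (g^-1 * h)%g).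
Proof. by rewrite -(cayley_left g^-1%g) mulVg. Qed.

Lemma cayley_bounded (I : eqType) (s : seq I) (f : I -> G) :
  exists2 M : R, 0 <= M & forall i, i \in s -> d (vtx 1%g) (vtx (f i)) <= M.
Proof.
elim: s => [|i s [M M0 hM]]; first by exists 0.
exists (M + d (vtx 1%g) (vtx (f i))) => [|j]; first by rewrite addr_ge0 ?mdist_ge0.
rewrite inE => /predU1P[->|/hM]; first by rewrite lerDr.
by move/le_trans; apply; rewrite lerDl mdist_ge0.
Qed.

End CayleyGeometry.

(** * Morse rays *)

Section Morse.
Variables (R : realType) (X : metricType R).
Implicit Types (f g h : R -> X) (x y z : X) (A : set X) (N : R -> R) (C : R).
Local Notation d := (@mdist R X).

Definition qgeo C a b h := forall s t, a <= s <= b -> a <= t <= b ->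
  C^-1 * `|s - t| - C <= d (h s) (h t) <= C * `|s - t| + C.

Definition half_image f : set X := [set x | exists2 s, 0 <= s & x = f s].

(** The Morse condition sees only the image of a path. As a property of sets it applies to [i \o r]
    and to total functions alike. *)
Definition morse_set N A := forall C a b h, 1 <= C -> a <= b -> qgeo C a b h ->
  A (h a) -> A (h b) -> forall t, a <= t <= b -> exists2 x, A x & d (h t) x <= N C.

Lemma morse_set_le N N' A : (forall C, 1 <= C -> N C <= N' C) -> morse_set N A -> morse_set N' A.
Proof.
move=> NN' mA C a b h C1 ab qh ha hb t tab; have [x Ax hx] := mA C a b h C1 ab qh ha hb t tab.
by exists x => //; apply: le_trans hx (NN' _ C1).
Qed.

(* Quasi-geodesics need not be continuous, so their endpoints may be moved. *)
Lemma morse_set_near N A C D a b h x y : morse_gauge N -> morse_set N A ->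
  1 <= C -> 0 <= D -> a <= b -> qgeo C a b h -> A x -> A y ->
  d (h a) x <= D -> d (h b) y <= D ->
  forall t, a <= t <= b -> exists2 z, A z & d (h t) z <= N (C + 2 * D) + D.
Proof.
move=> gN mA C1 D0 ab qh Ax Ay hax hby t tab.
have C'1 : 1 <= C + 2 * D by lra.
have N0 := gN _ C'1.
have [ta|ta] := eqVneq t a; first by exists x => //; rewrite ta; lra.
have [tb|tb] := eqVneq t b; first by exists y => //; rewrite tb; lra.
pose k s := if s == a then x else if s == b then y else h s.
have ka : k a = x by rewrite /k eqxx.
have kb : k b = y.
  rewrite /k eqxx; case: eqP => // ba; exfalso.
  by move: tab ta; rewrite ba => /andP[t1 t2] /eqP; apply; apply/eqP; rewrite eq_le t1 t2.
have kt : k t = h t by rewrite /k (negPf ta) (negPf tb).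
have kh s : d (k s) (h s) <= D.
  rewrite /k; case: eqP => [->|_]; first by rewrite metric_sym.
  by case: eqP => [->|_]; [rewrite metric_sym|rewrite mdistxx].
have qk : qgeo (C + 2 * D) a b k.
  move=> s s' sab s'ab; have /andP[q1 q2] := qh s s' sab s'ab.
  have n0 : 0 <= `|s - s'| by exact: normr_ge0.
  have t1 := metric_triangle (k s) (h s) (k s'); have t2 := metric_triangle (h s) (h s') (k s').
  have t3 := metric_triangle (h s) (k s) (h s'); have t4 := metric_triangle (k s) (k s') (h s').
  have e1 := metric_sym (h s) (k s); have e2 := metric_sym (h s') (k s').
  have h1 := kh s; have h2 := kh s'.
  have C'C : (C + 2 * D)^-1 <= C^-1 by rewrite lef_pV2 ?posrE; lra.
  by apply/andP; split; nra.
have [||z Az hz] := mA _ _ _ _ C'1 ab qk _ _ t tab; rewrite ?ka ?kb //.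
by exists z => //; rewrite -kt; lra.
Qed.

End Morse.

(** A sequence that avoids the [J]-neighbourhood of [s] starts below it and cannot jump over it.
    Only upward jumps have to be bounded. *)
Lemma discrete_ivt (R : realType) (u : nat -> R) m (J T s : R) : 0 <= J ->
  (forall j, (j < m)%N -> u j.+1 <= u j + J) -> u 0%N <= J -> T - J <= u m ->
  0 <= s <= T -> exists2 j, (j <= m)%N & `|u j - s| <= J.
Proof.
move=> J0 step u0 um /andP[s0 sT]; apply: contrapT => no.
have far j : (j <= m)%N -> ~ `|u j - s| <= J by move=> jm h; apply: no; exists j.
have low j : (j <= m)%N -> u j < s.
  elim: j => [_|j IH jm].
    by rewrite ltNge; apply/negP => h; apply: (far 0%N) => //; rewrite ger0_norm; lra.
  have := IH (ltnW jm) => uj; have fj := far j (ltnW jm); have := step j jm.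
  rewrite ltr0_norm in fj; last by lra.
  move=> st; rewrite ltNge; apply/negP => h; apply: fj; lra.
have := low m (leqnn _) => lm; apply: (far m) => //; rewrite ltr0_norm; lra.
Qed.

(** * Morse rays and quasi-isometric embeddings *)

Section QuasiIsometry.
Variables (R : realType) (X Y : metricType R) (i : Y -> X) (K : R).
Local Notation d := mdist.
Hypothesis K1 : (1 : R) <= K.
Hypothesis iK : forall x y, K^-1 * d x y - K <= d (i x) (i y) <= K * d x y + K.

Let K_gt0 : 0 < K.
Proof. exact: lt_le_trans ltr01 K1. Qed.

Lemma qi_upper x y : d (i x) (i y) <= K * d x y + K.
Proof. by have /andP[] := iK x y. Qed.

Lemma qi_lower x y : d x y <= K * (d (i x) (i y) + K).
Proof. by have /andP[h _] := iK x y; rewrite -ler_pdivrMl ?K_gt0 //; lra. Qed.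

Lemma qgeo_qi C a b h : 1 <= C -> qgeo C a b h -> qgeo (K * C + K) a b (i \o h).
Proof.
have K1' : (1 : R) <= K := K1.
move=> C1 qh s t sab tab; have /andP[q1 q2] := qh s t sab tab.
have /andP[k1 k2] := iK (h s) (h t).
have n0 : 0 <= `|s - t| by exact: normr_ge0.
have Ki : 0 < K^-1 by rewrite invr_gt0 K_gt0.
have C0 : 0 < C by lra.
have Ki1 : K^-1 <= 1 by rewrite invf_le1 ?K_gt0.
have Ci : 0 < C^-1 by rewrite invr_gt0.
have Kn : 0 <= K * `|s - t| by rewrite mulr_ge0 // ltW.
apply/andP; split; last first.
  have : K * d (h s) (h t) <= K * (C * `|s - t| + C) by rewrite ler_wpM2l // ltW.
  by rewrite /=; lra.
have lei : (K * C + K)^-1 <= K^-1 * C^-1.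
  have KC : 0 < K * C by rewrite mulr_gt0.
  rewrite -invfM lef_pV2 ?posrE //; last by rewrite addr_gt0.
  by rewrite lerDl ltW.
rewrite /=; apply: le_trans k1.
have : K^-1 * (C^-1 * `|s - t| - C) <= K^-1 * d (h s) (h t) by rewrite ler_wpM2l // ltW.
have : (K * C + K)^-1 * `|s - t| <= K^-1 * C^-1 * `|s - t| by rewrite ler_wpM2r.
have : K^-1 * C <= K * C by rewrite ler_wpM2r ?(ltW C0) // (le_trans Ki1).
lra.
Qed.

Lemma geodesic_qgeo L f : geodesic_on L f -> qgeo K 0 L (i \o f).
Proof. by move=> gf s t sL tL; rewrite /= -(gf s t sL tL); exact: iK. Qed.

(** Quasi-geodesics are pushed forward by [i], and distances are pulled back by its lower bound.
    Hence a ray of a subgroup that is Morse in the group is Morse in the subgroup. *)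
Lemma morse_set_pull N r : morse_set N (half_image (i \o r)) ->
  morse_set (fun C => K * (N (K * C + K) + K)) (half_image r).
Proof.
have K1' : (1 : R) <= K := K1.
move=> mr C a b h C1 ab qh [sa sa0 ha] [sb sb0 hb] t tab.
have KC : 1 <= K * C + K.
  have : 0 <= K * C by rewrite mulr_ge0 ?(ltW K_gt0) // (le_trans ler01).
  lra.
have [||_ [s s0 ->] hs] := mr (K * C + K) a b (i \o h) KC ab (qgeo_qi C1 qh) _ _ t tab.
- by exists sa => //=; rewrite ha.
- by exists sb => //=; rewrite hb.
exists (r s); first by exists s.
by apply: le_trans (qi_lower _ _) _; rewrite ler_wpM2l ?(ltW K_gt0) // lerD2r.
Qed.

Definition fellow M L T (f g : R -> X) :=
  (forall t, 0 <= t <= L -> exists2 s, 0 <= s & d (f t) (g s) <= M) /\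
  (forall s, 0 <= s <= T -> exists2 t, 0 <= t <= L & d (f t) (g s) <= M).

(** With [M0 := N (K + 2 * D) + D] this is [M0] plus the jump [J := 2 * M0 + 2 * K + D] that occurs
    in the proof of [fellow_qi]. *)
Definition fellow_bound N D := 3 * (N (K + 2 * D) + D) + 2 * K + D.

(** The Morse property puts [i \o rho] near [beta]. Conversely, the parameters on [beta] near the
    points of [rho] at integer times go from near 0 to near [T] with bounded jumps, so they come
    near every [s]. *)
Lemma fellow_qi N D L T rho beta : morse_gauge N -> 0 <= D -> 0 <= L -> 0 <= T ->
  geodesic_on L rho -> geodesic_half beta -> morse_set N (half_image beta) ->
  d (i (rho 0)) (beta 0) <= D -> d (i (rho L)) (beta T) <= D ->
  fellow (fellow_bound N D) L T (i \o rho) beta.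
Proof.
have K1' : (1 : R) <= K := K1.
move=> gN D0 L0 T0 grho gbeta mb h0 hL.
have N0 : 0 <= N (K + 2 * D) by apply: gN; lra.
set M0 := N (K + 2 * D) + D.
have M00 : 0 <= M0 by rewrite /M0; lra.
have near t : 0 <= t <= L -> exists2 s, 0 <= s & d (i (rho t)) (beta s) <= M0.
  move=> tL; have [||_ [s s0 ->] hs] := morse_set_near gN mb K1 D0 L0 (geodesic_qgeo grho)
    _ _ h0 hL tL; last by exists s.
  - by exists 0.
  - by exists T.
split=> [t /near[s s0 hs]|s sT].
  by exists s => //; apply: le_trans hs _; rewrite /fellow_bound -/M0; lra.
have /choice[sg hsg] : forall t, exists s, 0 <= t <= L -> 0 <= s /\ d (i (rho t)) (beta s) <= M0.
  move=> t; have [/near[s' s0 hs]|_] := boolP (0 <= t <= L); first by exists s'.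
  by exists 0.
pose tm (j : nat) : R := Num.min j%:R L.
have tmL j : 0 <= tm j <= L by rewrite /tm le_min ler0n L0 ge_min lexx orbT.
pose J := 2 * M0 + 2 * K + D.
have [||||j _ hj] := @discrete_ivt R (fun j => sg (tm j)) (Num.truncn L).+1 J T s _ _ _ _ sT.
- by rewrite /J; lra.
- move=> j _; have [a0 a1] := hsg _ (tmL j); have [b0 b1] := hsg _ (tmL j.+1).
  have dt : d (rho (tm j.+1)) (rho (tm j)) <= 1.
    rewrite grho // ler_norml /tm -natr1.
    by rewrite !minEle; case: ifP => c1; case: ifP => c2; lra.
  have k1 := qi_upper (rho (tm j.+1)) (rho (tm j)).
  have e : d (beta (sg (tm j.+1))) (beta (sg (tm j))) = `|sg (tm j.+1) - sg (tm j)| by rewrite gbeta.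
  have t1 := metric_triangle (beta (sg (tm j.+1))) (i (rho (tm j.+1))) (beta (sg (tm j))).
  have t2 := metric_triangle (i (rho (tm j.+1))) (i (rho (tm j))) (beta (sg (tm j))).
  have e2 := metric_sym (beta (sg (tm j.+1))) (i (rho (tm j.+1))).
  have := ler_norm (sg (tm j.+1) - sg (tm j)); rewrite -e /J.
  have : K * d (rho (tm j.+1)) (rho (tm j)) <= K * 1 by rewrite ler_wpM2l ?(ltW K_gt0) //; lra.
  lra.
- have -> : tm 0%N = 0 by rewrite /tm min_l.
  have [|a0 a1] := hsg 0; first by rewrite lexx.
  have e : d (beta (sg 0)) (beta 0) = sg 0 by rewrite gbeta // subr0 ger0_norm.
  have t1 := metric_triangle (beta (sg 0)) (i (rho 0)) (beta 0).
  by have e2 := metric_sym (beta (sg 0)) (i (rho 0)); rewrite /J; lra.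
- have -> : tm (Num.truncn L).+1 = L by rewrite /tm min_r // ltW // truncnS_gt.
  have [|a0 a1] := hsg L; first by rewrite L0 lexx.
  have e : d (beta T) (beta (sg L)) = `|T - sg L| by rewrite gbeta.
  have t1 := metric_triangle (beta T) (i (rho L)) (beta (sg L)).
  have e2 := metric_sym (beta T) (i (rho L)).
  by have := ler_norm (T - sg L); rewrite /J; lra.
exists (tm j); first exact: tmL.
have [a0 a1] := hsg _ (tmL j).
have e : d (beta (sg (tm j))) (beta s) = `|sg (tm j) - s| by rewrite gbeta; case/andP: sT.
have t1 := metric_triangle (i (rho (tm j))) (beta (sg (tm j))) (beta s).
by rewrite /= /fellow_bound -/M0; rewrite /J in hj; lra.
Qed.

Section Limit.
Variables (p : X) (q : Y) (N : R -> R) (M : R) (r : R -> Y).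
Hypotheses (gN : morse_gauge N) (M0 : 0 <= M) (gr : geodesic_half r).

Definition approximable gamma := forall T, exists L rho beta,
  [/\ T <= L, geodesic_on L rho & rho 0 = q] /\
  [/\ geodesic_half beta, beta 0 = p & morse_set N (half_image beta)] /\
  [/\ fellow M L T (i \o rho) beta, (forall t, 0 <= t <= T -> d (rho t) (r t) <= 3) &
     forall t, 0 <= t <= T -> d (beta t) (gamma t) <= 3 :> R].

(** Endpoints move by [M + 4 * K] from [i \o r] to [beta], which enters [morse_set_near]; the last
    two terms lead back from [beta] through [rho] to [r]. Here [4 * K] is the effect of [i] on
    distances up to 3. *)
Definition limit_gauge C := N (C + 2 * (M + 4 * K)) + (M + 4 * K) + M + 4 * K.

Let qi3 x y : d x y <= 3 -> d (i x) (i y) <= 4 * K.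
Proof.
have K1' : (1 : R) <= K := K1.
move=> xy; apply: le_trans (qi_upper _ _) _.
have : K * d x y <= K * 3 by rewrite ler_wpM2l ?(ltW K_gt0) //; lra.
lra.
Qed.

Lemma limit_gaugeP : morse_gauge limit_gauge.
Proof.
have K1' : (1 : R) <= K := K1; have M0' : (0 : R) <= M := M0.
move=> C C1; have C'1 : 1 <= C + 2 * (M + 4 * K) by lra.
by have := gN C'1; rewrite /limit_gauge; lra.
Qed.

Lemma limit_morse :
  (forall T, exists L rho beta,
  [/\ T <= L, geodesic_on L rho & rho 0 = q] /\
  [/\ geodesic_half beta, beta 0 = p & morse_set N (half_image beta)] /\
  [/\ fellow M L T (i \o rho) beta & (forall t, 0 <= t <= T -> d (rho t) (r t) <= 3)]) ->
  morse_set limit_gauge (half_image (i \o r)).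
Proof.
have K1' : (1 : R) <= K := K1; have M0' : (0 : R) <= M := M0.
move=> app C a b h C1 ab qh [sa sa0 ha] [sb sb0 hb] t tab.
pose D := M + 4 * K; have D0 : 0 <= D by rewrite /D; lra.
pose N1 := N (C + 2 * D) + D.
have N10 : 0 <= N1.
  have C'1 : 1 <= C + 2 * D by lra.
  by have := gN C'1; rewrite /N1; lra.
pose Q := d p (h t).
have Q0 : 0 <= Q by exact: mdist_ge0.
(* The point of [beta] near [h t] has parameter at most [Q + N1], and [B] bounds the parameter of a
   point of [rho] near it. One approximation valid beyond these bounds is enough. *)
pose B := K * (Q + N1 + M + d p (i q) + N1 + K).
have B0 : 0 <= B by have := mdist_ge0 p (i q); rewrite /B; nra.
have [L [rho [beta [[TL grho rho0] [[gb b0 mb] [[fel1 fel2] close]]]]]] := app (sa + sb + (Q + N1) + B).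
have endpt s x : 0 <= s -> s <= sa + sb -> x = (i \o r) s ->
    exists2 y, half_image beta y & d x y <= D.
  move=> s0 sT ->; have [|s' s'0 hs'] := fel1 s; first by lra.
  exists (beta s'); first by exists s'.
  have := metric_triangle (i (r s)) (i (rho s)) (beta s').
  have c : d (rho s) (r s) <= 3 by apply: close; lra.
  have e := metric_sym (i (rho s)) (i (r s)).
  by have := qi3 c; rewrite /D /= in hs' *; lra.
have [|xa xaP hxa] := endpt sa _ sa0 _ ha; first by lra.
have [|xb xbP hxb] := endpt sb _ sb0 _ hb; first by lra.
have [_ [s s0 ->] hs] := morse_set_near gN mb C1 D0 ab qh xaP xbP hxa hxb tab.
rewrite -/N1 in hs.
have sb' : s <= Q + N1.
  have e : d p (beta s) = s by rewrite -b0 gb // sub0r normrN ger0_norm.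
  by have := metric_triangle p (h t) (beta s); rewrite /Q; lra.
have [|t' t'L ht'] := fel2 s; first by lra.
have t'B : t' <= B.
  have e : d (rho t') (rho 0) = t'.
    by rewrite grho ?subr0 ?ger0_norm //; case/andP: t'L => //; lra.
  have := qi_lower (rho t') (rho 0); rewrite e rho0 => /le_trans; apply.
  rewrite /B ler_wpM2l //; first lra.
  have t1 := metric_triangle (i (rho t')) (beta s) (i q).
  have t2 := metric_triangle (beta s) (h t) (i q).
  have t3 := metric_triangle (h t) p (i q).
  have e1 := metric_sym (beta s) (h t); have e2 := metric_sym p (h t).
  by rewrite /Q /= in ht' *; lra.
exists (i (r t')); first by exists t' => //; case/andP: t'L.
have c : d (rho t') (r t') <= 3 by apply: close; lra.
have t1 := metric_triangle (h t) (beta s) (i (r t')).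
have t2 := metric_triangle (beta s) (i (rho t')) (i (r t')).
have e1 := metric_sym (beta s) (i (rho t')).
by have := qi3 c; rewrite /limit_gauge -/D -/N1 /= in ht' *; rewrite /D; lra.
Qed.

(** The terms [4 * K], [M] and [3] lead from [r] to [rho], on to [beta] and on to [gamma]. *)
Lemma limit_close gamma : geodesic_half gamma -> gamma 0 = p -> approximable gamma ->
  (forall t, 0 <= t -> exists2 s, 0 <= s & d (i (r t)) (gamma s) <= M + 4 * K + 3) /\
  (forall s, 0 <= s -> exists2 t, 0 <= t & d (i (r t)) (gamma s) <= M + 4 * K + 3).
Proof.
have K1' : (1 : R) <= K := K1; have M0' : (0 : R) <= M := M0.
move=> gg g0 app; split=> t t0.
  pose B := K * t + K + M + d (i q) p.
  have B0 : 0 <= B by have := mdist_ge0 (i q) p; rewrite /B; nra.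
  have [L [rho [beta [[TL grho rho0] [[gb b0 mb] [[fel1 fel2] close closeb]]]]]] := app (t + B).
  have [|s s0 hs] := fel1 t; first by lra.
  have sB : s <= B.
    have e : d (beta s) p = s by rewrite -b0 gb // subr0 ger0_norm.
    have t1 := metric_triangle (beta s) (i (rho t)) p.
    have t2 := metric_triangle (i (rho t)) (i q) p.
    have e1 := metric_sym (beta s) (i (rho t)).
    have e2 : d (rho t) q = t.
      by rewrite -rho0 grho ?subr0 ?ger0_norm //; lra.
    by have := qi_upper (rho t) q; rewrite e2 /B /= in hs *; lra.
  exists s => //.
  have c : d (rho t) (r t) <= 3 by apply: close; lra.
  have c' : d (beta s) (gamma s) <= 3 by apply: closeb; lra.
  have t1 := metric_triangle (i (r t)) (i (rho t)) (gamma s).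
  have t2 := metric_triangle (i (rho t)) (beta s) (gamma s).
  have e1 := metric_sym (i (r t)) (i (rho t)).
  by have := qi3 c; rewrite /= in hs *; lra.
pose B := K * (M + t + d p (i q) + K).
have B0 : 0 <= B by have := mdist_ge0 p (i q); rewrite /B; nra.
have [L [rho [beta [[TL grho rho0] [[gb b0 mb] [[fel1 fel2] close closeb]]]]]] := app (t + B).
have [|s sL hs] := fel2 t; first by lra.
have sB : s <= B.
  have e : d (rho s) (rho 0) = s.
    by rewrite grho ?subr0 ?ger0_norm //; case/andP: sL => //; lra.
  have := qi_lower (rho s) (rho 0); rewrite e rho0 => /le_trans; apply.
  rewrite /B ler_wpM2l //; first lra.
  have e2 : d (beta t) p = t by rewrite -b0 gb // subr0 ger0_norm.
  have t1 := metric_triangle (i (rho s)) (beta t) (i q).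
  have t2 := metric_triangle (beta t) p (i q).
  by rewrite /= in hs; lra.
exists s; first by case/andP: sL.
have c : d (rho s) (r s) <= 3 by apply: close; lra.
have c' : d (beta t) (gamma t) <= 3 by apply: closeb; lra.
have t1 := metric_triangle (i (r s)) (i (rho s)) (gamma t).
have t2 := metric_triangle (i (rho s)) (beta t) (gamma t).
have e1 := metric_sym (i (r s)) (i (rho s)).
by have := qi3 c; rewrite /= in hs *; lra.
Qed.

End Limit.

End QuasiIsometry.

(** * Quasi-geodesics between two diverging Morse rays *)

Section Thin.
Variables (R : realType) (X : metricType R).
Implicit Types (f g h : R -> X) (x y z p : X) (A : set X) (N : R -> R) (C a b t : R).
Local Notation d := (@mdist R X).

Lemma qgeo_le C C' a b h : 1 <= C -> C <= C' -> qgeo C a b h -> qgeo C' a b h.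
Proof.
move=> C1 CC' qh s t sab tab; have /andP[q1 q2] := qh s t sab tab.
have n0 : 0 <= `|s - t| by exact: normr_ge0.
have CV : C'^-1 <= C^-1 by rewrite lef_pV2 ?posrE //; lra.
have : C'^-1 * `|s - t| <= C^-1 * `|s - t| by rewrite ler_wpM2r.
have : C * `|s - t| <= C' * `|s - t| by rewrite ler_wpM2r.
by move=> h1 h2; apply/andP; split; lra.
Qed.

Lemma qgeo_rev C a b h : qgeo C a b h -> qgeo C a b (fun s => h (a + b - s)).
Proof.
move=> qh s t sab tab; have -> : `|s - t| = `|a + b - s - (a + b - t)|.
  by rewrite distrC; congr `|_|; ring.
by apply: qh; lra.
Qed.

Definition concat l tau f h := fun s : R => if s <= l then f s else h (tau + (s - l)).

Definition concat_const C := C * C + 2 * C + 2.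

(* This works because f ends at a nearest point of h, up to an error 1. *)
Lemma qgeo_concat C a b h l tau f : 1 <= C -> qgeo C a b h -> a <= tau <= b -> 0 <= l ->
  geodesic_on l f -> f l = h tau -> (forall t, a <= t <= b -> l <= d (f 0) (h t) + 1) ->
  qgeo (concat_const C) 0 (l + (b - tau)) (concat l tau f h).
Proof.
move=> C1 qh taub l0 gf fl near.
set C' := concat_const C.
have CC' : C <= C' by rewrite /C' /concat_const; nra.
have C'1 : 1 <= C' by lra.
have C'0 : 0 < C' by lra.
have C'V : C'^-1 <= 1 by rewrite invf_le1.
(* If [D] is the distance of the two points, near minimality gives [l - s <= D + 1], and then
   [t - l <= C * (2 * D + 1 + C)]. These two bounds dictate [concat_const]. *)
have mixed s t : 0 <= s <= l -> l < t <= l + (b - tau) ->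
   C'^-1 * `|s - t| - C' <= d (f s) (h (tau + (t - l))) <= C' * `|s - t| + C'.
  move=> sl tl; set y := h _; rewrite ltr0_norm; last by lra.
  set D := d (f s) y; have D0 : 0 <= D by exact: mdist_ge0.
  have tb : a <= tau + (t - l) <= b by lra.
  have e1 : d (f s) (h tau) = l - s by rewrite -fl gf ?ler0_norm; lra.
  have e2 : d (f 0) (f s) = s by rewrite gf ?sub0r ?normrN ?ger0_norm //; lra.
  have h1 := near _ tb; rewrite -/y in h1.
  have t1 := metric_triangle (f 0) (f s) y; rewrite -/D in t1.
  have t2 := metric_triangle (h tau) (f s) y; rewrite -/D in t2.
  have t3 := metric_triangle (f s) (h tau) y; rewrite -/D in t3.
  have e3 := metric_sym (h tau) (f s).
  have /andP[q1 q2] := qh tau (tau + (t - l)) taub tb.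
  have e4 : `|tau - (tau + (t - l))| = t - l by rewrite ler0_norm; lra.
  rewrite e4 -/y in q1 q2.
  have q1' : t - l <= C * (d (h tau) y + C) by rewrite -ler_pdivrMl; lra.
  have q3 : C * (d (h tau) y + C) <= C * (2 * D + 1 + C) by rewrite ler_wpM2l; lra.
  apply/andP; split.
    rewrite lerBlDr ler_pdivrMl //.
    have : C' <= C' * C' by rewrite ler_peMr //; lra.
    have : (2 * C + 1) * D <= C' * D by rewrite ler_wpM2r // /C' /concat_const; nra.
    rewrite mulrDr; rewrite /C' /concat_const; nra.
  have : C * (t - l) <= C' * (t - l) by rewrite ler_wpM2r //; lra.
  have : l - s <= C' * (l - s) by rewrite ler_peMl //; lra.
  by lra.
move=> s t sI tI; rewrite /concat; case: ifP => sl; case: ifP => tl.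
- have n0 : 0 <= `|s - t| by exact: normr_ge0.
  rewrite gf; [|lra|lra].
  have : C'^-1 * `|s - t| <= 1 * `|s - t| by rewrite ler_wpM2r.
  have : 1 * `|s - t| <= C' * `|s - t| by rewrite ler_wpM2r.
  by move=> h1 h2; apply/andP; split; lra.
- by apply: mixed; lra.
- by rewrite metric_sym distrC; apply: mixed; lra.
- have -> : `|s - t| = `|tau + (s - l) - (tau + (t - l))| by congr `|_|; ring.
  by apply: (qgeo_le C1 CC' qh); lra.
Qed.

Hypothesis X_geodesic : geodesic_space X.

(** The geodesic [e] from [p] to an almost nearest point of [h], continued along either half of [h],
    is a quasi-geodesic from [p] to [f] or to [g]. If [h] stayed farther than [s0] from [p], then
    [e s0] would be within [2 * N C'] of both [f s0] and [g s0], which are farther apart than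
    that. *)
Lemma morse_rays_thin N C f g p : morse_gauge N -> 1 <= C ->
  geodesic_half f -> geodesic_half g -> f 0 = p -> g 0 = p ->
  morse_set N (half_image f) -> morse_set N (half_image g) ->
  (forall M, ~ forall s, 0 <= s -> d (f s) (g s) <= M) ->
  exists D : R, forall a b h, a <= b -> qgeo C a b h ->
    half_image f (h a) -> half_image g (h b) -> exists2 t, a <= t <= b & d p (h t) <= D.
Proof.
move=> gN C1 gf gg f0 g0 mf mg far; set C' := concat_const C.
have C'1 : 1 <= C' by rewrite /C' /concat_const; nra.
have [s0 s00 fars] : exists2 s0, 0 <= s0 & 4 * N C' < d (f s0) (g s0).
  apply: contrapT => no; apply: (far (4 * N C')) => s s0.
  by rewrite leNgt; apply/negP => lt; apply: no; exists s.
exists s0 => a b h ab qh ha hb.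
pose A := [set d p (h t) | t in [set t | a <= t <= b]].
have hA : has_inf A.
  split; first by exists (d p (h a)), a => //=; rewrite lexx.
  by exists 0 => _ [t _ <-]; exact: mdist_ge0.
have [_ [tau /= taub <-] lt] := inf_adherent (ltr01 : (0 : R) < 1) hA.
have near t : a <= t <= b -> d p (h tau) <= d p (h t) + 1.
  move=> tab; apply: le_trans (ltW lt) _; rewrite lerD2r; apply: ge_inf; first exact: hA.2.
  by exists t.
exists tau => //; rewrite leNgt; apply/negP => far0.
have [e [e0 el ge]] := X_geodesic p (h tau); set l := d p (h tau) in el ge far0.
have l0 : 0 <= l by exact: mdist_ge0.
have side F H (tau' : R) : geodesic_half F -> F 0 = p -> morse_set N (half_image F) ->
    qgeo C a b H -> a <= tau' <= b -> H tau' = h tau ->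
    (forall t, a <= t <= b -> l <= d p (H t) + 1) -> half_image F (H b) ->
    d (e s0) (F s0) <= 2 * N C'.
  move=> gF F0 mF qH taub' Htau nearH Hb.
  have lb : 0 <= l + (b - tau') by lra.
  have eH : e l = H tau' by rewrite Htau.
  have nearH' t : a <= t <= b -> l <= d (e 0) (H t) + 1 by rewrite e0; exact: nearH.
  have qk := qgeo_concat C1 qH taub' l0 ge eH nearH'.
  have [|||_ [s s_0 ->] hs] := mF _ _ _ _ C'1 lb qk _ _ s0.
  - by rewrite /concat l0 e0; exists 0.
  - rewrite /concat; case: ifP => c; last by have -> : tau' + (l + (b - tau') - l) = b by ring.
    have tb : tau' = b by lra.
    have -> : l + (b - tau') = l by lra.
    by rewrite eH tb.
  - by lra.
  rewrite /concat (ltW far0) in hs.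
  have e1 : d (e 0) (e s0) = s0 by rewrite ge ?sub0r ?normrN ?ger0_norm //; lra.
  have e2 : d (F 0) (F s) = s by rewrite gF // ?sub0r ?normrN ?ger0_norm.
  rewrite e0 in e1; rewrite F0 in e2.
  have t1 := metric_triangle p (e s0) (F s).
  have t2 := metric_triangle p (F s) (e s0); have e3 := metric_sym (F s) (e s0).
  have ds : d (F s) (F s0) <= N C' by rewrite gF // ler_norml; lra.
  by have := metric_triangle (e s0) (F s) (F s0); lra.
have sg := side g h tau gg g0 mg qh taub erefl near hb.
(* The half that ends on [f] is traversed backwards. *)
have sf : d (e s0) (f s0) <= 2 * N C'.
  apply: (side f (fun s => h (a + b - s)) (a + b - tau)) => //.
  - exact: qgeo_rev.
  - by lra.
  - by congr h; ring.
  - by move=> t tab; apply: near; lra.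
  - by have -> : a + b - b = a by ring.
have := metric_triangle (f s0) (e s0) (g s0); have := metric_sym (f s0) (e s0).
by move: fars sf sg; lra.
Qed.

End Thin.

(** * Rays as total functions and their Hausdorff distance *)

Section Rays.
Variables (R : realType) (X : metricType R).
Implicit Types (g : ray X) (f h : R -> X) (p : X) (N : R -> R).
Local Notation d := (@mdist R X).

Lemma half_lineP (t : R) : Num.max 0 t \in `[0, +oo[.
Proof. by rewrite in_itv /= andbT le_max lexx. Qed.

Definition half_line (t : R) : [set` `[(0 : R), +oo[ ] := 
  exist (fun x => x \in [set` `[(0 : R), +oo[ ]) _ (@mem_set _ [set` `[(0 : R), +oo[ ] _ (half_lineP t)).

(** Total functions allow arithmetic on parameters without membership proofs; only their values on
    nonnegative reals matter. *)
Definition of_ray g : R -> X := fun t => g (half_line t).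
Definition to_ray f : ray X := fun t => f (\val t).

Lemma val_half_line t : 0 <= t -> \val (half_line t) = t.
Proof. by move=> t0; rewrite /= max_r. Qed.

Lemma half_line_val (s : [set` `[(0 : R), +oo[ ]) : half_line (\val s) = s.
Proof. by apply: val_inj; rewrite val_half_line //; have := set_valP s; rewrite /= in_itv /= andbT. Qed.

Lemma half_line_ge0 (s : [set` `[(0 : R), +oo[ ]) : 0 <= \val s.
Proof. by have := set_valP s; rewrite /= in_itv /= andbT. Qed.

Lemma of_rayK g : to_ray (of_ray g) = g.
Proof. by apply/funext => s; rewrite /to_ray /of_ray half_line_val. Qed.

Lemma to_rayE f t : 0 <= t -> of_ray (to_ray f) t = f t.
Proof. by move=> t0; rewrite /to_ray /of_ray val_half_line. Qed.

Lemma ray_val g s : g s = of_ray g (\val s).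
Proof. by rewrite /of_ray half_line_val. Qed.

Lemma geodesic_rayP p g : geodesic_ray p g <-> of_ray g 0 = p /\ geodesic_half (of_ray g).
Proof.
split=> [[g0 gg]|[g0 gg]].
  split; first by apply: g0; rewrite val_half_line.
  by move=> s t s0 t0; rewrite /of_ray gg !val_half_line.
split=> [t t0|s t]; first by rewrite ray_val t0.
by rewrite !ray_val gg ?half_line_ge0.
Qed.

Lemma to_ray_geodesic p f : f 0 = p -> geodesic_half f -> geodesic_ray p (to_ray f).
Proof.
move=> f0 gf; apply/geodesic_rayP; split; first by rewrite to_rayE.
by move=> s t s0 t0; rewrite !to_rayE // gf.
Qed.

Lemma seg_in (a b t : R) : a <= b -> Num.min b (Num.max a t) \in `[a, b].
Proof. by move=> ab; rewrite in_itv /= le_min ab le_max lexx /= ge_min lexx. Qed.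

Lemma morse_morse_set N g : morse N g -> morse_set N (half_image (of_ray g)).
Proof.
move=> [_ _ mN] C a b h C1 ab qh [sa sa0 ha] [sb sb0 hb] t tab.
pose k : path_on X `[a, b] := fun s => h (\val s).
have in_seg (s : [set` `[a, b] ]) : a <= \val s <= b by have := set_valP s; rewrite /= in_itv.
have qk : quasi_geodesic C k by move=> s s'; apply: qh.
have tin : t \in `[a, b] by rewrite in_itv.
have [|s hs] := mN C a b k C1 ab qk _ (exist (fun x => x \in [set` `[a, b] ]) t (@mem_set _ [set` `[a, b] ] _ tin)).
  move=> s [] e; rewrite /k e; [exists (half_line sa)|exists (half_line sb)] => //.
exists (g s) => //; exists (\val s); [exact: half_line_ge0|exact: ray_val].
Qed.

Lemma morse_set_morse N f C : morse_gauge N -> 1 <= C ->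
  (forall s t, 0 <= s -> 0 <= t ->
     C^-1 * `|s - t| - C <= d (f s) (f t) <= C * `|s - t| + C) ->
  morse_set N (half_image f) -> morse N (to_ray f).
Proof.
move=> gN C1 qf mf; split=> //.
  by exists C => // s t; apply: qf; exact: half_line_ge0.
move=> D a b h D1 ab qh hab t.
pose pr (s : R) : [set` `[a, b] ] := 
    exist (fun x => x \in [set` `[a, b] ]) _ (@mem_set _ [set` `[a, b] ] _ (seg_in s ab)).
have prE s : a <= s <= b -> \val (pr s) = s.
  by move=> /andP[sa sb]; rewrite /= max_r // min_r.
have prK s : pr (\val s) = s.
  by apply: val_inj; rewrite prE //; have := set_valP s; rewrite /= in_itv.
have tab : a <= \val t <= b by have := set_valP t; rewrite /= in_itv.
have [|||_ [s s0 ->] hs] := mf D a b (fun s => h (pr s)) D1 ab _ _ _ (\val t) tab.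
- by move=> s s' sab s'ab; have := qh (pr s) (pr s'); rewrite !prE.
- have [|s hs] := hab (pr a); first by left; rewrite prE // lexx.
  by exists (\val s); [exact: half_line_ge0|].
- have [|s hs] := hab (pr b); first by right; rewrite prE // ab lexx.
  by exists (\val s); [exact: half_line_ge0|].
by exists (half_line s); rewrite /to_ray val_half_line // -[t]prK.
Qed.

Lemma to_ray_morse N f : morse_gauge N -> geodesic_half f ->
  morse_set N (half_image f) -> morse N (to_ray f).
Proof.
move=> gN gf; apply: (@morse_set_morse _ _ 1) => // s t s0 t0.
by rewrite gf // invr1 !mul1r; lra.
Qed.

Definition hausdorff_close (M : R) f h :=
  (forall t, 0 <= t -> exists2 s, 0 <= s & d (f t) (h s) <= M) /\
  (forall s, 0 <= s -> exists2 t, 0 <= t & d (f t) (h s) <= M).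

Lemma asymptoticP g g' : asymptotic g g' <-> exists M, hausdorff_close M (of_ray g) (of_ray g').
Proof.
split=> [[K [h1 h2]]|[M [h1 h2]]].
  exists K; split=> t t0.
    by have [s hs] := h1 (half_line t); exists (\val s); rewrite -?ray_val // half_line_ge0.
  by have [s hs] := h2 (half_line t); exists (\val s); rewrite -?ray_val // half_line_ge0.
exists M; split=> s.
  by have [t t0 ht] := h1 _ (half_line_ge0 s); exists (half_line t); rewrite ray_val.
by have [t t0 ht] := h2 _ (half_line_ge0 s); exists (half_line t); rewrite [g' s]ray_val.
Qed.

Lemma hausdorff_close_sym M f h : hausdorff_close M f h -> hausdorff_close M h f.
Proof.
move=> [h1 h2]; split=> s s0.
  by have [t t0 ht] := h2 s s0; exists t; rewrite // metric_sym.
by have [t t0 ht] := h1 s s0; exists t; rewrite // metric_sym.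
Qed.

Lemma hausdorff_close_trans M M' f h k :
  hausdorff_close M f h -> hausdorff_close M' h k -> hausdorff_close (M + M') f k.
Proof.
move=> [a1 a2] [b1 b2]; split=> s s0.
  have [t t0 ht] := a1 s s0; have [u u0 hu] := b1 t t0; exists u => //.
  by apply: le_trans (metric_triangle _ (h t) _) _; exact: lerD.
have [t t0 ht] := b2 s s0; have [u u0 hu] := a2 t t0; exists u => //.
by apply: le_trans (metric_triangle _ (h t) _) _; exact: lerD.
Qed.

Lemma hausdorff_close_le M M' f h : M <= M' -> hausdorff_close M f h -> hausdorff_close M' f h.
Proof.
move=> MM' [h1 h2]; split=> s s0.
  by have [t t0 ht] := h1 s s0; exists t => //; exact: le_trans MM'.
by have [t t0 ht] := h2 s s0; exists t => //; exact: le_trans MM'.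
Qed.

Lemma hausdorff_close_refl M f : 0 <= M -> hausdorff_close M f f.
Proof. by move=> M0; split=> s s0; exists s; rewrite // mdistxx. Qed.

Lemma hausdorff_close_eq M f f' h : (forall t, 0 <= t -> f t = f' t) ->
  hausdorff_close M f h -> hausdorff_close M f' h.
Proof.
move=> ff' [h1 h2]; split=> s s0.
  by have [t t0 ht] := h1 s s0; exists t; rewrite -?ff'.
by have [t t0 ht] := h2 s s0; exists t; rewrite -?ff'.
Qed.

(** The parameter is the distance to the common origin, so nearby points have nearby parameters. *)
Lemma hausdorff_close_sync M f h : geodesic_half f -> geodesic_half h -> f 0 = h 0 ->
  hausdorff_close M f h -> forall t, 0 <= t -> d (f t) (h t) <= 2 * M.
Proof.
move=> gf gh fh0 [h1 _] t t0; have [s s0 hs] := h1 t t0.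
have e1 : d (f 0) (f t) = t by rewrite gf // sub0r normrN ger0_norm.
have e2 : d (f 0) (h s) = s by rewrite fh0 gh // sub0r normrN ger0_norm.
have t1 := metric_triangle (f 0) (f t) (h s).
have t2 := metric_triangle (f 0) (h s) (f t); have e3 := metric_sym (h s) (f t).
have st : d (h s) (h t) <= M by rewrite gh // ler_norml; lra.
by have := metric_triangle (f t) (h s) (h t); lra.
Qed.

End Rays.

Section LimitRays.
Variables (R : realType) (G : groupType) (S : gen_seq G) (H : groupClosed G).
Variables (c : rel_setting R S H) (p : cayley R S) (N : R -> R) (D : R).
Hypothesis (gN : morse_gauge N).
Local Notation X := (cayley R S).
Local Notation Y := (cayley R (rs_gens c)).
Local Notation i := (rs_map c).
Local Notation q := (rs_base c).

(* The ray r is a limit of geodesics of H from q to the h n, which the Morse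
   property keeps near the beta n. *)
Lemma limit_ray : exists N1 N2 M, [/\ morse_gauge N1, morse_gauge N2 &
  forall (beta : nat -> R -> X) (T : nat -> R) (h : nat -> G),
  (forall n, [/\ geodesic_half (beta n), beta n 0 = p & morse_set N (half_image (beta n))]) ->
  (forall n, [/\ n%:R <= T n, h n \in H & mdist (beta n (T n)) (cayley_vertex R S (h n)) <= D]) ->
  exists r : R -> Y, [/\ geodesic_half r, r 0 = q, morse_set N1 (half_image (i \o r)),
    morse_set N2 (half_image r) &
    forall gamma, (forall n, beta n = gamma) -> hausdorff_close M (i \o r) gamma]].
Proof.
have [K K1' qK] := rs_qi c; have K1 : (1 : R) <= K := K1'.
(* The first term makes the bound nonnegative for every [D]; the second accounts for geodesics
   starting at [i q] and not at [p]. *)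
pose D' := `|D| + mdist (i q) p.
have D'0 : 0 <= D' by rewrite /D' addr_ge0 ?mdist_ge0.
pose M := fellow_bound K N D'.
have M0 : 0 <= M.
  have C1 : 1 <= K + 2 * D' by lra.
  by have := gN C1; rewrite /M /fellow_bound; lra.
pose N1 := limit_gauge K N M; pose N2 C := K * (N1 (K * C + K) + K).
have gN1 : morse_gauge N1 by apply: limit_gaugeP.
exists N1, N2, (M + 4 * K + 3); split=> //.
  move=> C C1; have C'1 : 1 <= K * C + K.
    have : 0 <= K * C by rewrite mulr_ge0 //; lra.
    lra.
  by have := gN1 _ C'1; rewrite /N2 => h; apply: mulr_ge0; lra.
move=> beta T h hb hT.
have Y_geo := @cayley_geodesic R _ (rs_gens c).
have /choice[rho hrho] : forall n, exists rho : R -> Y, exists L,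
    [/\ rho 0 = q, 0 <= L, geodesic_on L rho, mdist (i (rho L)) (beta n (T n)) <= D' &
       T n <= K * L + K + D'].
  move=> n; have [nT hH hD] := hT n; have [gb b0 _] := hb n.
  have [f [f0 fL gf]] := Y_geo q (cayley_vertex R (rs_gens c) (SubgroupOf hH)).
  set L := mdist q _ in fL gf.
  have ifL : i (f L) = cayley_vertex R S (h n) by rewrite fL rs_ext.
  have hD' : mdist (i (f L)) (beta n (T n)) <= `|D|.
    by rewrite ifL metric_sym; apply: le_trans hD (ler_norm D).
  have L0 : 0 <= L by exact: mdist_ge0.
  exists f, L; split=> //; first by rewrite /D'; have := mdist_ge0 (i q) p; lra.
  have T0 : 0 <= T n by apply: le_trans nT.
  have e : mdist p (beta n (T n)) = T n by rewrite -b0 gb // sub0r normrN ger0_norm.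
  have t1 := metric_triangle p (i q) (beta n (T n)).
  have t2 := metric_triangle (i q) (i (f L)) (beta n (T n)).
  have e1 := metric_sym p (i q).
  have : mdist (i q) (i (f L)) <= K * L + K.
    by have /andP[_] := qK q (f L); have -> : mdist q (f L) = L by rewrite fL.
  by rewrite /D'; lra.
have {}/choice[L hrhoL] := hrho.
(* Since [T n <= K * L n + K + D'], this index makes the geodesic at least [n] long, as
   [arzela_ascoli] requires. *)
pose phi n := (Num.truncn (K * n%:R + K + D')).+1.
have phiL n : n%:R <= L (phi n).
  have [_ _ _ _ h1] := hrhoL (phi n); have [h2 _ _] := hT (phi n).
  have h3 : K * n%:R + K + D' < (phi n)%:R by exact: truncnS_gt.
  have : K * n%:R <= K * L (phi n) by lra.
  by rewrite ler_pM2l //; lra.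
have phin n : n%:R <= T (phi n).
  have h3 : K * n%:R + K + D' < (phi n)%:R by exact: truncnS_gt.
  have [h2 _ _] := hT (phi n).
  have : 1 * n%:R <= K * n%:R :> R by rewrite ler_wpM2r.
  lra.
have [|r [r0 gr close]] := @arzela_ascoli R Y (@cayley_proper R _ (rs_gens c)) q
    (fun n => rho (phi n)) (fun n => L (phi n)).
  by move=> n; have [h1 h2 h3 _ _] := hrhoL (phi n).
have app T' : exists n, [/\ T' <= L (phi n),
    fellow M (L (phi n)) T' (i \o rho (phi n)) (beta (phi n)) &
    forall t, 0 <= t <= T' -> mdist (rho (phi n) t) (r t) <= 3].
  have [n [kn TL cl]] := close T' 3 (Num.truncn T').+1 ltac:(lra).
  exists n; split=> //.
  have [h1 h2 h3 h4 _] := hrhoL (phi n); have [gb b0 mb] := hb (phi n).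
  have T'T : T' <= T (phi n).
    apply: le_trans (phin n); apply: le_trans (ltW (truncnS_gt T')) _.
    by rewrite ler_nat.
  have T0 : 0 <= T (phi n) by apply: le_trans (phin n).
  have h5 : mdist (i (rho (phi n) 0)) (beta (phi n) 0) <= D'.
    by rewrite h1 b0 /D'; have := normr_ge0 D; lra.
  have [f1 f2] := fellow_qi K1 qK gN D'0 h2 T0 h3 gb mb h5 h4.
  split=> [t|s sT]; first exact: f1.
  by apply: f2; lra.
have mi : morse_set N1 (half_image (i \o r)).
  apply: (limit_morse K1 qK (p := p) (q := q)) => // T'.
  have [n [h1 h2 h3]] := app T'.
  exists (L (phi n)), (rho (phi n)), (beta (phi n)).
  have [e1 e2 e3 _ _] := hrhoL (phi n).
  by split=> //; split=> //; exact: hb.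
exists r; split=> //; first exact: (morse_set_pull K1 qK).
move=> gamma bg.
have [gg g0 mg] : [/\ geodesic_half gamma, gamma 0 = p & morse_set N (half_image gamma)].
  by rewrite -(bg 0%N); exact: hb.
apply: (limit_close K1 qK (p := p) (q := q) (N := N)) => // T'.
have [n [h1 h2 h3]] := app T'.
exists (L (phi n)), (rho (phi n)), (beta (phi n)).
have [e1 e2 e3 _ _] := hrhoL (phi n).
split=> //; split=> //.
by split=> // t _; rewrite bg mdistxx.
Qed.

End LimitRays.

(** * Morse rays and edges of the tree *)

Section Cosets.
Variables (R : realType) (G : groupType) (S : gen_seq G).
Local Notation vtx := (cayley_vertex R S).

(** For each of the finitely many [w] fix [k w] carrying it to [e]; then [g * (k w)^-1] fixes [e]
    and its distance to [g] depends on [w] only. The set [O] is arbitrary so as to cover vertices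
    and edges. *)
Lemma coset_near (O : choiceType) (f : G -> O -> O) (e : O) (F : seq O) (H : groupClosed G) :
  (forall w, f 1%g w = w) -> (forall g h w, f (g * h)%g w = f g (f h w)) ->
  (forall h, f h e = e -> h \in H) ->
  exists2 D : R, 0 <= D & forall g, f g^-1%g e \in F ->
    exists2 h, h \in H & mdist (vtx g) (vtx h) <= D.
Proof.
move=> f1 fM fH.
have /(seq_choice 1%g)[k hk] : forall w, w \in F -> exists k : G, (exists g, f g w = e) -> f k w = e.
  move=> w _; have [[g gw]|n] := pselect (exists g, f g w = e); first by exists g.
  by exists 1%g.
have [D D0 hD] := cayley_bounded R S F (fun w => (k w)^-1%g).
exists D => // g gF; set w := f g^-1%g e in gF.
have gw : f g w = e by rewrite /w -fM mulgV f1.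
have kw : f (k w) w = e by apply: hk => //; exists g.
exists (g * (k w)^-1)%g; last by rewrite cayley_dist1 mulKg; exact: hD.
by apply: fH; rewrite fM -{1}kw -(fM (k w)^-1%g) mulVg f1.
Qed.

End Cosets.

Lemma seq_bound (R : realType) (I : eqType) (s : seq I) (P : I -> R -> Prop) :
  (forall i, i \in s -> exists D, forall D', D <= D' -> P i D') ->
  exists D, forall i, i \in s -> P i D.
Proof.
move=> h; suff [D hD] : exists D, forall i, i \in s -> forall D', D <= D' -> P i D'.
  by exists D => i /hD; apply.
elim: s h => [_|i s IH h]; first by exists 0.
have [|D hD] := IH; first by move=> j js; apply: h; rewrite inE js orbT.
have [|D1 hD1] := h i; first by rewrite inE eqxx.
exists (Num.max D D1) => j; rewrite inE => /predU1P[->|js] D'; rewrite ge_max => /andP[? ?].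
  exact: hD1.
exact: hD.
Qed.

(* If a = b, the new endpoints need distinct parameters, hence the new interval. *)
Lemma qgeo_move_ends (R : realType) (X : metricType R) C D (a b : R) (h : R -> X) x y :
  1 <= C -> 0 <= D -> a <= b -> qgeo C a b h -> mdist (h a) x <= D -> mdist (h b) y <= D ->
  exists a' b' k, [/\ a' <= b', qgeo (C + 2 * D) a' b' k, k a' = x, k b' = y &
    forall s, a' <= s <= b' -> exists2 s', a <= s' <= b & mdist (k s) (h s') <= D].
Proof.
move=> C1 D0 ab qh hx hy.
have C'C : (C + 2 * D)^-1 <= C^-1 by rewrite lef_pV2 ?posrE; lra.
have C1V : C^-1 <= 1 by rewrite invf_le1; lra.
have [ba|ba] := eqVneq b a.
  exists a, (a + 1), (fun s => if s == a then x else y); rewrite eqxx; split=> //; first lra.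
  - have xy : mdist x y <= 2 * D.
      have := metric_triangle x (h a) y; have := metric_sym x (h a); rewrite ba in hy; lra.
    have xy0 := mdist_ge0 x y; have yx := metric_sym x y.
    move=> s t sI tI.
    have st : `|s - t| <= 1 by rewrite ler_norml; lra.
    have n0 : 0 <= `|s - t| by exact: normr_ge0.
    have : (C + 2 * D)^-1 * `|s - t| <= 1 * 1 by apply: ler_pM => //; rewrite ?invr_ge0; lra.
    have : 0 <= (C + 2 * D) * `|s - t| by apply: mulr_ge0 => //; lra.
    move=> h1 h2.
    by case: eqP => _; case: eqP => _; rewrite ?mdistxx; apply/andP; split; lra.
  - by rewrite -subr_eq0 addrAC subrr add0r oner_eq0.
  - move=> s _; exists a; first by rewrite lexx ab.
    case: eqP => _; first by rewrite metric_sym.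
    by rewrite metric_sym -{1}ba.
have ab' : a < b by rewrite lt_neqAle eq_sym ba.
pose k s := if s == a then x else if s == b then y else h s.
have kh s : mdist (k s) (h s) <= D.
  rewrite /k; case: eqP => [->|_]; first by rewrite metric_sym.
  by case: eqP => [->|_]; [rewrite metric_sym|rewrite mdistxx].
exists a, b, k; split=> //.
- move=> s s' sab s'ab; have /andP[q1 q2] := qh s s' sab s'ab.
  have n0 : 0 <= `|s - s'| by exact: normr_ge0.
  have t1 := metric_triangle (k s) (h s) (k s'); have t2 := metric_triangle (h s) (h s') (k s').
  have t3 := metric_triangle (h s) (k s) (h s'); have t4 := metric_triangle (k s) (k s') (h s').
  have e1 := metric_sym (h s) (k s); have e2 := metric_sym (h s') (k s').
  have h1 := kh s; have h2 := kh s'.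
  by apply/andP; split; nra.
- by rewrite /k eqxx.
- by rewrite /k (negPf ba) eqxx.
- by move=> s sI; exists s.
Qed.

Section Boundary.
Variables (R : realType) (X : metricType R).

Lemma boundary_pt (p : X) N f : morse_gauge N -> f 0 = p -> geodesic_half f ->
  morse_set N (half_image f) ->
  exists z : morse_boundary p, point_rays z = ray_class p (to_ray f).
Proof.
move=> gN f0 gf mf.
have zP : exists N g, [/\ geodesic_ray p g, morse N g & ray_class p (to_ray f) = ray_class p g].
  by exists N, (to_ray f); split=> //; [exact: to_ray_geodesic|exact: to_ray_morse].
by exists (MorseBoundary zP).
Qed.

Lemma ray_class_refl (p : X) f : f 0 = p -> geodesic_half f -> ray_class p (to_ray f) (to_ray f).
Proof.
move=> f0 gf; split; first exact: to_ray_geodesic.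
by apply/asymptoticP; exists 0; exact: hausdorff_close_refl.
Qed.

End Boundary.

Lemma rel_boundary_mem (R : realType) (G : groupType) (S : gen_seq G) (H : groupClosed G)
    (c : rel_setting R S H) r N (z : morse_boundary (rs_base c)) :
  morse_gauge N -> geodesic_half r -> r 0 = rs_base c ->
  morse_set N (half_image (rs_map c \o r)) -> point_rays z (to_ray r) -> rel_morse_boundary c z.
Proof.
move=> gN gr r0 mr zr; exists (to_ray r), N; split=> //.
have [K K1 qK] := rs_qi c.
apply: (@morse_set_morse _ _ N (rs_map c \o r) K) => // s t s0 t0.
by have := qK (r s) (r t); rewrite gr.
Qed.

Section Ends.
Variables (R : realType) (G : groupType) (S : gen_seq G) (T : graph) (a : action G T).
Variables (x0 : T) (p : cayley R S).
Hypotheses (T_tree : is_tree T) (a_inv : without_inversions a).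
Hypothesis E_empty : forall x y : T, adj x y ->
  exists c : rel_setting R S (edge_stab a x y), rel_morse_boundary c = set0.
Local Notation X := (cayley R S).
Local Notation vtx := (cayley_vertex R S).
Local Notation d := (@mdist R X).
Implicit Types (beta gamma : R -> X) (y z : T) (N : R -> R).

Definition morse_from N gamma :=
  [/\ geodesic_half gamma, gamma 0 = p & morse_set N (half_image gamma)].

Lemma small_step (rho : R) : exists B : seq G, forall g h, d (vtx g) (vtx h) <= rho ->
  exists2 b, b \in B & (h = g * b)%g.
Proof.
have [B hB] := cayley_ball S rho; exists B => g h.
by rewrite cayley_dist1 => /hB gh; exists (g^-1 * h)%g => //; rewrite mulVKg.
Qed.

(** Counterexamples for all [T0 = n] form a sequence of possibly different rays with one gauge.
    [limit_ray] accepts such a sequence, so [T0] can be chosen before the ray. *)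
Lemma no_crossing y z N (rho : R) : adj y z -> morse_gauge N -> exists T0 : R,
  forall gamma t g g', morse_from N gamma -> T0 <= t -> d (vtx g) (gamma t) <= rho ->
    d (vtx g') (gamma t) <= rho -> ~ separates y z (a g x0) (a g' x0).
Proof.
move=> yz gN; apply: contrapT => no.
have [B hB] := small_step (rho + rho).
have [F hF] := fin_edges a x0 T_tree B.
have [|||D D0 hD] := @coset_near R G S (T * T)%type (fun g e => (a g e.1, a g e.2)) (y, z) F
    (edge_stab a y z).
- by move=> [u v]; rewrite !act1.
- by move=> g h [u v]; rewrite !actM.
- by move=> h /= [hy hz]; apply/(edge_stabP a_inv).
have [c cE] := E_empty yz.
have [N1 [N2 [M [gN1 gN2 lim]]]] := limit_ray c p (rho + D) gN.
have /choice[bt hbt] : forall n : nat, exists bt : (R -> X) * R * G, [/\ morse_from N bt.1.1, n%:R <= bt.1.2,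
    bt.2 \in edge_stab a y z & d (bt.1.1 bt.1.2) (vtx bt.2) <= rho + D].
  move=> n; apply: contrapT => non; apply: no; exists n%:R => gamma t g g' mg nt hg hg' sep.
  have gg' : d (vtx g) (vtx g') <= rho + rho.
    apply: le_trans (metric_triangle _ (gamma t) _) _; rewrite lerD //.
    by rewrite metric_sym.
  have [b bB e] := hB _ _ gg'.
  have [|h hE hd] := hD g.
    by rewrite /=; apply: hF => //; exists b; rewrite -?e.
  apply: non; exists (gamma, t, h); split=> //=.
  apply: le_trans (metric_triangle _ (vtx g) _) _; rewrite lerD //.
  by rewrite metric_sym.
have [||r [gr r0 mir mr _]] := lim (fun n => (bt n).1.1) (fun n => (bt n).1.2) (fun n => (bt n).2).
- by move=> n; have [] := hbt n.
- by move=> n; have [] := hbt n.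
have [w wE] := boundary_pt gN2 r0 gr mr.
suff : rel_morse_boundary c w by rewrite cE.
apply: (rel_boundary_mem gN1 gr r0 mir); rewrite wE; exact: ray_class_refl.
Qed.

(** Quantifying over all scales [rho] makes the notion invariant under finite Hausdorff distance,
    see [ends_close]. *)
Definition ends gamma y z := forall rho : R, exists T0 : R, forall t g,
  0 <= t -> T0 <= t -> d (vtx g) (gamma t) <= rho -> side y z (a g x0).

Lemma ends_excl gamma y z : adj y z -> ends gamma y z -> ~ ends gamma z y.
Proof.
move=> yz /(_ 1)[T1 h1] /(_ 1)[T2 h2]; pose t := Num.max 0 (Num.max T1 T2).
have t0 : 0 <= t by rewrite le_max lexx.
have tT1 : T1 <= t by rewrite !le_max lexx orbT.
have tT2 : T2 <= t by rewrite !le_max lexx !orbT.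
have [g hg] := cayley_near (gamma t); rewrite metric_sym in hg.
exact: side_excl (h1 _ _ t0 tT1 hg) (h2 _ _ t0 tT2 hg).
Qed.

Lemma nseparates_side y z u w : adj y z -> ~ separates y z u w -> side y z u -> side y z w.
Proof. by move=> yz n zu; apply: side_step2 zu n. Qed.

(** Past [T0] the ray is followed in unit steps, none of which changes the side. The radius 5 leaves
    room for a vertex chosen near another ray: 1 for the choice and 3 from [nbhs_ray]. *)
Lemma ends_after y z N : adj y z -> morse_gauge N -> exists T0 : R,
  forall T1 gamma g, 0 <= T1 -> T0 <= T1 -> morse_from N gamma -> d (vtx g) (gamma T1) <= 5 ->
    side y z (a g x0) -> ends gamma y z.
Proof.
move=> yz gN; have [T0 hT0] := no_crossing 5 yz gN.
exists T0 => T1 gamma g T10 T01 mg hg zg rho.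
have step t t' h : T1 <= t -> T1 <= t' -> `|t - t'| <= 1 ->
    (forall g, d (vtx g) (gamma t) <= 1 -> side y z (a g x0)) ->
    d (vtx h) (gamma t') <= 1 -> side y z (a h x0).
  move=> tT1 t'T1 tt' ht hh; have [k hk] := cayley_near (gamma t); rewrite metric_sym in hk.
  have [gg _ _] := mg.
  have e : d (gamma t') (gamma t) <= 1 by rewrite metric_sym gg; lra.
  have h2 : d (vtx h) (gamma t) <= 5.
    by have := metric_triangle (vtx h) (gamma t') (gamma t); lra.
  apply: nseparates_side (ht _ hk) => //.
  by apply: (hT0 gamma t) => //; lra.
have near t : T1 <= t -> forall g, d (vtx g) (gamma t) <= 1 -> side y z (a g x0).
  move=> tT1; have nat n : forall g, d (vtx g) (gamma (T1 + n%:R)) <= 1 -> side y z (a g x0).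
    elim: n => [h|n IH h].
      rewrite addr0 => hh; apply: nseparates_side zg => //.
      by apply: (hT0 gamma T1) => //; lra.
    have n0 : 0 <= n%:R :> R by exact: ler0n.
    rewrite -natr1; apply: (step (T1 + n%:R)) => //; try lra.
    by rewrite ler_norml; lra.
  move=> h; pose n := Num.truncn (t - T1).
  have := @truncn_itv _ (t - T1); rewrite subr_ge0 => /(_ tT1) /andP[]; rewrite -/n -natr1 => n1 n2.
  have n0 : 0 <= n%:R :> R by exact: ler0n.
  apply: (step (T1 + n%:R) _ h _ _ _ (nat n)) => //; try lra.
  by rewrite ler_norml; lra.
have [T2 hT2] := no_crossing (Num.max rho 1) yz gN.
exists (Num.max T1 T2) => t h t0; rewrite ge_max => /andP[tT1 tT2] hh.
have [k hk] := cayley_near (gamma t); rewrite metric_sym in hk.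
apply: nseparates_side (near t tT1 k hk) => //.
by apply: (hT2 gamma t) => //; rewrite le_max ?hk ?hh ?orbT.
Qed.

(** The time is common to all rays of gauge [N], so the side is decided on an initial segment. This
    makes the sides open in each stratum. *)
Lemma ends_at y z N : adj y z -> morse_gauge N -> exists2 T1 : R, 0 <= T1 &
  forall gamma g, morse_from N gamma -> d (vtx g) (gamma T1) <= 5 ->
    (side y z (a g x0) <-> ends gamma y z).
Proof.
move=> yz gN; have zy : adj z y by rewrite adj_sym.
have [T1 h1] := ends_after yz gN; have [T2 h2] := ends_after zy gN.
pose T0 := Num.max 0 (Num.max T1 T2).
have T00 : 0 <= T0 by rewrite le_max lexx.
have T01 : T1 <= T0 by rewrite !le_max lexx orbT.
have T02 : T2 <= T0 by rewrite !le_max lexx !orbT.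
exists T0 => // gamma g mg hg; split=> [|eg]; first exact: h1 hg.
have [//|/(h2 T0 gamma g T00 T02 mg hg) eg'] := side_total T_tree y z (a g x0).
by case: (ends_excl yz eg eg').
Qed.

Lemma ends_total gamma y z N : adj y z -> morse_gauge N -> morse_from N gamma ->
  ends gamma y z \/ ends gamma z y.
Proof.
move=> yz gN mg; have zy : adj z y by rewrite adj_sym.
have [T1 h1] := ends_after yz gN; have [T2 h2] := ends_after zy gN.
pose T0 := Num.max 0 (Num.max T1 T2).
have T00 : 0 <= T0 by rewrite le_max lexx.
have T01 : T1 <= T0 by rewrite !le_max lexx orbT.
have T02 : T2 <= T0 by rewrite !le_max lexx !orbT.
have [g hg] := cayley_near (gamma T0); have hg' : d (vtx g) (gamma T0) <= 5.
  by rewrite metric_sym; lra.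
have [zg|yg] := side_total T_tree y z (a g x0); first by left; exact: h1 hg' zg.
by right; exact: h2 hg' yg.
Qed.

Lemma ends_close M gamma gamma' y z : geodesic_half gamma -> geodesic_half gamma' ->
  gamma 0 = gamma' 0 -> hausdorff_close M gamma gamma' -> ends gamma y z -> ends gamma' y z.
Proof.
move=> gg gg' g0 cl e rho; have sync := hausdorff_close_sync gg gg' g0 cl.
have [T0 hT0] := e (rho + 2 * M); exists T0 => t g t0 tT hg; apply: (hT0 t) => //.
have := sync t t0; have := metric_sym (gamma t) (gamma' t).
by have := metric_triangle (vtx g) (gamma' t) (gamma t); lra.
Qed.

End Ends.

(* Rounding a geodesic of H to vertices allows us to translate it by g. *)
Lemma subgroup_path (R : realType) (G : groupType) (S : gen_seq G) (H : groupClosed G)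
    (c : rel_setting R S H) : exists2 C : R, 1 <= C &
  forall g h, h \in H -> exists b (k : R -> cayley R S), [/\ 0 <= b, qgeo C 0 b k,
    mdist (cayley_vertex R S g) (k 0) <= C, mdist (cayley_vertex R S (g * h)%g) (k b) <= C &
    forall s, exists2 h', h' \in H & k s = cayley_vertex R S (g * h')%g].
Proof.
(* Rounding both points to vertices changes a distance by at most 2, and [rs_map] adds [K]. *)
have [K K1' qK] := rs_qi c; have K1 : (1 : R) <= K := K1'; exists (3 * K); first by lra.
move=> g h hH; pose Y := cayley R (rs_gens c).
have [f [f0 fL gf]] := @cayley_geodesic R _ (rs_gens c) (cayley_vertex R _ 1%g)
   (cayley_vertex R _ (SubgroupOf hH)).
set b := mdist _ _ in fL gf.
have b0 : 0 <= b by exact: mdist_ge0.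
have /choice[e he] : forall s, exists e : subgroup_of H, mdist (f s) (cayley_vertex R _ e) <= 1.
  by move=> s; exact: cayley_near.
have dist (e1 e2 : subgroup_of H) :
    mdist (cayley_vertex R S (g * \val e1)%g) (cayley_vertex R S (g * \val e2)%g) =
    mdist (rs_map c (cayley_vertex R _ e1)) (rs_map c (cayley_vertex R _ e2)).
  by rewrite !rs_ext cayley_left.
have near1 e1 e2 : mdist (cayley_vertex R (rs_gens c) e1) (cayley_vertex R (rs_gens c) e2) <= 1 ->
    mdist (cayley_vertex R S (g * \val e1)%g) (cayley_vertex R S (g * \val e2)%g) <= 3 * K.
  rewrite dist => h1; have /andP[_ h2] := qK (cayley_vertex R _ e1) (cayley_vertex R _ e2).
  have : K * mdist (cayley_vertex R (rs_gens c) e1) (cayley_vertex R (rs_gens c) e2) <= K * 1.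
    by rewrite ler_wpM2l //; lra.
  by lra.
exists b, (fun s => cayley_vertex R S (g * \val (e s))%g); split=> //.
- move=> s t sb tb; rewrite dist.
  have /andP[q1 q2] := qK (cayley_vertex R _ (e s)) (cayley_vertex R _ (e t)).
  set D := mdist (cayley_vertex R _ (e s)) _ in q1 q2; set D' := mdist _ _ in q1 q2 *.
  have st := gf s t sb tb; set n := `|s - t| in st *.
  have n0 : 0 <= n by exact: normr_ge0.
  have h1 := he s; have h2 := he t.
  have t1 := metric_triangle (f s) (cayley_vertex R _ (e s)) (f t).
  have t2 := metric_triangle (cayley_vertex R _ (e s)) (cayley_vertex R _ (e t)) (f t).
  have t3 := metric_triangle (cayley_vertex R _ (e s)) (f s) (cayley_vertex R _ (e t)).
  have t4 := metric_triangle (f s) (f t) (cayley_vertex R _ (e t)).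
  have e1 := metric_sym (f s) (cayley_vertex R _ (e s)).
  have e2 := metric_sym (f t) (cayley_vertex R _ (e t)).
  rewrite -/D in t2 t3.
  have Dn : D <= n + 2 by lra.
  have nD : n <= D + 2 by lra.
  have K0 : 0 < K by lra.
  have KV : 0 < K^-1 by rewrite invr_gt0.
  have KV1 : K^-1 <= 1 by rewrite invf_le1.
  have K3 : (3 * K)^-1 <= K^-1 by rewrite lef_pV2 ?posrE //; lra.
  have : (3 * K)^-1 * n <= K^-1 * n by rewrite ler_wpM2r.
  have : K^-1 * n <= K^-1 * (D + 2) by rewrite ler_wpM2l // ltW.
  have : K * D <= K * (n + 2) by rewrite ler_wpM2l // ltW.
  have : 0 <= K * n by rewrite mulr_ge0 // ltW.
  by move=> *; apply/andP; split; lra.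
- have := near1 1%g (e 0); rewrite /= mulg1; apply.
  by rewrite -f0.
- by apply: (near1 (SubgroupOf hH) (e b)); rewrite -fL.
- by move=> s; exists (\val (e s)) => //; exact: valP.
Qed.

(** * The vertex to which all edges point *)

Section Sink.
Variables (R : realType) (G : groupType) (S : gen_seq G) (T : graph) (a : action G T).
Variables (x0 : T) (p : cayley R S).
Hypotheses (T_tree : is_tree T) (a_inv : without_inversions a).
Hypothesis E_empty : forall x y : T, adj x y ->
  exists c : rel_setting R S (edge_stab a x y), rel_morse_boundary c = set0.
Local Notation X := (cayley R S).
Local Notation vtx := (cayley_vertex R S).
Local Notation d := (@mdist R X).
Local Notation ends := (ends a x0).
Implicit Types (beta gamma : R -> X) (y z : T) (N : R -> R).

Lemma ray_vertices gamma (g0 : G) : geodesic_half gamma -> d (gamma 0) (vtx g0) <= 1 ->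
  exists v : nat -> G, [/\ v 0%N = g0, forall n, d (gamma n%:R) (vtx (v n)) <= 1 &
    forall n, d (vtx (v n)) (vtx (v n.+1)) <= 3].
Proof.
move=> gg hg0.
have /choice[v hv] : forall n : nat, exists g, d (gamma n%:R) (vtx g) <= 1 /\ (n = 0%N -> g = g0).
  case=> [|n]; first by exists g0.
  by have [g hg] := cayley_near (gamma n.+1%:R); exists g.
exists v; split=> [|n|n]; [exact: (hv 0%N).2|exact: (hv n).1|].
have [h1 _] := hv n; have [h2 _] := hv n.+1.
have t1 := metric_triangle (vtx (v n)) (gamma n%:R) (vtx (v n.+1)).
have t2 := metric_triangle (gamma n%:R) (gamma n.+1%:R) (vtx (v n.+1)).
have e1 := metric_sym (vtx (v n)) (gamma n%:R).
have : d (gamma n%:R) (gamma n.+1%:R) <= 1.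
  by rewrite gg ?ler0n // -natr1 ler_norml; lra.
lra.
Qed.

Lemma ends_cross B gamma y z (g0 : G) : adj y z ->
  (forall g h, d (vtx g) (vtx h) <= 3 -> exists2 b, b \in B & (h = g * b)%g) ->
  geodesic_half gamma -> d (gamma 0) (vtx g0) <= 1 -> ends gamma y z -> side z y (a g0 x0) ->
  exists g t, [/\ 0 <= t, d (gamma t) (vtx g) <= 1 & crosses a x0 B y z g].
Proof.
move=> yz hB gg hg0 eg yg0; have [v [v0 hv vv]] := ray_vertices gg hg0.
apply: contrapT => no; have zy : adj z y by rewrite adj_sym.
have all n : side z y (a (v n) x0).
  elim: n => [|n IH]; first by rewrite v0.
  apply: nseparates_side IH => // sep; apply: no; exists (v n), n%:R.
  split=> //; have [b bB e] := hB _ _ (vv n); exists b => //; rewrite -e.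
  exact: separatesC.
have [T0 hT0] := eg 1; pose n := (Num.truncn T0).+1.
have : side y z (a (v n) x0).
  apply: (hT0 n%:R) => //; last by rewrite metric_sym.
  exact: ltW (truncnS_gt _).
by move=> h; exact: side_excl h (all n).
Qed.

Section TwoRays.
Variables (N : R -> R) (gamma gamma' : R -> X).
Hypotheses (gN : morse_gauge N) (mg : morse_from p N gamma) (mg' : morse_from p N gamma').
Hypothesis far : forall M, ~ forall s, 0 <= s -> d (gamma s) (gamma' s) <= M.

(* A path in the coset of the edge group joining the two crossings has to come
   near p, so that the edge is one of the finitely many crossed near p. *)
Lemma shared_crossings : exists Q : seq (T * T), forall y z (g0 : G), adj y z ->
  d p (vtx g0) <= 1 -> ends gamma y z -> ends gamma' y z -> side z y (a g0 x0) -> (y, z) \in Q.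
Proof.
have [gg g0p mm] := mg; have [gg' g0p' mm'] := mg'.
have [B hB] := small_step S (3 : R).
have [F0 hF0] := fin_edges a x0 T_tree B.
pose F := [seq f <- F0 | adj f.1 f.2].
have hF y z g : adj y z -> crosses a x0 B y z g -> (a g^-1%g y, a g^-1%g z) \in F.
  by move=> yz /hF0 h; rewrite mem_filter h // act_adj yz.
(* The bound depends on the listed translates of the edge at the two crossings, not on the edge
   itself; [seq_bound] then gives one bound for all pairs. *)
have near_p f f' : f \in F -> f' \in F -> exists D : R, forall D', D <= D' ->
  forall y z g g' t t', adj y z -> 0 <= t -> 0 <= t' ->
    d (gamma t) (vtx g) <= 1 -> d (gamma' t') (vtx g') <= 1 ->
    crosses a x0 B y z g -> (a g^-1%g y, a g^-1%g z) = f -> (a g'^-1%g y, a g'^-1%g z) = f' ->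
    exists2 g'', crosses a x0 B y z g'' & d p (vtx g'') <= D'.
  move=> fF f'F; have fadj : adj f.1 f.2 by move: fF; rewrite mem_filter => /andP[].
  have [[u [u1 u2]]|nou] := pselect (exists u, a u f'.1 = f.1 /\ a u f'.2 = f.2); last first.
    exists 0 => D' _ y z g g' t t' _ _ _ _ _ _ ef ef'; case: nou.
    by exists (g^-1 * g')%g; rewrite -ef -ef' /= !actM !actKV.
  have [c _] := E_empty fadj; have [C C1' path] := subgroup_path c.
  have C1 : (1 : R) <= C := C1'.
  pose E := C + 1 + d (vtx 1%g) (vtx u).
  have E0 : 0 <= E by rewrite /E; have := mdist_ge0 (vtx 1%g) (vtx u); lra.
  have CE : 1 <= C + 2 * E by lra.
  have [D hD] := morse_rays_thin (@cayley_geodesic R _ S) gN CE gg gg' g0p g0p' mm mm' far.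
  exists (D + E) => D' DD' y z g g' t t' yz t0 t'0 hg hg' cr ef ef'.
  (* [h] fixes the edge [f], and [g * h = g' * u^-1] is at bounded distance from [g']: the coset of
     the edge group through [g] passes near both crossings. *)
  pose h := (g^-1 * g' * u^-1)%g.
  have hfix : a h f.1 = f.1 /\ a h f.2 = f.2.
    by rewrite !actM -{1}u1 -{1}u2 !actVK -ef' -ef /= !actKV.
  have hH : h \in edge_stab a f.1 f.2 by apply/(edge_stabP a_inv).
  have [b [k [b0 qk k0 kb kH]]] := path g h hH.
  have hk0 : d (k 0) (gamma t) <= E.
    have := metric_triangle (k 0) (vtx g) (gamma t); have := metric_sym (k 0) (vtx g).
    have := metric_sym (gamma t) (vtx g); have := mdist_ge0 (vtx 1%g) (vtx u).
    by rewrite /E; lra.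
  have hkb : d (k b) (gamma' t') <= E.
    have := metric_triangle (k b) (vtx (g * h)%g) (gamma' t').
    have := metric_triangle (vtx (g * h)%g) (vtx g') (gamma' t').
    have := metric_sym (k b) (vtx (g * h)%g).
    have := metric_sym (gamma' t') (vtx g').
    have : d (vtx (g * h)%g) (vtx g') = d (vtx 1%g) (vtx u).
      rewrite cayley_dist1; congr (d _ (vtx _)).
      have -> : (g * h = g' * u^-1)%g by rewrite /h !mulgA mulgV mul1g.
      by rewrite invgM invgK mulgVK.
    by rewrite /E; lra.
  have [a' [b' [k' [ab' qk' ka' kb' kk']]]] := qgeo_move_ends C1 E0 b0 qk hk0 hkb.
  have [||s sI hs] := hD a' b' k' ab' qk'.
  - by exists t.
  - by exists t'.
  have [s' _ hs'] := kk' s sI; have [h' h'H kE] := kH s'.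
  (* It arises from [g] by left multiplication with an element that fixes [y] and [z], so the same
     edge is crossed there. *)
  exists (g * h')%g.
    have -> : (g * h' = (g * h' * g^-1) * g)%g by rewrite mulgVK.
    have [h1 h2] := (edge_stabP a_inv _ fadj).1 h'H.
    rewrite -ef /= in h1 h2.
    by apply: crosses_stab; rewrite // !actM ?h1 ?h2 actKV.
  rewrite -kE; have := metric_triangle p (k' s) (k s'); lra.
have [D hD] := @seq_bound R _ [seq (f, f') | f <- F, f' <- F]
  (fun ff D => forall y z g g' t t', adj y z -> 0 <= t -> 0 <= t' ->
    d (gamma t) (vtx g) <= 1 -> d (gamma' t') (vtx g') <= 1 ->
    crosses a x0 B y z g -> (a g^-1%g y, a g^-1%g z) = ff.1 -> (a g'^-1%g y, a g'^-1%g z) = ff.2 ->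
    exists2 g'', crosses a x0 B y z g'' & d p (vtx g'') <= D)
  (fun ff ffF => ltac:(by case/allpairsPdep: ffF => f [f' [fF f'F ->]]; exact: near_p)).
have [B' hB'] := cayley_ball S (D + d (vtx 1%g) p).
exists [seq (a g f.1, a g f.2) | g <- B', f <- F] => y z g0 yz hg0 eg eg' yg0.
have hg0g : d (gamma 0) (vtx g0) <= 1 by rewrite g0p.
have hg0g' : d (gamma' 0) (vtx g0) <= 1 by rewrite g0p'.
have [g [t [t0 hg cr]]] := ends_cross yz hB gg hg0g eg yg0.
have [g' [t' [t'0 hg' cr']]] := ends_cross yz hB gg' hg0g' eg' yg0.
pose f := (a g^-1%g y, a g^-1%g z); pose f' := (a g'^-1%g y, a g'^-1%g z).
have ffF : (f, f') \in [seq (f, f') | f <- F, f' <- F].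
  by apply/allpairsPdep; exists f, f'; split=> //; exact: hF.
have [g'' cr'' hg''] := hD (f, f') ffF y z g g' t t' yz t0 t'0 hg hg' cr erefl erefl.
apply/allpairsPdep; exists g'', (a g''^-1%g y, a g''^-1%g z); split; first 2 last.
- by rewrite /= !actKV.
- apply: hB'; have := metric_triangle (vtx 1%g) p (vtx g''); lra.
- exact: hF.
Qed.

(* We take x farthest from the base among the vertices behind an edge that both
   rays cross. *)
Lemma ends_sink : (forall y z, adj y z -> ends gamma y z -> ends gamma' y z) ->
  exists x, forall z, adj x z -> ends gamma z x.
Proof.
move=> same; have [Q hQ] := shared_crossings.
have [g0 hg0] := cayley_near p; set b := a g0 x0 in hQ *.
have [_ cn _] := T_tree; pose dist := gdist cn b.
pose good x := x = b \/ exists y, [/\ adj y x, side x y b & ends gamma y x].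
have bound x : good x -> (dist x <= \max_(w <- b :: map snd Q) dist w)%N.
  move=> gx; apply: (leq_bigmaxn_seq dist); rewrite inE; case: gx => [->|[y [yx xyb e]]].
    by rewrite eqxx.
  apply/orP; right; apply/mapP; exists (y, x) => //.
  by apply: (hQ _ _ g0) => //; exact: same.
have ex0 : exists n, `[< exists2 x, good x & dist x = n >].
  by exists (dist b); apply/asboolP; exists b => //; left.
have ubound n : `[< exists2 x, good x & dist x = n >] -> (n <= \max_(w <- b :: map snd Q) dist w)%N.
  by move=> /asboolP[x gx <-]; exact: bound.
case: (ex_maxnP ex0 ubound) => n /asboolP[x gx xn] maxn.
exists x => z xz; have zx : adj z x by rewrite adj_sym.
have [e|//] := @ends_total R G S T a x0 p T_tree a_inv E_empty gamma x z N xz gN mg.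
have [xzb|zxb] := side_total T_tree x z b.
  have [xb|[y [yx xyb ey]]] := gx.
    by case: (not_side T_tree xz); rewrite -xb in xzb.
  have xy : adj x y by rewrite adj_sym.
  have [yz|yz] := eqVneq y z; first by rewrite -yz.
  by case: (side_excl T_tree xy xyb); exact: (side_branch T_tree xy xz yz).
(* Here the edge points from [x] to [z] and away from the base, so [z] would be good and farther
   than [x]. *)
have gz : good z by right; exists x.
have := maxn (dist z); rewrite -xn => /(_ _)/wrap[]; first by apply/asboolP; exists z.
by rewrite leqNgt /dist gdist_side.
Qed.

End TwoRays.

(* Otherwise the ray would finally stay in one branch of T at x. *)
Lemma ends_visits x : exists D : R, forall gamma, geodesic_half gamma -> gamma 0 = p ->
  (forall z, adj x z -> ends gamma z x) ->
  forall n : nat, exists t h, [/\ n%:R <= t, h \in vertex_stab a x & d (gamma t) (vtx h) <= D].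
Proof.
have [B hB] := small_step S (3 : R).
have [F hF] := fin_edges a x0 T_tree B.
(* The entry [x0] covers orbit points that land on [x]; the others cover crossings of an edge at
   [x]. *)
have [|||D D0 hD] := @coset_near R G S T (fun g e => a g e) x (x0 :: map fst F) (vertex_stab a x).
- exact: act1.
- exact: actM.
- by move=> h hx; apply/vertex_stabP.
exists (1 + D) => gamma gg g0 ex n; have [k0 hk0] := cayley_near p; rewrite -g0 in hk0.
have [v [_ hv vv]] := ray_vertices gg hk0.
apply: contrapT => no.
have nZ m : (n <= m)%N -> a (v m)^-1%g x \notin x0 :: map fst F.
  move=> nm; apply/negP => /hD[h hH hd]; apply: no; exists m%:R, h; split=> //.
    by rewrite ler_nat.
  by apply: le_trans (metric_triangle _ (vtx (v m)) _) _; exact: lerD.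
have vx m : (n <= m)%N -> a (v m) x0 <> x.
  by move=> /nZ + e; rewrite -e actVK inE eqxx.
have [z xz zv] := branch_ex T_tree (vx n (leqnn n)).
have zx : adj z x by rewrite adj_sym.
have all m : side x z (a (v (n + m)%N) x0).
  elim: m => [|m IH]; first by rewrite addn0.
  apply: nseparates_side IH => //; rewrite addnS => sep.
  have [b bB e] := hB _ _ (vv (n + m)%N).
  have := nZ (n + m)%N (leq_addr _ _); rewrite inE negb_or => /andP[_ /negP]; apply.
  apply/mapP; exists (a (v (n + m)%N)^-1%g x, a (v (n + m)%N)^-1%g z) => //.
  by apply: hF => //; exists b => //; rewrite -e.
have [T0 hT0] := ex z xz 1; pose m := (Num.truncn T0).+1.
have : side z x (a (v (n + m)%N) x0).
  apply: (hT0 (n + m)%:R) => //; last by rewrite metric_sym.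
  apply: le_trans (ltW (truncnS_gt T0)) _; by rewrite ler_nat leq_addl.
by move=> h; exact: (side_excl T_tree xz (all m)).
Qed.

End Sink.

(** * The topology of the boundary *)

Section BoundaryTopology.
Variables (R : realType) (X : metricType R).
Implicit Types (N : R -> R) (f : R -> X).
Local Notation d := (@mdist R X).

Lemma boundary_openE (p : X) (U : set (morse_boundary p)) :
  open U <-> forall N, morse_gauge N -> open (@stratum_pt _ _ N p @^-1` U).
Proof.
rewrite -[open U]/(boundary_open U).
by split=> h N gN; [rewrite -stratum_openE; exact: h|rewrite stratum_openE; exact: h].
Qed.

(** Closeness at the integers up to [n] is a finite intersection of conditions on one-point compact
    sets, and geodesics that are 1-close there are 3-close in between. *)
Lemma nbhs_ray N (p : X) (g : morse_rays N p) (n : nat) :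
  nbhs g [set g' : morse_rays N p | forall t, 0 <= t <= n%:R ->
    d (of_ray (\val g') t) (of_ray (\val g) t) <= 3].
Proof.
have single (t : R) : 0 <= t -> nbhs g [set g' : morse_rays N p |
    d (of_ray (\val g) t) (of_ray (\val g') t) < 1].
  move=> t0; pose O : set {compact-open, [set` `[(0 : R), +oo[ ] -> X} :=
    [set f | f @` [set half_line t] `<=` interior (ball (of_ray (\val g) t) 1)].
  have oO : open O.
    by apply: compact_open_open; [exact: compact_set1|exact: open_interior].
  have : nbhs (\val g) O.
    apply: open_nbhs_nbhs; split=> // _ [_ -> <-].
    exact: (nbhsx_ballx _ _ ltr01).
  move=> /(@initial_continuous _ _ (@set_val _ (morse_rays N p)) g) nO.
  have {nO} : nbhs g (set_val @^-1` O) := nO.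
  apply: filterS => g' /= h.
  have : ball (of_ray (\val g) t) 1 (of_ray (\val g') t).
    by apply: interior_subset; apply: h; exists (half_line t).
  by rewrite ballEmdist.
have : nbhs g [set g' : morse_rays N p | forall j, j \in iota 0 n.+1 ->
    d (of_ray (\val g) j%:R) (of_ray (\val g') j%:R) < 1].
  elim: (iota 0 n.+1) => [|j s IH]; first by apply: filterS filterT => g' _ j.
  apply: filterS (filterI (single j%:R (ler0n _ _)) IH) => g' [/= h1 h2] k.
  by rewrite inE => /predU1P[->|/h2].
apply: filterS => g' hg' t tn.
have [[/geodesic_rayP[_ gg] _] [/geodesic_rayP[_ gg'] _]] := (set_valP g, set_valP g').
have -> : (3 : R) = 1 + 2 * 1 by ring.
apply: (net_close (ltr01 : (0 : R) < 1) (geodesic_half_on gg') (geodesic_half_on gg)) tn.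
move=> j; rewrite mulr1 ler_nat => jn; rewrite metric_sym; apply/ltW/hg'.
by rewrite mem_iota add0n ltnS.
Qed.

(** Uniform convergence on bounded intervals gives compact-open convergence;
    [compact_near_coveringP] reduces a compact set to neighbourhoods of its points. *)
Lemma compact_open_ray (rho : nat -> R -> X) (r : R -> X) : geodesic_half r ->
  (forall n t, 0 <= t <= n%:R -> d (rho n t) (r t) <= n.+1%:R^-1) ->
  forall O : set {compact-open, [set` `[(0 : R), +oo[ ] -> X}, open O -> O (to_ray r) ->
  exists n, O (to_ray (rho n)).
Proof.
move=> gr close O oO Or.
have cvg : ((fun n => to_ray (rho n) : {compact-open, [set` `[(0 : R), +oo[ ] -> X}) @ \oo)
    --> (to_ray r : {compact-open, [set` `[(0 : R), +oo[ ] -> X}).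
  apply/compact_open_cvgP => K O' cK oO' rO'.
  have nearK : forall s, K s -> \forall s' \near s & n \near \oo, O' (rho n (\val s')).
    move=> s Ks; have : O' (r (\val s)) by apply: rO'; exists s.
    move: oO'; rewrite openE => /[apply]; rewrite /interior -nbhs_ballE => -[e /= e0 be].
    have e2 : 0 < e / 2 by rewrite divr_gt0.
    have ns : nbhs s [set s' : [set` `[(0 : R), +oo[ ] | ball (\val s) (e / 2) (\val s')].
      exact: (@initial_continuous _ _ (@set_val _ [set` `[(0 : R), +oo[ ]) s _ (nbhsx_ballx (\val s) (e / 2) e2)).
    have n1 := nbhs_infty_ge (Num.truncn (\val s + e)).+1.
    have n2 := nbhs_infty_ge (Num.truncn (e / 2)^-1).+1.
    exists ([set s' | ball (\val s) (e / 2) (\val s')],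
      [set n | ((Num.truncn (\val s + e)).+1 <= n)%N /\ ((Num.truncn (e / 2)^-1).+1 <= n)%N]).
      by split=> //; exact: filterI.
    move=> [s' n] [/= bs [ns1 ns2]]; apply: be; rewrite ballEmdist /=.
    have s0 := half_line_ge0 s; have s'0 := half_line_ge0 s'.
    have {}bs : `|(\val s : R) - \val s'| < e / 2 := bs.
    have e1 : d (r (\val s)) (r (\val s')) < e / 2 by rewrite gr.
    have s'e : \val s' < \val s + e.
      have := ler_norm ((\val s' : R) - \val s); rewrite distrC; lra.
    have e3 : d (rho n (\val s')) (r (\val s')) <= n.+1%:R^-1.
      apply: close; rewrite s'0 /=; apply: le_trans (ltW s'e) _.
      by apply: le_trans (ltW (truncnS_gt _)) _; rewrite ler_nat.
    have e4 : n.+1%:R^-1 < e / 2.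
      rewrite -[ltRHS]invrK ltf_pV2 ?posrE ?invr_gt0 //.
      by apply: lt_le_trans (truncnS_gt _) _; rewrite ler_nat; exact: leq_trans (leqnSn _).
    apply: le_lt_trans (metric_triangle _ (r (\val s')) _) _.
    rewrite [ltRHS]splitr ltrD // metric_sym; exact: le_lt_trans e3 e4.
  have /compact_near_coveringP/(_ nat \oo (fun n s => O' (rho n (\val s))) _ nearK) := cK.
  apply: filterS => n h _ [s Ks <-]; exact: h.
have nO : nbhs (to_ray r : {compact-open, [set` `[(0 : R), +oo[ ] -> X}) O by exact: open_nbhs_nbhs.
have ev : \forall n \near \oo, O (to_ray (rho n)) := cvg _ nO.
by have [n On] := filter_ex ev; exists n.
Qed.

Definition represents (p : X) (w : morse_boundary p) f :=
  [/\ geodesic_half f, f 0 = p & point_rays w (to_ray f)].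

Lemma boundary_eq (p : X) (w w' : morse_boundary p) : point_rays w = point_rays w' -> w = w'.
Proof.
case: w w' => [A AP] [B BP] /= e; subst B; congr MorseBoundary; exact: Prop_irrelevance.
Qed.

Lemma represents_ex (p : X) (w : morse_boundary p) : exists N f,
  [/\ morse_gauge N, represents w f & morse_set N (half_image f)].
Proof.
have [N [g [gg mg wE]]] := point_raysP w; exists N, (of_ray g).
have [g0 gh] := (geodesic_rayP _ _).1 gg; split; [by case: mg| |exact: morse_morse_set].
split=> //; rewrite wE of_rayK; split=> //.
by apply/asymptoticP; exists 0; exact: hausdorff_close_refl.
Qed.

Lemma to_ray_close f h : asymptotic (to_ray f) (to_ray h) <-> exists M, hausdorff_close M f h.
Proof.
split=> [/asymptoticP[M h1]|[M h1]]; [|apply/asymptoticP]; exists M.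
  apply: (hausdorff_close_eq (f := of_ray (to_ray f))); first by move=> t t0; rewrite to_rayE.
  apply: hausdorff_close_sym; apply: (hausdorff_close_eq (f := of_ray (to_ray h))).
    by move=> t t0; rewrite to_rayE.
  exact: hausdorff_close_sym.
apply: (hausdorff_close_eq (f := f)); first by move=> t t0; rewrite to_rayE.
apply: hausdorff_close_sym; apply: (hausdorff_close_eq (f := h)).
  by move=> t t0; rewrite to_rayE.
exact: hausdorff_close_sym.
Qed.

Lemma represents_close (p : X) (w : morse_boundary p) f h :
  represents w f -> represents w h -> exists M, hausdorff_close M f h.
Proof.
move=> [gf f0 wf] [gh h0 wh]; have [N [g [gg mg wE]]] := point_raysP w.
move: wf wh; rewrite wE => -[_ gf'] [_ gh'].
move: gf' gh'; rewrite -{1 2}[g]of_rayK => /to_ray_close[M h1] /to_ray_close[M' h2].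
by exists (M + M'); apply: hausdorff_close_trans h2; exact: hausdorff_close_sym.
Qed.

Lemma ray_class_eq (p : X) f h M : f 0 = p -> h 0 = p -> geodesic_half f -> geodesic_half h ->
  hausdorff_close M f h -> ray_class p (to_ray f) = ray_class p (to_ray h).
Proof.
move=> f0 h0 gf gh cl; apply/seteqP; split=> k [gk]; rewrite -{1}[k]of_rayK => /to_ray_close[M' h1];
  split=> //; rewrite -[k]of_rayK; apply/to_ray_close; exists (M + M').
  by apply: hausdorff_close_trans h1; exact: hausdorff_close_sym.
exact: hausdorff_close_trans h1.
Qed.

Lemma represents_class (p : X) (w : morse_boundary p) f :
  represents w f -> point_rays w = ray_class p (to_ray f).
Proof.
move=> wf; have [gf f0 wf'] := wf; have [N [g [gg mg wE]]] := point_raysP w.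
have [g0 gh] := (geodesic_rayP _ _).1 gg.
move: wf'; rewrite wE -{1}[g]of_rayK => -[_ /to_ray_close[M h1]].
by rewrite -[g in LHS]of_rayK; exact: ray_class_eq h1.
Qed.

Lemma represents_inj (p : X) (w w' : morse_boundary p) f h M :
  represents w f -> represents w' h -> hausdorff_close M f h -> w = w'.
Proof.
move=> wf wh cl; apply: boundary_eq; rewrite (represents_class wf) (represents_class wh).
by have [gf f0 _] := wf; have [gh h0 _] := wh; exact: ray_class_eq cl.
Qed.

Lemma stratum_pt_represents N (p : X) (g : morse_rays N p) :
  represents (stratum_pt g) (of_ray (\val g)).
Proof.
have [gg mg] := set_valP g; have [g0 gh] := (geodesic_rayP _ _).1 gg.
split=> //; rewrite of_rayK; split=> //; apply/asymptoticP.
by exists 0; exact: hausdorff_close_refl.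
Qed.

End BoundaryTopology.

Section BoundarySides.
Variables (R : realType) (G : groupType) (S : gen_seq G) (T : graph) (a : action G T).
Variables (x0 : T) (p : cayley R S).
Hypotheses (T_tree : is_tree T) (a_inv : without_inversions a).
Hypothesis E_empty : forall x y : T, adj x y ->
  exists c : rel_setting R S (edge_stab a x y), rel_morse_boundary c = set0.
Local Notation X := (cayley R S).
Local Notation vtx := (cayley_vertex R S).
Local Notation d := (@mdist R X).
Local Notation ends := (ends a x0).

Definition boundary_side (y z : T) : set (morse_boundary p) :=
  [set w | exists2 gamma, represents w gamma & ends gamma y z].

Lemma boundary_side_ends y z w gamma :
  represents w gamma -> boundary_side y z w <-> ends gamma y z.
Proof.
move=> wg; split=> [[gamma' wg' e]|e]; last by exists gamma.
have [M cl] := represents_close wg' wg; have [gg' g0' _] := wg'; have [gg g0 _] := wg.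
by apply: (ends_close gg' gg _ cl e); rewrite g0 g0'.
Qed.

Lemma boundary_side_total y z w : adj y z -> boundary_side y z w \/ boundary_side z y w.
Proof.
move=> yz; have [N [gamma [gN wg mg]]] := represents_ex w.
have mf : morse_from p N gamma by have [gg g0 _] := wg.
have [e|e] := @ends_total R G S T a x0 p T_tree a_inv E_empty gamma y z N yz gN mf.
  by left; exists gamma.
by right; exists gamma.
Qed.

Lemma boundary_side_excl y z w : adj y z -> boundary_side y z w -> ~ boundary_side z y w.
Proof.
move=> yz [gamma wg e] /(boundary_side_ends _ _ wg) e'.
exact: (ends_excl T_tree yz e e').
Qed.

Lemma boundary_sideC y z : adj y z -> ~` boundary_side y z = boundary_side z y.
Proof.
move=> yz; have zy : adj z y by rewrite adj_sym.
apply/seteqP; split=> w; last exact: boundary_side_excl.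
by have [|//] := boundary_side_total w yz.
Qed.

Lemma stratum_morse_from N (g : morse_rays N p) : morse_from p N (of_ray (\val g)).
Proof.
have [gg mg] := set_valP g; have [g0 gh] := (geodesic_rayP _ _).1 gg.
by split=> //; exact: morse_morse_set.
Qed.

(** At the time given by [ends_at], nearby rays of the same gauge pass near the same vertex [k],
    which decides the side for all of them. *)
Lemma open_boundary_side y z : adj y z -> open (boundary_side y z).
Proof.
move=> yz; apply/boundary_openE => N gN; rewrite openE => g /= Ug.
have eg := (boundary_side_ends _ _ (stratum_pt_represents g)).1 Ug.
have mg := stratum_morse_from g.
have [T1 T10 hT] := @ends_at R G S T a x0 p T_tree a_inv E_empty y z N yz gN.
have := nbhs_ray g (Num.truncn T1).+1; apply: filterS => g' /= close.
apply/(boundary_side_ends _ _ (stratum_pt_represents g')).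
have [k hk] := cayley_near (of_ray (\val g) T1); rewrite metric_sym in hk.
have c : d (of_ray (\val g') T1) (of_ray (\val g) T1) <= 3.
  by apply: close; rewrite T10 /=; exact: ltW (truncnS_gt _).
have hk' : d (vtx k) (of_ray (\val g') T1) <= 5.
  have := metric_triangle (vtx k) (of_ray (\val g) T1) (of_ray (\val g') T1).
  by have := metric_sym (of_ray (\val g) T1) (of_ray (\val g') T1); lra.
apply/(hT _ _ (stratum_morse_from g') hk').
have hk5 : d (vtx k) (of_ray (\val g) T1) <= 5 by lra.
exact/(hT _ _ mg hk5).
Qed.

Lemma connected_boundary_side (C : set (morse_boundary p)) y z w w' : adj y z ->
  connected C -> C w -> C w' -> boundary_side y z w -> boundary_side y z w'.
Proof.
move=> yz cC Cw Cw' Uw; have zy : adj z y by rewrite adj_sym.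
have eC : C `&` boundary_side y z = C.
  apply: cC; first by exists w.
    by exists (boundary_side y z) => //; exact: open_boundary_side.
  exists (boundary_side y z) => //.
  by rewrite -(boundary_sideC zy) closedC; exact: open_boundary_side.
by have [] : (C `&` boundary_side y z) w' by rewrite eC.
Qed.

End BoundarySides.

(** * Rays of a subgroup that follow rays of the group *)

Section Shadows.
Variables (R : realType) (G : groupType) (S : gen_seq G) (H : groupClosed G).
Variables (c : rel_setting R S H) (p : cayley R S).
Local Notation X := (cayley R S).
Local Notation Y := (cayley R (rs_gens c)).
Local Notation i := (rs_map c).
Local Notation q := (rs_base c).
Implicit Types (r : R -> Y) (gamma : R -> X).

Lemma shadow_unique M M' M'' r r' gamma gamma' :
  hausdorff_close M (i \o r) gamma -> hausdorff_close M' (i \o r') gamma' ->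
  hausdorff_close M'' gamma gamma' -> exists M0, hausdorff_close M0 r r'.
Proof.
move=> h1 h2 h3; have [K K1 qK] := rs_qi c; have K1' : (1 : R) <= K := K1.
have [a1 a2] := hausdorff_close_trans (hausdorff_close_trans h1 h3) (hausdorff_close_sym h2).
have low x y D : mdist (i x) (i y) <= D -> mdist x y <= K * (D + K).
  by move=> xy; apply: le_trans (qi_lower K1 qK x y) _; rewrite ler_wpM2l ?lerD2r //; lra.
exists (K * (M + M'' + M' + K)); split=> s s0.
  by have [t t0 ht] := a1 s s0; exists t => //; exact: low.
by have [t t0 ht] := a2 s s0; exists t => //; exact: low.
Qed.

Lemma shadow_inj M M' M'' r r' gamma gamma' :
  hausdorff_close M (i \o r) gamma -> hausdorff_close M' (i \o r') gamma' ->
  hausdorff_close M'' r r' -> exists M0, hausdorff_close M0 gamma gamma'.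
Proof.
move=> h1 h2 [h3 h4]; have [K K1 qK] := rs_qi c; have K1' : (1 : R) <= K := K1.
have up x y : mdist x y <= M'' -> mdist (i x) (i y) <= K * M'' + K.
  move=> xy; apply: le_trans (qi_upper qK x y) _.
  by rewrite lerD2r ler_wpM2l //; lra.
have h5 : hausdorff_close (K * M'' + K) (i \o r) (i \o r').
  split=> s s0; first by have [t t0 ht] := h3 s s0; exists t => //; exact: up.
  by have [t t0 ht] := h4 s s0; exists t => //; exact: up.
exists (M + (K * M'' + K) + M').
exact: hausdorff_close_trans (hausdorff_close_trans (hausdorff_close_sym h1) h5) h2.
Qed.

(** The [beta n] need only stay within 3 of [gamma], which is what [nbhs_ray] provides, whereas the
    rays of [H] subconverge to [rho], which is what [compact_open_ray] consumes. *)
Lemma shadow_limit N M : morse_gauge N -> exists N1 N2, [/\ morse_gauge N1, morse_gauge N2 &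
  forall (r : nat -> R -> Y) (beta : nat -> R -> X) gamma,
  (forall n, morse_from p N (beta n)) ->
  (forall n, [/\ geodesic_half (r n), r n 0 = q & hausdorff_close M (i \o r n) (beta n)]) ->
  geodesic_half gamma -> gamma 0 = p ->
  (forall n t, 0 <= t <= n%:R -> mdist (beta n t) (gamma t) <= 3) ->
  exists rho, [/\ geodesic_half rho, rho 0 = q, morse_set N1 (half_image (i \o rho)) &
    [/\ morse_set N2 (half_image rho), (exists M', hausdorff_close M' (i \o rho) gamma) &
    exists phi : nat -> nat, forall n t, 0 <= t <= n%:R -> mdist (r (phi n) t) (rho t) <= n.+1%:R^-1]]].
Proof.
move=> gN; have [K K1' qK] := rs_qi c; have K1 : (1 : R) <= K := K1'.
pose M1 := `|M|; have M10 : 0 <= M1 by exact: normr_ge0.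
pose N1 := limit_gauge K N M1; pose N2 C := K * (N1 (K * C + K) + K).
have gN1 : morse_gauge N1 by apply: limit_gaugeP.
exists N1, N2; split=> //.
  move=> C C1; have C'1 : 1 <= K * C + K.
    have : 0 <= K * C by rewrite mulr_ge0 //; lra.
    lra.
  by have := gN1 _ C'1; rewrite /N2 => h; apply: mulr_ge0; lra.
move=> r beta gamma hb hr gg g0 bg.
have [|rho [rho0 grho close]] := @arzela_ascoli R Y (@cayley_proper R _ (rs_gens c)) q r (fun n => n%:R).
  by move=> n; have [gr r0 _] := hr n; split=> //; exact: geodesic_half_on.
have /choice[phi hphi] : forall n, exists m, (n <= m)%N /\
    forall t, 0 <= t <= n%:R -> mdist (r m t) (rho t) <= n.+1%:R^-1.
  move=> n; have [|m [nm _ cl]] := close n%:R n.+1%:R^-1 n; first by rewrite invr_gt0.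
  by exists m.
have app : approximable i p q N M1 rho gamma.
  move=> T; pose n := (Num.truncn T).+1; have [nphi cl] := hphi n.
  have Tn : T <= n%:R by exact: ltW (truncnS_gt _).
  have [gr r0 hc] := hr (phi n); have [gb b0 mb] := hb (phi n).
  have [c1 c2] := hausdorff_close_le (ler_norm M) hc; rewrite -/M1 in c1 c2.
  (* The second term bounds the parameters at which [r (phi n)] comes near the part of
     [beta (phi n)] over [[0, T]]. *)
  pose L := Num.max T (K * (M1 + T + mdist p (i q) + K)).
  exists L, (r (phi n)), (beta (phi n)); split; [split|split; [split|split]] => //.
  - by rewrite le_max lexx.
  - exact: geodesic_half_on.
  - split=> [t /andP[t0 _]|s /andP[s0 sT]]; first exact: c1.
    have [t t0 ht] := c2 s s0; exists t => //; rewrite t0 /= le_max; apply/orP; right.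
    have e : mdist (r (phi n) t) (r (phi n) 0) = t by rewrite gr ?subr0 ?ger0_norm.
    have := qi_lower K1 qK (r (phi n) t) (r (phi n) 0); rewrite e r0 => /le_trans; apply.
    rewrite ler_wpM2l //; first lra.
    have e2 : mdist (beta (phi n) s) p = s by rewrite -b0 gb // subr0 ger0_norm.
    have t1 := metric_triangle (i (r (phi n) t)) (beta (phi n) s) (i q).
    have t2 := metric_triangle (beta (phi n) s) p (i q).
    by rewrite /= in ht; lra.
  - move=> t /andP[t0 tT]; have n1 : n.+1%:R^-1 <= 1 :> R by rewrite invf_le1 // ler1n.
    by apply: le_trans (cl t _) _; [rewrite t0 (le_trans tT)|apply: le_trans n1 _; rewrite ler1n].
  - move=> t /andP[t0 tT]; apply: bg; rewrite t0 (le_trans tT) // (le_trans Tn) //.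
    by rewrite ler_nat.
have mi : morse_set N1 (half_image (i \o rho)).
  apply: (limit_morse K1 qK (p := p) (q := q)) => // T.
  have [L [r' [b [h1 [h2 [h3 h4 _]]]]]] := app T.
  by exists L, r', b.
exists rho; split=> //; split; first exact: (morse_set_pull K1 qK).
  by exists (M1 + 4 * K + 3); apply: (limit_close K1 qK (p := p) (q := q) (N := N)).
by exists phi => n; exact: (hphi n).2.
Qed.

(** The map to the boundary of the subgroup, as a relation: [shadows_fun] and [shadows_inj] make it
    a partial injection without a choice of rays. *)
Definition shadows (w : morse_boundary p) (v : morse_boundary q) := rel_morse_boundary c v /\
  exists gamma r M, [/\ represents w gamma, represents v r & hausdorff_close M (i \o r) gamma].

Lemma shadows_fun w v v' : shadows w v -> shadows w v' -> v = v'.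
Proof.
move=> [_ [g [r [M [wg vr h]]]]] [_ [g' [r' [M' [wg' vr' h']]]]].
have [M'' h''] := represents_close wg wg'; have [M0 h0] := shadow_unique h h' h''.
exact: represents_inj h0.
Qed.

Lemma shadows_inj w w' v : shadows w v -> shadows w' v -> w = w'.
Proof.
move=> [_ [g [r [M [wg vr h]]]]] [_ [g' [r' [M' [wg' vr' h']]]]].
have [M'' h''] := represents_close vr vr'; have [M0 h0] := shadow_inj h h' h''.
exact: represents_inj h0.
Qed.

End Shadows.

Section VertexBoundary.
Variables (R : realType) (G : groupType) (S : gen_seq G) (T : graph) (a : action G T).
Variables (x0 : T) (p : cayley R S).
Hypotheses (T_tree : is_tree T) (a_inv : without_inversions a).
Hypothesis E_empty : forall x y : T, adj x y ->
  exists c : rel_setting R S (edge_stab a x y), rel_morse_boundary c = set0.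
Variables (x : T) (c : rel_setting R S (vertex_stab a x)).
Local Notation X := (cayley R S).
Local Notation Y := (cayley R (rs_gens c)).
Local Notation i := (rs_map c).
Local Notation q := (rs_base c).

Definition boundary_at : set (morse_boundary p) :=
  [set w | forall z, adj x z -> boundary_side a x0 z x w].

(** The visits from [ends_visits] feed [limit_ray] with a constant sequence of rays. That [N1], [N2]
    and [M] depend on [N] only is essential for [closed_shadows]. *)
Lemma shadow_ex N : morse_gauge N -> exists N1 N2 M, [/\ morse_gauge N1, morse_gauge N2 &
  forall w gamma, represents w gamma -> morse_set N (half_image gamma) -> boundary_at w ->
  exists r, [/\ geodesic_half r, r 0 = q, morse_set N1 (half_image (i \o r)),
    morse_set N2 (half_image r) & hausdorff_close M (i \o r) gamma]].
Proof.
move=> gN; have [D hD] := @ends_visits R G S T a x0 p T_tree x.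
have [N1 [N2 [M [gN1 gN2 lim]]]] := limit_ray c p D gN.
exists N1, N2, M; split=> // w gamma wg mg Pw.
have [gg g0 _] := wg.
have /choice[th hth] : forall n : nat, exists th : R * G,
    [/\ n%:R <= th.1, th.2 \in vertex_stab a x & mdist (gamma th.1) (cayley_vertex R S th.2) <= D].
  move=> n; have [|t [h ht]] := hD gamma gg g0 _ n; last by exists (t, h).
  by move=> z xz; apply/(@boundary_side_ends R G S T a x0 p z x w gamma wg); exact: Pw.
have [||r [gr r0 mi mr cl]] := lim (fun=> gamma) (fun n => (th n).1) (fun n => (th n).2) => //.
by exists r; split=> //; exact: cl.
Qed.

Lemma shadows_ex w : boundary_at w -> exists v, shadows (c := c) w v.
Proof.
move=> Pw; have [N [gamma [gN wg mg]]] := represents_ex w.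
have [N1 [N2 [M [gN1 gN2 h]]]] := shadow_ex gN.
have [r [gr r0 mi mr cl]] := h _ _ wg mg Pw.
have [v vE] := boundary_pt gN2 r0 gr mr; exists v.
have vr : point_rays v (to_ray r) by rewrite vE; exact: ray_class_refl.
split; first exact: (rel_boundary_mem gN1 gr r0 mi vr).
by exists gamma, r, M.
Qed.

(** A point outside the set either is cut off from [x] by an edge, an open condition, or has its
    shadow outside [F]. In the second case, points of the set approaching it in one stratum would
    have shadows in a single stratum subconverging to its shadow, against closedness of [F]. *)
Lemma closed_shadows (F : set (morse_boundary q)) : closed F ->
  closed [set w | boundary_at w /\ exists2 v, F v & shadows (c := c) w v].
Proof.
move=> cF; rewrite -openC; apply/boundary_openE => N gN; rewrite openE => g /= nAg.
have [Pg|nPg] := pselect (boundary_at (stratum_pt g)); last first.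
  have [z [xz nz]] : exists z, adj x z /\ ~ boundary_side a x0 z x (stratum_pt g).
    by apply: contrapT => no; apply: nPg => z xz; apply: contrapT => nz; apply: no; exists z.
  have zx : adj z x by rewrite adj_sym.
  have := open_boundary_side x0 p T_tree a_inv E_empty xz.
  move=> /boundary_openE/(_ N gN); rewrite openE => /(_ g) nb.
  have nb' : boundary_side a x0 x z (stratum_pt g).
    by have := @boundary_sideC R G S T a x0 p T_tree a_inv E_empty z x zx => <-.
  have := nb nb'; apply: filterS => g' /= h [P _].
  by have := boundary_side_excl T_tree xz h; apply; exact: P.
apply: contrapT => nnb.
have /choice[gn hgn] : forall n : nat, exists g' : morse_rays N p,
    (forall t, 0 <= t <= n%:R -> mdist (of_ray (\val g') t) (of_ray (\val g) t) <= 3) /\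
    boundary_at (stratum_pt g') /\ exists2 v, F v & shadows (c := c) (stratum_pt g') v.
  move=> n; apply: contrapT => no; apply: nnb; have := nbhs_ray g n.
  by apply: filterS => g' h1 h2; apply: no; exists g'.
have [N1 [N2 [M [gN1 gN2 sh]]]] := shadow_ex gN.
have /choice[r hr] : forall n : nat, exists r, [/\ geodesic_half r, r 0 = q,
    morse_set N1 (half_image (i \o r)), morse_set N2 (half_image r) &
    hausdorff_close M (i \o r) (of_ray (\val (gn n)))].
  move=> n; have [_ [P _]] := hgn n; have [_ _ m] := stratum_morse_from (gn n).
  exact: sh (stratum_pt_represents (gn n)) m P.
have [N3 [N4 [gN3 gN4 lim]]] := shadow_limit c p M gN.
have [gg g0 _] := stratum_pt_represents g.
have [|||||rho [grho rho0 mi [mrho [M' cl] [phi close]]]] :=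
    lim r (fun n => of_ray (\val (gn n))) (of_ray (\val g)).
- by move=> n; exact: stratum_morse_from.
- by move=> n; have [? ? _ _ ?] := hr n.
- exact: gg.
- exact: g0.
- by move=> n; exact: (hgn n).1.
have [v vE] := boundary_pt gN4 rho0 grho mrho.
have vrho : represents v rho by split=> //; rewrite vE; exact: ray_class_refl.
apply: nAg; split=> //; exists v; last first.
  split; first by apply: (rel_boundary_mem gN3 grho rho0 mi); case: vrho.
  by exists (of_ray (\val g)), rho, M'; split=> //; exact: stratum_pt_represents.
apply: contrapT => nFv.
(* [N2] is a gauge for the approximating shadows and [N4] for their limit; the sum puts all of them
   into one stratum. *)
pose N5 C := N2 C + N4 C.
have gN5 : morse_gauge N5 by move=> C C1; rewrite addr_ge0 ?gN2 ?gN4.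
have in5 f : geodesic_half f -> f 0 = q -> morse_set N5 (half_image f) -> morse_rays N5 q (to_ray f).
  by move=> gf f0 mf; split; [exact: to_ray_geodesic|exact: to_ray_morse].
have rho5 : morse_set N5 (half_image rho).
  by apply: morse_set_le mrho => C C1; rewrite lerDr gN2.
have r5 n : morse_set N5 (half_image (r n)).
  by have [_ _ _ m _] := hr n; apply: morse_set_le m => C C1; rewrite lerDl gN4.
have : open (~` F) by rewrite openC.
move=> /boundary_openE/(_ N5 gN5) [O oO OE].
pose pt f (h : morse_rays N5 q (to_ray f)) : morse_rays N5 q :=
  exist (fun g' => g' \in morse_rays N5 q) _ (mem_set h).
have Opt f h : O (to_ray f) <-> ~ F (stratum_pt (@pt f h)).
  have : (set_val @^-1` O) (pt f h) <-> (@stratum_pt _ _ N5 q @^-1` ~` F) (pt f h) by rewrite OE.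
  by [].
have ptE f (h : morse_rays N5 q (to_ray f)) v' : represents v' f -> stratum_pt (pt f h) = v'.
  move=> v'f; apply: (@represents_inj _ _ _ _ _ (of_ray (to_ray f)) f 0) => //.
    exact: (stratum_pt_represents (pt f h)).
  apply: (hausdorff_close_eq (f := f)); first by move=> t t0; rewrite to_rayE.
  exact: hausdorff_close_refl.
have hrho5 := in5 _ grho rho0 rho5.
have Orho : O (to_ray rho) by apply/(Opt _ hrho5); rewrite (ptE _ _ _ vrho).
have [n On] := compact_open_ray (rho := r \o phi) grho close oO Orho.
have [gr r0 mir mr clr] := hr (phi n).
have hr5 := in5 _ gr r0 (r5 (phi n)).
move/(Opt _ hr5) : On; apply.
have [_ [_ [v' Fv' sv']]] := hgn (phi n).
have [v'' v''E] := boundary_pt gN2 r0 gr mr.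
have v''r : represents v'' (r (phi n)) by split=> //; rewrite v''E; exact: ray_class_refl.
rewrite (ptE _ _ _ v''r).
suff -> : v'' = v' by [].
apply: (shadows_fun _ sv'); split.
  by apply: (rel_boundary_mem gN1 gr r0 mir); case: v''r.
exists (of_ray (\val (gn (phi n)))), (r (phi n)), M; split=> //.
exact: stratum_pt_represents.
Qed.

(** A clopen part of the image pulls back to a clopen part of [C]. For openness, [closed_shadows] is
    applied to the complement of [O]. *)
Lemma connected_shadows (C : set (morse_boundary p)) : C `<=` boundary_at -> connected C ->
  connected [set v | exists2 w, C w & shadows (c := c) w v].
Proof.
move=> CP cC B [v0 Bv0] [O oO BO] [F cF BF].
set B1 := [set v | _] in BO BF *.
have inB v : B v -> B1 v by rewrite BO => -[].
have BOE v : B1 v -> B v <-> O v by move=> h; rewrite BO; split=> [[]|].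
have BFE v : B1 v -> B v <-> F v by move=> h; rewrite BF; split=> [[]|].
pose C' := [set w | C w /\ exists2 v, B v & shadows (c := c) w v].
suff eC : C' = C.
  apply/seteqP; split=> // v [w Cw sw].
  have [_ [v' Bv' sw']] : C' w by rewrite eC.
  by rewrite (shadows_fun sw sw').
apply: cC.
- by have [w Cw sw] := inB _ Bv0; exists w; split=> //; exists v0.
- exists (~` [set w | boundary_at w /\ exists2 v, (~` O) v & shadows (c := c) w v]).
    by rewrite openC; apply: closed_shadows; rewrite closedC.
  apply/seteqP; split=> w.
    move=> [Cw [v Bv sv]]; split=> // -[_ [v' nO sv']]; apply: nO.
    by rewrite -(shadows_fun sv sv'); apply/(BOE v) => //; exact: inB.
  move=> [Cw nA]; split=> //; have [v sv] := shadows_ex (CP w Cw); exists v => //.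
  apply/(BOE v); first by exists w.
  by apply: contrapT => nO; apply: nA; split; [exact: CP|exists v].
- exists [set w | boundary_at w /\ exists2 v, F v & shadows (c := c) w v].
    exact: closed_shadows.
  apply/seteqP; split=> w.
    move=> [Cw [v Bv sv]]; split=> //; split; first exact: CP.
    by exists v => //; apply/(BFE v) => //; exact: inB.
  move=> [Cw [_ [v Fv sv]]]; split=> //; exists v => //.
  by apply/(BFE v) => //; exists w.
Qed.

End VertexBoundary.

Theorem corollary2 (R : realType) (G : groupType) (S : gen_seq G)
    (T : graph) (a : action G T)
    (T_tree : is_tree T)
    (a_inv : without_inversions a)
    (a_fix : no_global_fixed_point a R)
    (E_fg : forall x y : T, adj x y ->
       finitely_generated (subgroup_of (edge_stab a x y)))
    (E_undistorted : forall x y : T, adj x y ->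
       undistorted R S (edge_stab a x y))
    (E_empty : forall x y : T, adj x y ->
       exists c : rel_setting R S (edge_stab a x y),
         rel_morse_boundary c = set0)
    (V_td : forall x : T, undistorted R S (vertex_stab a x) ->
       exists c : rel_setting R S (vertex_stab a x),
         totally_disconnected (rel_morse_boundary c))
    (p : cayley R S) :
  totally_disconnected [set: morse_boundary p].
Proof.
have [[x0] _ _] := T_tree.
move=> w _; apply/seteqP; split=> [w' [C [Cw _ cC] Cw']|_ ->]; last first.
  by exists [set w]; [split=> //; exact: connected1|].
apply: contrapT => ww' /=.
have [N [gamma [gN wg mg]]] := represents_ex w.
have [N' [gamma' [gN' wg' mg']]] := represents_ex w'.
(* A common gauge for the two rays. *)
pose N0 C := N C + N' C.
have gN0 : morse_gauge N0 by move=> D D1; rewrite addr_ge0 ?gN ?gN'.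
have [gg g0 _] := wg; have [gg' g0' _] := wg'.
have m0 : morse_from p N0 gamma.
  by split=> //; apply: morse_set_le mg => D D1; rewrite lerDl gN'.
have m0' : morse_from p N0 gamma'.
  by split=> //; apply: morse_set_le mg' => D D1; rewrite lerDr gN.
have far M : ~ forall s, 0 <= s -> mdist (gamma s) (gamma' s) <= M.
  move=> h; apply: ww'; apply: (represents_inj (M := M) wg' wg).
  apply: hausdorff_close_sym; split=> s s0; exists s => //; exact: h.
have same (u u' : morse_boundary p) y z : C u -> C u' -> adj y z ->
    boundary_side a x0 y z u -> boundary_side a x0 y z u'.
  by move=> Cu Cu' yz; exact: (connected_boundary_side T_tree a_inv E_empty yz cC Cu Cu').
have [|x hx] := ends_sink T_tree a_inv E_empty gN0 m0 m0' far (x0 := x0).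
  move=> y z yz e; apply/(@boundary_side_ends R G S T a x0 p y z w' gamma' wg').
  by apply: (same w) => //; apply/(@boundary_side_ends R G S T a x0 p y z w gamma wg).
have [c td] := V_td x (vertex_stab_undistorted x T_tree a_inv E_undistorted).
have CP : C `<=` boundary_at a x0 x.
  move=> u Cu z xz; apply: (same w) => //; first by rewrite adj_sym.
  by apply/(@boundary_side_ends R G S T a x0 p z x w gamma wg); exact: hx.
have cB := connected_shadows T_tree a_inv E_empty CP cC (c := c).
have [v sv] := @shadows_ex R G S T a x0 p T_tree x c w (CP _ Cw).
have [v' sv'] := @shadows_ex R G S T a x0 p T_tree x c w' (CP _ Cw').
have rv : rel_morse_boundary c v by case: sv.
(* The set of all shadows of points of [C] is a connected subset containing both. *)
have vv' : connected_component (rel_morse_boundary c) v v'.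
  exists [set v | exists2 w, C w & shadows (c := c) w v]; last by exists w'.
  by split=> //; [exists w|move=> u [u' _ [h _]]].
have vE : v' = v by move: vv'; rewrite (td _ rv).
by apply: ww'; apply: (shadows_inj sv'); rewrite vE.
Qed.
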